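(* Consider the truncated Gaussian prior $\Pi$ on $\Omega$ with constant $\Lambda>0$ (defined in the context). Assume $\|\Sigma^*\|\vee\|\Omega^*\|\le\Lambda=O(1)$ and $\frac{p^3(\log n)^2}{n}=o(1)$. Then $$P_{\Sigma^*}^n\sup_{t\in\mathbb{R}}\left|\Pi\left(\sqrt{\frac{n}{2p}}\,\big(\log\det(\Sigma)-\log\det(\hat\Sigma)\big)\le t\,\Big|\,X^n\right)-\mathbb{P}(Z\le t)\right|\to0,$$ where $\hat\Sigma$ is the sample covariance matrix and $Z\sim N(0,1)$.
   Context: $X^n=(X_1,\dots,X_n)$ are i.i.d. $N(0,\Sigma^* )$ in $\mathbb{R}^p$, $\Omega^*=(\Sigma^* )^{-1}$, $\hat\Sigma=\frac1n\sum_{i=1}^nX_iX_i^T$. For a precision matrix (symmetric positive definite) $\Omega$, write $\Sigma=\Omega^{-1}$. The Gaussian prior $\Pi$ has density $$\frac{d\Pi(\Omega)}{d\Omega}\propto\exp\Big(-\frac12\|\Omega\|_F^2\Big)$$ supported on the set of precision matrices $\{\Omega=\Omega^T,\ \|\Omega\|<2\Lambda,\ \|\Sigma\|\le2\Lambda\}$. The posterior is $\Pi(B|X^n)=\int_B e^{l_n(\Omega)}d\Pi(\Omega)/\int e^{l_n(\Omega)}d\Pi(\Omega)$ with $l_n(\Omega)=\frac n2\log\det(\Omega)-\frac n2\mathrm{tr}(\Omega\hat\Sigma)$. Asymptotics are as $n,p\to\infty$ jointly; $P_{\Sigma^*}^n$ applied to a random variable denotes expectation under the sampling distribution. $\|\cdot\|$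 is the spectral norm, $\|\cdot\|_F$ the Frobenius norm, $a\vee b=\max(a,b)$. *)

(* Defs.v *)
From HB Require Import structures.
From mathcomp Require Import all_boot all_order all_algebra.
From mathcomp Require Import all_classical all_reals all_analysis.

Set Implicit Arguments.
Unset Strict Implicit.
Unset Printing Implicit Defensive.

Import Order.TTheory GRing.Theory Num.Theory.
Import numFieldNormedType.Exports.

Local Open Scope classical_set_scope.
Local Open Scope ring_scope.

Section lebesgue_tuple.
Context {R : realType}.

Definition tuple_of_pair n (x : measurableTypeR R * n.-tuple R) :
    n.+1.-tuple R :=
  [tuple of x.1 :: x.2].

Lemma measurable_tuple_of_pair n : measurable_fun setT (@tuple_of_pair n).
Proof. exact: measurable_cons. Qed.

Section step.
Variables (n : nat) (m : {sigma_finite_measure set (n.-tuple R) -> \bar R}).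

Definition lebesgue_tupleS : set (n.+1.-tuple R) -> \bar R :=
  pushforward (lebesgue_measure \x m)%E (@tuple_of_pair n).

(* pushforward carries a measure structure only for measurable maps *)
Let mu : {measure set (n.+1.-tuple R) -> \bar R} :=
  measure_function_pushforward__canonical__measure_function_Measure
    (lebesgue_measure \x m)%E (@measurable_tuple_of_pair n).

Let lebesgue_tupleS0 : lebesgue_tupleS set0 = 0%E.
Proof. exact: (measure0 mu). Qed.

Let lebesgue_tupleS_ge0 A : (0 <= lebesgue_tupleS A)%E.
Proof. exact: (measure_ge0 mu). Qed.

Let lebesgue_tupleS_sigma_additive : semi_sigma_additive lebesgue_tupleS.
Proof. exact: (@measure_semi_sigma_additive _ _ _ mu). Qed.

HB.instance Definition _ := isMeasure.Build _ _ _ lebesgue_tupleS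
  lebesgue_tupleS0 lebesgue_tupleS_ge0 lebesgue_tupleS_sigma_additive.

Let sigma_finite_lebesgue_tupleS : sigma_finite setT lebesgue_tupleS.
Proof.
have /sigma_finiteP[F [TF ndF Foo]] := sigma_finiteT (@lebesgue_measure R).
have /sigma_finiteP[G [TG ndG Goo]] := sigma_finiteT m.
pose g (t : n.+1.-tuple R) : measurableTypeR R * n.-tuple R :=
  (thead t, [tuple of behead t]).
have mg : measurable_fun setT g.
  apply/measurable_fun_pair; first exact: measurable_tnth.
  exact: measurable_behead.
exists (fun k => g @^-1` (F k `*` G k)).
  rewrite -preimage_bigcup (_ : \bigcup_k _ = setT) ?preimage_setT//.
  rewrite -setXTT TF TG predeqE => -[x y]; split.
    by move=> [k _ []]; split; exists k.
  move=> [/= [i _ Fx] [j _ Gy]]; exists (maxn i j) => //; split.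
    by move: x Fx; exact/subsetPset/ndF/leq_maxl.
  by move: y Gy; exact/subsetPset/ndG/leq_maxr.
move=> k; have [mF Fk] := Foo k; have [mG Gk] := Goo k; split.
  by rewrite -[X in measurable X]setTI; apply: mg => //; exact: measurableX.
rewrite /lebesgue_tupleS /pushforward (_ : _ @^-1` _ = F k `*` G k).
  by rewrite product_measure1E// lte_mul_pinfty// ge0_fin_numE.
apply/seteqP; split => -[x t] /=; rewrite /g /tuple_of_pair /= theadE;
  by rewrite (_ : [tuple of _] = t)//; exact: val_inj.
Qed.

HB.instance Definition _ :=
  @Measure_isSigmaFinite.Build _ _ _ lebesgue_tupleS
    sigma_finite_lebesgue_tupleS.

End step.

(* Lebesgue measure on R^n: the n-fold product, with R^0 a unit point mass. *)
Fixpoint lebesgue_tuple n : {sigma_finite_measure set (n.-tuple R) -> \bar R} :=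
  match n return {sigma_finite_measure set (n.-tuple R) -> \bar R} with
  | 0 => dirac [tuple]
  | n'.+1 => lebesgue_tupleS (lebesgue_tuple n')
  end.

End lebesgue_tuple.

Section matrices.
Context {R : realType}.

Definition colv p (x : p.-tuple R) : 'cV[R]_p := \col_i tnth x i.

Definition posdefmx p (A : 'M[R]_p) : Prop :=
  A^T = A /\ forall x : 'cV[R]_p, x != 0 -> 0 < (x^T *m A *m x) 0 0.

(* On column vectors this is the Euclidean norm. *)
Definition frobenius m n (A : 'M[R]_(m, n)) : R :=
  Num.sqrt (\sum_i \sum_j A i j ^+ 2).

Definition spectral_norm m n (A : 'M[R]_(m, n)) : R :=
  sup [set frobenius (A *m x) | x in [set x : 'cV[R]_n | frobenius x <= 1]].

(* Linear coordinates on symmetric matrices: the entry (i, j) with i <= j < p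
   is stored at position 'C(j.+1, 2) + i (upper triangle, column by column),
   which enumerates 0, ..., 'C(p.+1, 2) - 1 without repetition.  The measure
   dOmega on symmetric matrices is the Lebesgue measure in these coordinates. *)
Definition symmx p (v : 'C(p.+1, 2).-tuple R) : 'M[R]_p :=
  \matrix_(i, j) nth 0 v ('C((maxn i j).+1, 2) + minn i j)%N.

End matrices.

Section probability.
Context {R : realType}.

Definition mutually_independent d d' (T : measurableType d)
    (T' : measurableType d') (P : probability T R) (I : finType)
    (X : I -> {RV P >-> T'}) : Prop :=
  forall (J : {set I}) (A : I -> set T'), (forall i, measurable (A i)) ->
    P (\bigcap_(i in [set` J]) (X i @^-1` A i)) =
    (\prod_(i in J) P (X i @^-1` A i))%E.

Definition mvnormal_pdf p (Sigma : 'M[R]_p) (x : p.-tuple R) : R :=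
  (Num.sqrt ((2 * pi) ^+ p * \det Sigma))^-1 *
  expR (- ((colv x)^T *m invmx Sigma *m colv x) 0 0 / 2).

(* N(0, Sigma), for positive definite Sigma *)
Definition mvnormal_prob p (Sigma : 'M[R]_p) (A : set (p.-tuple R)) : \bar R :=
  (\int[lebesgue_tuple p]_(x in A) (mvnormal_pdf Sigma x)%:E)%E.

Definition iid_mvnormal d (T : measurableType d) (P : probability T R) n p
    (X : 'I_n -> {RV P >-> p.-tuple R}) (Sigma : 'M[R]_p) : Prop :=
  mutually_independent X /\
  forall i A, measurable A -> distribution P (X i) A = mvnormal_prob Sigma A.

End probability.

Section posterior.
Context {R : realType}.

Definition sample_cov n p (x : 'I_n -> p.-tuple R) : 'M[R]_p :=
  n%:R^-1 *: \sum_i colv (x i) *m (colv (x i))^T.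

Definition loglik n p (x : 'I_n -> p.-tuple R) (Omega : 'M[R]_p) : R :=
  n%:R / 2 * ln (\det Omega) - n%:R / 2 * \tr (Omega *m sample_cov x).

Definition prior_support p (Lam : R) : set 'M[R]_p :=
  [set Omega | posdefmx Omega /\ spectral_norm Omega < 2 * Lam /\
               spectral_norm (invmx Omega) <= 2 * Lam].

Definition prior_weight p (Lam : R) (Omega : 'M[R]_p) : R :=
  \1_(prior_support Lam) Omega * expR (- frobenius Omega ^+ 2 / 2).

(* Density of the prior with respect to dOmega.  Rescaling dOmega by a constant
   (another choice of linear coordinates) leaves the prior unchanged. *)
Definition prior_pdf p (Lam : R) (Omega : 'M[R]_p) : R :=
  prior_weight Lam Omega /
  \int[lebesgue_tuple 'C(p.+1, 2)]_v prior_weight Lam (symmx v).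

(* the integral of f over B with respect to the prior Pi *)
Definition prior_int p (Lam : R) (B : set 'M[R]_p) (f : 'M[R]_p -> R) : R :=
  \int[lebesgue_tuple 'C(p.+1, 2)]_(v in @symmx R p @^-1` B)
    (f (symmx v) * prior_pdf Lam (symmx v)).

Definition posterior n p (Lam : R) (x : 'I_n -> p.-tuple R)
    (B : set 'M[R]_p) : R :=
  prior_int Lam B (fun Omega => expR (loglik x Omega)) /
  prior_int Lam setT (fun Omega => expR (loglik x Omega)).

End posterior.

(* Main.v *)
Require Import Defs.
From HB Require Import structures.
From mathcomp Require Import all_boot all_order all_algebra.
From mathcomp Require Import all_classical all_reals all_analysis.
From mathcomp Require Import measurable_realfun ring lra zify.

(** Up to factors close to one the posterior is an explicit density, for which
    the log-determinant can be traded for a trace with an explicit law.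

    Completing the square in the prior around the true precision Omega*, the
    likelihood times the prior is, up to a constant, the Wishart-type density
    det(Omega)^(n/2) exp(- n/2 tr(Omega St)) with St = S + (2/n) Omega*, S being
    the sample covariance, times the indicator of the prior support and
    exp(- |Omega - Omega*|^2 / 2) ([posterior_tilt]).  Let St = V^T V and
    Omega* = U^T U be Cholesky factorizations.  Then |V Omega V^T - 1|^2 under
    the Wishart-type density, and |U S U^T - 1|^2 under the sampling
    distribution, have expectation O(p^2 / n) ([wishart_moment],
    [sampling_moment]): both Laplace transforms are powers of a determinant, by
    triangular changes of variables, and bound the exponential moments of each
    entry at the scale sqrt n ([second_moment]).  So both are at most
    eta^2 = p^2 ln n / n up to a probability O(1 / ln n).  When they are, Omega
    lies in the prior support and |Omega - Omega*|^2 = O(eta^2) ([near_truth]);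
    hence posterior probabilities differ from Wishart ones by
    O(eta^2 + 1 / ln n) ([density_sandwich]).

    On the same event the eigenvalues of V Omega V^T are so close to 1 that
    p ln(T / p) - ln det(V Omega V^T), T = tr(Omega St), is at most 2 eta^2
    ([amgm_gap]), while ln det St - ln det S = O(p / n) ([ln_det_tilt]).  The
    statistic is therefore - sqrt(n p / 2) ln(T / p) up to an error of order
    sqrt(n / p) eta^2 = sqrt(p^3 (ln n)^2 / n), which tends to 0
    ([stat_near_trace]).  The Wishart-type density being homogeneous, T has
    exactly a gamma law ([trace_law]), and a centred and scaled logarithm of a
    gamma variable of large shape is nearly standard normal, uniformly over
    half-lines ([log_gamma_normal]).

    These bounds hold on the good sampling event ([posterior_cdf]); elsewhere
    the deviation is at most 1, which contributes O(1 / ln n) to the expectation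
    ([expected_deviation]). *)

Set Implicit Arguments.
Unset Strict Implicit.
Unset Printing Implicit Defensive.

Import Order.TTheory GRing.Theory Num.Theory.
Import numFieldNormedType.Exports.

Local Open Scope classical_set_scope.
Local Open Scope ring_scope.

(** * Integrals of nonnegative functions *)

Section integral_monotone.
Context d (T : measurableType d) (R : realType).
Local Open Scope ereal_scope.
Implicit Types (mu : {measure set T -> \bar R}) (D E : set T).

(** The integral of a nonnegative function is a supremum over the simple
    functions below it, hence monotone on arbitrary functions; this is what
    lets the sets and weights of the posterior be merely sandwiched. *)
Lemma ge0_le_integral_sub mu D E (f g : T -> \bar R) :
  (forall x, D x -> 0 <= f x) -> (forall x, E x -> 0 <= g x) ->
  D `<=` E -> (forall x, D x -> f x <= g x) ->
  \int[mu]_(x in D) f x <= \int[mu]_(x in E) g x.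
Proof.
move=> f0 g0 DE fg; rewrite (integral_mkcond D) (integral_mkcond E).
have h1 x : 0 <= (f \_ D) x by exact: erestrict_ge0.
have h2 x : 0 <= (g \_ E) x by exact: erestrict_ge0.
rewrite !ge0_integralTE//; apply: le_ereal_sup => _ [h hf <-].
exists h => // x; rewrite (le_trans (hf x))//.
rewrite !patchE; case: ifPn => [xD|_].
  by have Dx := set_mem xD; rewrite (mem_set (DE _ Dx)) fg.
by case: ifPn => // xE; apply: g0; exact: set_mem.
Qed.

Lemma ge0_le_integral_nomeas mu (f g : T -> \bar R) :
  (forall x, 0 <= f x) -> (forall x, f x <= g x) ->
  \int[mu]_x f x <= \int[mu]_x g x.
Proof.
move=> f0 fg; apply: ge0_le_integral_sub => // x _.
exact: le_trans (fg x).
Qed.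

Lemma integral_scale mu (k : R) (f : T -> R) : (0 <= k)%R ->
  measurable_fun [set: T] f -> (forall x, (0 <= f x)%R) ->
  \int[mu]_x (k * f x)%:E = k%:E * \int[mu]_x (f x)%:E.
Proof.
move=> k0 mf f0; under eq_integral do rewrite EFinM.
rewrite ge0_integralZl_EFin//; first by move=> x _; rewrite lee_fin.
exact/measurable_EFinP.
Qed.

End integral_monotone.

Section transfer.
Context d d' (T : measurableType d) (T' : measurableType d') (R : realType).
Variables (mu : {measure set T -> \bar R}) (nu : {measure set T' -> \bar R}).
Variables (X : T -> T') (H : T -> R) (w : T' -> R).
Hypotheses (mX : measurable_fun [set: T] X) (mH : measurable_fun [set: T] H).
Hypotheses (mw : measurable_fun [set: T'] w).
Hypotheses (H0 : forall x, 0 <= H x) (w0 : forall y, 0 <= w y).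
Hypothesis XHw : forall A, measurable A ->
  (\int[mu]_(x in X @^-1` A) (H x)%:E = \int[nu]_(y in A) (w y)%:E)%E.
Import HBNNSimple.
Local Open Scope ereal_scope.

Let transfer_nnsfun (h : {nnsfun T' >-> R}) :
  \int[mu]_x ((H x)%:E * (h (X x))%:E) = \int[nu]_y ((w y)%:E * (h y)%:E).
Proof.
have mh r : measurable (h @^-1` [set r]).
  by [].
have mI r : measurable_fun setT
    (fun y => (r * \1_(h @^-1` [set r]) y)%:E : \bar R).
  by apply/measurable_EFinP; apply: measurable_funM => //.
have hE y : (h y)%:E =
    \sum_(r \in range h) (r * \1_(h @^-1` [set r]) y)%:E.
  by rewrite fsumEFin// -fimfunE.
have hT r : range h r -> (0 <= r)%R by case=> y _ <-; exact: fun_ge0.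
have fin := @fimfunP _ _ h.
have pos r y : 0 <= ((r * \1_(h @^-1` [set r]) y)%:E : \bar R).
  rewrite lee_fin; have [r0|r0] := leP 0%R r; first by rewrite mulr_ge0.
  rewrite [X in (_ <= _ * X)%R](_ : _ = 0%R) ?mulr0//.
  rewrite indicE; apply/eqP; rewrite pnatr_eq0 eqb0; apply/negP.
  by rewrite inE /= => hy; have : (0 <= h y)%R by []; rewrite hy leNgt r0.
transitivity (\int[mu]_x \sum_(r \in range h)
    ((H x)%:E * (r * \1_(h @^-1` [set r]) (X x))%:E)).
  apply: eq_integral => x _; rewrite hE ge0_mule_fsumr//.
rewrite ge0_integral_fsum//; last 2 first.
- move=> r; apply: emeasurable_funM; first exact/measurable_EFinP.
  exact: (measurableT_comp (mI r) mX).
- by move=> r x _; rewrite mule_ge0// lee_fin.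
transitivity (\int[nu]_y \sum_(r \in range h)
    ((w y)%:E * (r * \1_(h @^-1` [set r]) y)%:E)); last first.
  by apply: eq_integral => x _; rewrite hE ge0_mule_fsumr.
rewrite ge0_integral_fsum//; last 2 first.
- by move=> r; apply: emeasurable_funM => //; exact/measurable_EFinP.
- by move=> r x _; rewrite mule_ge0// lee_fin.
apply: eq_fsbigr => r /set_mem rh.
have mXr : measurable (X @^-1` (h @^-1` [set r])).
  by rewrite -[X in measurable X]setTI; exact: mX.
have key (S : set T') (y : T') (z : \bar R) :
    z * (r * \1_S y)%:E = r%:E * (z * (\1_S y)%:E).
  by rewrite EFinM muleCA.
under eq_integral do rewrite key.
under [RHS]eq_integral do rewrite key.
rewrite !ge0_integralZl_EFin ?hT//; last 4 first.
- by move=> y _; rewrite mule_ge0// lee_fin.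
- by apply: emeasurable_funM; [exact/measurable_EFinP|]; exact/measurable_EFinP.
- by move=> y _; rewrite mule_ge0// lee_fin.
- apply: emeasurable_funM; [exact/measurable_EFinP|]; apply/measurable_EFinP.
  by apply: (measurableT_comp _ mX); exact: measurable_indic.
congr *%E; transitivity (\int[mu]_(x in X @^-1` (h @^-1` [set r])) (H x)%:E).
  by rewrite [RHS]integral_mkcond epatch_indic.
by rewrite XHw// [LHS]integral_mkcond epatch_indic.
Qed.

(** An identity between weighted measures tested on sets extends to all
    nonnegative functions.  It is used for laws with a density and, with
    [H] a product of functions of other variables, for independence. *)
Lemma transfer_integral (f : T' -> \bar R) :
  measurable_fun setT f -> (forall y, 0 <= f y) ->
  \int[mu]_x ((H x)%:E * f (X x)) = \int[nu]_y ((w y)%:E * f y).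
Proof.
move=> mf f0.
pose h := nnsfun_approx measurableT mf.
have h_nd y : {homo (fun n => (h n y)%:E) : a b / (a <= b)%N >-> a <= b}.
  by move=> a b ab; rewrite lee_fin; exact/lefP/nd_nnsfun_approx.
have mul_cvg (k : R) y : (k%:E * (h n y)%:E) @[n --> \oo] --> k%:E * f y.
  by apply: cvgeZl => //; exact: cvg_nnsfun_approx.
transitivity (limn (fun n => \int[mu]_x ((H x)%:E * (h n (X x))%:E))).
  rewrite -monotone_convergence//.
  - by apply: eq_integral => x _; apply/esym/cvg_lim => //; exact: mul_cvg.
  - move=> n; apply: emeasurable_funM; [exact/measurable_EFinP|]; apply/measurable_EFinP.
    by apply: measurableT_comp.
  - by move=> n x _; rewrite mule_ge0// lee_fin.
  - by move=> x _ a b ab; apply: lee_wpmul2l; [rewrite lee_fin|exact: h_nd].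
transitivity (limn (fun n => \int[nu]_y ((w y)%:E * (h n y)%:E))); last first.
  rewrite -monotone_convergence//.
  - by apply: eq_integral => x _; apply/cvg_lim => //; exact: mul_cvg.
  - move=> n; apply: emeasurable_funM; [exact/measurable_EFinP|]; exact/measurable_EFinP.
  - by move=> n x _; rewrite mule_ge0// lee_fin.
  - by move=> x _ a b ab; apply: lee_wpmul2l; [rewrite lee_fin|exact: h_nd].
by congr (limn _); apply/funext => n; exact: transfer_nnsfun.
Qed.

End transfer.

(** * Lebesgue measure on tuples *)

Section lebesgue_affine.
Context {R : realType}.
Local Notation lambda := (@lebesgue_measure R).

Let aff (a b : R) (x : measurableTypeR R) : measurableTypeR R := a * x + b.

Let maff a b : measurable_fun setT (aff a b).
Proof. by apply: measurable_funD => //; exact: measurable_funM. Qed.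

Let affM a b : {measure set (measurableTypeR R) -> \bar R} :=
  measure_function_pushforward__canonical__measure_function_Measure
    lambda (@maff a b).

Lemma integral_affine (a b : R) (f : R -> \bar R) : 0 < a ->
  measurable_fun setT f -> (forall x, (0 <= f x)%E) ->
  (\int[lambda]_x f (a * x + b)%R = (a^-1)%:E * \int[lambda]_x f x)%E.
Proof.
move=> a0 mf f0; have an0 : a != 0 by rewrite gt_eqF.
pose k := NngNum (ltW a0).
have pf : (\int[affM a b]_x f x = \int[lambda]_x f (a * x + b)%R)%E.
  rewrite (@ge0_integral_pushforward _ _ (measurableTypeR R) (measurableTypeR R)
    R (aff a b) (maff a b) lambda setT f)//.
have E A : measurable A -> lambda A = mscale k (affM a b) A.
  apply: lebesgue_measure_unique => _ [[x y] _ <-] /=.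
  rewrite /mscale /= /pushforward.
  rewrite (_ : aff a b @^-1` _ = `](x - b) / a, (y - b) / a]%classic); last first.
    apply/seteqP; split => z /=; rewrite /aff !in_itv /= => /andP[h1 h2];
      apply/andP; split; move: h1 h2;
      by rewrite ?ltr_pdivrMr// ?ler_pdivlMr// ?ltrBlDr ?lerBrDr mulrC.
  rewrite !lebesgue_measure_itv /= !lte_fin ltr_pM2r ?invr_gt0// ltrD2r.
  case: ifP => _; last by rewrite mule0.
  rewrite -!EFinD -EFinM; congr EFin; field.
  exact: an0.
have -> : (\int[lambda]_x f x = \int[mscale k (affM a b)]_x f x)%E.
  by apply: eq_measure_integral => A mA _; exact: E.
rewrite ge0_integral_mscale// pf muleA -EFinM mulVf// mul1e//.
Qed.

End lebesgue_affine.

Section lebesgue_tuple_theory.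
Context {R : realType}.
Local Notation lambda := (@lebesgue_measure R).
Local Open Scope ereal_scope.

Lemma measurable_tuple_of_pair2 n (x : R) :
  measurable_fun setT (fun v : n.-tuple R => tuple_of_pair (x, v)).
Proof.
have := @measurable_cons _ _ (n.-tuple R) R (cst x) n id.
by apply => //; exact: measurable_cst.
Qed.

Lemma integral_lebesgue_tupleS n (f : n.+1.-tuple R -> \bar R) :
  measurable_fun setT f -> (forall v, 0 <= f v) ->
  \int[lebesgue_tuple n.+1]_v f v =
  \int[lambda]_x \int[lebesgue_tuple n]_v f (tuple_of_pair (x, v)).
Proof.
move=> mf f0.
pose pf : {measure set (n.+1.-tuple R) -> \bar R} :=
  measure_function_pushforward__canonical__measure_function_Measure
    (lambda \x lebesgue_tuple n) (@measurable_tuple_of_pair R n).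
transitivity (\int[pf]_v f v); first exact: eq_measure_integral.
rewrite (@ge0_integral_pushforward _ _ _ _ R (@tuple_of_pair R n)
  (@measurable_tuple_of_pair R n) (lambda \x lebesgue_tuple n) setT f)//.
rewrite preimage_setT fubini_tonelli1//; last by move=> x; exact: f0.
apply: measurableT_comp => //; exact: measurable_tuple_of_pair.
Qed.

Lemma measurable_integral_tuple n (f : n.+1.-tuple R -> \bar R) :
  measurable_fun setT f -> (forall v, 0 <= f v) ->
  measurable_fun [set: R]
    (fun x => \int[lebesgue_tuple n]_v f (tuple_of_pair (x, v))).
Proof.
move=> mf f0; have := @measurable_fun_fubini_tonelli_F _ _ (measurableTypeR R)
  (n.-tuple R) R (lebesgue_tuple n) (f \o @tuple_of_pair R n).
apply; last by move=> x; exact: f0.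
apply: measurableT_comp => //; exact: measurable_tuple_of_pair.
Qed.

Lemma integral_lebesgue_tuple0 (f : 0.-tuple R -> \bar R) :
  measurable_fun setT f -> \int[lebesgue_tuple 0]_v f v = f [tuple].
Proof. by move=> mf; rewrite integral_dirac//= ?diracT ?mul1e. Qed.

Lemma tnth_tuple_of_pair0 n (x : R) (v : n.-tuple R) :
  tnth (tuple_of_pair (x, v)) ord0 = x.
Proof. by []. Qed.

Lemma tnth_tuple_of_pairS n (x : R) (v : n.-tuple R) i :
  tnth (tuple_of_pair (x, v)) (lift ord0 i) = tnth v i.
Proof. by rewrite !(tnth_nth 0%R). Qed.

Lemma integral_prod_lebesgue_tuple n (h : nat -> R -> R) :
  (forall i, measurable_fun setT (h i)) -> (forall i x, (0 <= h i x)%R) ->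
  \int[lebesgue_tuple n]_v (\prod_(i < n) h i (tnth v i))%:E =
  \prod_(i < n) \int[lambda]_x (h i x)%:E.
Proof.
move=> mh h0.
have mprod m (g : nat -> R -> R) : (forall i, measurable_fun setT (g i)) ->
    measurable_fun setT
      (fun v : m.-tuple R => (\prod_(i < m) g i (tnth v i))%:E : \bar R).
  move=> mg; apply/measurable_EFinP; apply: measurable_prod => i _.
  exact: (measurableT_comp (mg i) (measurable_tnth i)).
elim: n h mh h0 => [|n IH] h mh h0.
  by rewrite integral_lebesgue_tuple0 ?big_ord0//; exact: mprod.
rewrite integral_lebesgue_tupleS; last 2 first.
- exact: mprod.
- by move=> v; rewrite lee_fin; exact: prodr_ge0.
under eq_integral => x _.
  under eq_integral => v _.
    rewrite big_ord_recl tnth_tuple_of_pair0 EFinM.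
    under eq_bigr do rewrite tnth_tuple_of_pairS.
    over.
  rewrite ge0_integralZl_EFin//=; last 2 first.
  - by move=> v _; rewrite lee_fin; apply: prodr_ge0 => i _; exact: (h0 i.+1).
  - exact: (mprod n (fun i => h i.+1)).
  rewrite (IH (fun i => h i.+1))//.
  rewrite muleC.
  over.
have mh0 : measurable_fun [set: R] (fun x => (h 0%N x)%:E).
  exact/measurable_EFinP.
rewrite /= ge0_integralZl//; last 2 first.
- by move=> x _; rewrite lee_fin.
- by apply: prode_ge0 => i _; apply: integral_ge0 => x _; rewrite lee_fin.
by rewrite muleC big_ord_recl.
Qed.

(** A triangular substitution is integrated out one coordinate at a time: given
    the earlier coordinates, each coordinate undergoes an affine map of slope
    [a i].  The shifts [c i] depend on the earlier coordinates only, so the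
    Jacobian is the product of the slopes. *)
Lemma integral_triangular n (a : nat -> R) (c : nat -> seq R -> R)
    (phi : n.-tuple R -> n.-tuple R) (f : n.-tuple R -> \bar R) :
  (forall i, (0 < a i)%R) -> measurable_fun setT phi ->
  (forall v i, tnth (phi v) i = a i * tnth v i + c i (take i v))%R ->
  measurable_fun setT f -> (forall v, 0 <= f v) ->
  \int[lebesgue_tuple n]_v f (phi v) =
  ((\prod_(i < n) a i)^-1)%:E * \int[lebesgue_tuple n]_v f v.
Proof.
move=> + + + mf f0.
elim: n a c phi f mf f0 => [|n IH] a c phi f mf f0 a0 mphi phiE.
  rewrite !integral_lebesgue_tuple0//; last exact: measurableT_comp.
  by rewrite big_ord0 invr1 mul1e; congr f; rewrite (tuple0 (phi _)).
rewrite !integral_lebesgue_tupleS//; last exact: measurableT_comp.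
pose psi x (v : n.-tuple R) : n.-tuple R :=
  [tuple of behead (phi (tuple_of_pair (x, v)))].
pose F y := \int[lebesgue_tuple n]_v f (tuple_of_pair (y, v)).
have phi_psi x v :
    phi (tuple_of_pair (x, v)) = tuple_of_pair (a 0%N * x + c 0%N [::], psi x v)%R.
  apply: eq_from_tnth => i; case: (unliftP ord0 i) => [j ->|->].
    by rewrite tnth_tuple_of_pairS !(tnth_nth 0%R) /= nth_behead.
  by rewrite phiE !tnth_tuple_of_pair0 take0.
have psiE x v i : tnth (psi x v) i =
    (a i.+1 * tnth v i + c i.+1 (x :: take i v))%R.
  have := phiE (tuple_of_pair (x, v)) (lift ord0 i).
  by rewrite phi_psi !tnth_tuple_of_pairS.
have inner x : \int[lebesgue_tuple n]_v f (phi (tuple_of_pair (x, v))) =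
    ((\prod_(i < n) a i.+1)^-1)%:E * F (a 0%N * x + c 0%N [::])%R.
  under eq_integral do rewrite phi_psi.
  apply: (IH (fun i => a i.+1) (fun i s => c i.+1 (x :: s)) (psi x)
    (fun v => f (tuple_of_pair (a 0%N * x + c 0%N [::], v)%R))) => //.
  - by apply: measurableT_comp => //; exact: measurable_tuple_of_pair2.
  - apply: (@measurableT_comp _ _ _ _ _ _
      (fun v : n.+1.-tuple R => [tuple of behead v]) _
      (fun v => phi (tuple_of_pair (x, v)))).
      exact: measurable_behead.
    by apply: measurableT_comp => //; exact: measurable_tuple_of_pair2.
under eq_integral do rewrite inner.
have mF : measurable_fun [set: R] F by exact: measurable_integral_tuple.
have F0 y : 0 <= F y by exact: integral_ge0.
rewrite ge0_integralZl_EFin//; last 2 first.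
- apply: measurableT_comp => //; exact: measurable_funD.
- by rewrite invr_ge0; apply: prodr_ge0 => i _; exact: ltW.
rewrite integral_affine// muleA -EFinM big_ord_recl invfM mulrC.
by congr (_ * _).
Qed.

End lebesgue_tuple_theory.

(** * Positive definite matrices *)

Section quadratic_forms.
Context {R : realType}.

(** Square of the Frobenius norm, and of the Euclidean norm on columns. *)
Definition nsq m n (A : 'M[R]_(m, n)) : R := \sum_i \sum_j A i j ^+ 2.

Definition qf p (A : 'M[R]_p) (x : 'cV[R]_p) : R := (x^T *m A *m x) 0 0.

Definition dot p (x y : 'cV[R]_p) : R := (x^T *m y) 0 0.

Lemma nsq_ge0 m n (A : 'M[R]_(m, n)) : 0 <= nsq A.
Proof. by apply: sumr_ge0 => i _; apply: sumr_ge0 => j _; exact: sqr_ge0. Qed.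

Lemma nsq_eq0 m n (A : 'M[R]_(m, n)) : nsq A = 0 -> A = 0.
Proof.
move=> /eqP; rewrite psumr_eq0; last first.
  by move=> i _; apply: sumr_ge0 => j _; exact: sqr_ge0.
move=> /allP h; apply/matrixP => i j; rewrite mxE.
have := h i (mem_index_enum _); rewrite /= psumr_eq0; last first.
  by move=> k _; exact: sqr_ge0.
by move=> /allP /(_ j (mem_index_enum _)) /=; rewrite sqrf_eq0 => /eqP.
Qed.

Lemma nsq_gt0 m n (A : 'M[R]_(m, n)) : A != 0 -> 0 < nsq A.
Proof.
by move=> A0; rewrite lt_def nsq_ge0 andbT; apply: contra A0 => /eqP/nsq_eq0 ->.
Qed.

Lemma nsq_tr m n (A : 'M[R]_(m, n)) : nsq A^T = nsq A.
Proof.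
rewrite /nsq exchange_big; apply: eq_bigr => i _; apply: eq_bigr => j _.
by rewrite mxE.
Qed.

Lemma nsq_trace m n (A : 'M[R]_(m, n)) : nsq A = \tr (A^T *m A).
Proof.
rewrite -nsq_tr /nsq /mxtrace; apply: eq_bigr => i _; rewrite mxE.
by apply: eq_bigr => j _; rewrite !mxE expr2.
Qed.

Lemma nsqZ m n (a : R) (A : 'M[R]_(m, n)) : nsq (a *: A) = a ^+ 2 * nsq A.
Proof.
rewrite /nsq mulr_sumr; apply: eq_bigr => i _; rewrite mulr_sumr.
by apply: eq_bigr => j _; rewrite mxE exprMn.
Qed.

Lemma nsqN m n (A : 'M[R]_(m, n)) : nsq (- A) = nsq A.
Proof. by rewrite -scaleN1r nsqZ sqrrN expr1n mul1r. Qed.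

Lemma nsq_add_le m n (A B : 'M[R]_(m, n)) :
  nsq (A + B) <= 2 * nsq A + 2 * nsq B.
Proof.
rewrite /nsq !mulr_sumr -big_split ler_sum// => i _.
rewrite !mulr_sumr -big_split ler_sum// => j _ /=; rewrite mxE.
have := sqr_ge0 (A i j - B i j); lra.
Qed.

Lemma frobenius_sqr m n (A : 'M[R]_(m, n)) : frobenius A ^+ 2 = nsq A.
Proof. by rewrite /frobenius sqr_sqrtr// nsq_ge0. Qed.

Lemma frobenius_ge0 m n (A : 'M[R]_(m, n)) : 0 <= frobenius A.
Proof. exact: sqrtr_ge0. Qed.

Lemma nsq_dot p (x : 'cV[R]_p) : nsq x = dot x x.
Proof. by rewrite nsq_trace /mxtrace big_ord1. Qed.

Lemma nsq_col m n (A : 'M[R]_(m, n)) : nsq A = \sum_j nsq (col j A).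
Proof.
rewrite /nsq exchange_big; apply: eq_bigr => j _; apply: eq_bigr => i _.
by rewrite big_ord1 mxE.
Qed.

Lemma dotC p (x y : 'cV[R]_p) : dot x y = dot y x.
Proof. by rewrite /dot -[x^T *m y]trmxK trmx_mul trmxK mxE. Qed.

Lemma dotDl p (x y z : 'cV[R]_p) : dot (x + y) z = dot x z + dot y z.
Proof. by rewrite /dot raddfD mulmxDl mxE. Qed.

Lemma dotZl p a (x z : 'cV[R]_p) : dot (a *: x) z = a * dot x z.
Proof. by rewrite /dot linearZ -scalemxAl mxE. Qed.

Lemma dotDr p (x y z : 'cV[R]_p) : dot z (x + y) = dot z x + dot z y.
Proof. by rewrite dotC dotDl !(dotC z). Qed.

Lemma dotZr p a (x z : 'cV[R]_p) : dot z (a *: x) = a * dot z x.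
Proof. by rewrite dotC dotZl dotC. Qed.

Lemma dot_mulmx m n (A : 'M[R]_(m, n)) (x : 'cV[R]_m) (y : 'cV[R]_n) :
  dot x (A *m y) = dot (A^T *m x) y.
Proof. by rewrite /dot trmx_mul trmxK mulmxA. Qed.

Lemma qf_dot p (A : 'M[R]_p) x : qf A x = dot x (A *m x).
Proof. by rewrite /qf /dot mulmxA. Qed.

Lemma cauchy_schwarz_dot p (x y : 'cV[R]_p) : dot x y ^+ 2 <= nsq x * nsq y.
Proof.
have [y0|y0] := eqVneq y 0.
  by rewrite y0 /dot mulmx0 mxE expr0n mulr_ge0// nsq_ge0.
have ny := nsq_gt0 y0.
have := nsq_ge0 (nsq y *: x + (- dot x y) *: y).
rewrite [nsq (_ + _)]nsq_dot !(dotDl, dotDr, dotZl, dotZr) -!nsq_dot (dotC y x).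
move=> h; rewrite -subr_ge0 -(pmulr_rge0 _ ny); nra.
Qed.

Lemma qfD p (A B : 'M[R]_p) x : qf (A + B) x = qf A x + qf B x.
Proof. by rewrite /qf mulmxDr mulmxDl mxE. Qed.

Lemma qfZ p a (A : 'M[R]_p) x : qf (a *: A) x = a * qf A x.
Proof. by rewrite /qf -scalemxAr -scalemxAl mxE. Qed.

Lemma qfN p (A : 'M[R]_p) x : qf (- A) x = - qf A x.
Proof. by rewrite -scaleN1r qfZ mulN1r. Qed.

Lemma qf1 p (x : 'cV[R]_p) : qf 1%:M x = nsq x.
Proof. by rewrite /qf mulmx1 nsq_dot. Qed.

Lemma qf_congr m n (B : 'M[R]_(m, n)) (A : 'M[R]_m) x :
  qf (B^T *m A *m B) x = qf A (B *m x).
Proof. by rewrite /qf trmx_mul !mulmxA. Qed.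

Lemma qf_gram m n (B : 'M[R]_(m, n)) x : qf (B^T *m B) x = nsq (B *m x).
Proof. by rewrite -[X in X *m B]mulmx1 qf_congr qf1. Qed.

Lemma qf_delta p (A : 'M[R]_p) i : qf A (delta_mx i 0) = A i i.
Proof. by rewrite /qf trmx_delta -rowE -colE !mxE. Qed.

Lemma nsq_mulmx_le m n k (A : 'M[R]_(m, n)) (B : 'M[R]_(n, k)) :
  nsq (A *m B) <= nsq A * nsq B.
Proof.
rewrite (nsq_col B) /nsq mulr_suml ler_sum// => i _.
rewrite mulr_sumr ler_sum// => j _.
have -> : (A *m B) i j = dot (row i A)^T (col j B).
  by rewrite /dot trmxK -row_mul !mxE; apply: eq_bigr => l _; rewrite !mxE.
rewrite (le_trans (cauchy_schwarz_dot _ _))// nsq_tr.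
by rewrite /nsq big_ord1; under eq_bigr do rewrite mxE.
Qed.

(** The Frobenius norm dominates the operator norm. *)
Lemma qf_le_nsq p (A : 'M[R]_p) e x :
  0 <= e -> nsq A <= e ^+ 2 -> `|qf A x| <= e * nsq x.
Proof.
move=> e0 Ae; rewrite -(@ler_pXn2r _ 2)// ?nnegrE ?normr_ge0 ?mulr_ge0 ?nsq_ge0//.
rewrite real_normK ?num_real// qf_dot (le_trans (cauchy_schwarz_dot _ _))//.
have := nsq_mulmx_le A x; have := nsq_ge0 x; have := nsq_ge0 A; nra.
Qed.

(** A bound on an operator norm, expressed on vectors, passes to Frobenius norms
    column by column. *)
Lemma opb_mulmx m n k (A : 'M[R]_(m, n)) (B : 'M[R]_(n, k)) c :
  (forall x : 'cV_n, nsq (A *m x) <= c * nsq x) -> nsq (A *m B) <= c * nsq B.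
Proof.
move=> Ac; rewrite !nsq_col mulr_sumr ler_sum// => j _.
by rewrite !colE -mulmxA; exact: Ac.
Qed.

Lemma opb_tr m n (A : 'M[R]_(m, n)) c : 0 <= c ->
  (forall x : 'cV_n, nsq (A *m x) <= c * nsq x) ->
  forall x : 'cV_m, nsq (A^T *m x) <= c * nsq x.
Proof.
move=> c0 Ac x; set y := A^T *m x.
have [y0|y0] := eqVneq y 0.
  by rewrite y0 nsq_dot /dot mulmx0 mxE mulr_ge0// nsq_ge0.
have ny := nsq_gt0 y0; rewrite -(ler_pM2r ny) -expr2.
have -> : nsq y = dot x (A *m y) by rewrite dot_mulmx -nsq_dot.
rewrite (le_trans (cauchy_schwarz_dot _ _))// [leRHS]mulrAC mulrC.
by rewrite dot_mulmx -nsq_dot -/y ler_wpM2r ?nsq_ge0.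
Qed.

End quadratic_forms.

Section posdef.
Context {R : realType}.

(** The triangular Cholesky factors: a lower triangular L acts on vectors, and
    by congruence on symmetric matrices, by triangular substitutions, which are
    the ones that can be integrated coordinate by coordinate. *)
Definition posdiag p (L : 'M[R]_p) := is_trig_mx L /\ forall i, 0 < L i i.

Lemma posdef_qf p (A : 'M[R]_p) x : posdefmx A -> x != 0 -> 0 < qf A x.
Proof. by case=> _ h /h. Qed.

Lemma posdef_qf_ge0 p (A : 'M[R]_p) x : posdefmx A -> 0 <= qf A x.
Proof.
move=> pA; have [->|x0] := eqVneq x 0; last exact/ltW/posdef_qf.
by rewrite /qf mulmx0 mxE.
Qed.

Lemma posdef_unit p (A : 'M[R]_p) : posdefmx A -> A \in unitmx.
Proof.
move=> [sA pA]; rewrite unitmxE unitfE; apply/negP => /det0P [v v0 vA].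
have vT0 : v^T != 0 by apply: contra v0 => /eqP h; rewrite -(trmxK v) h trmx0.
by have := pA _ vT0; rewrite trmxK vA mul0mx mxE ltxx.
Qed.

Lemma gram_sym m n (B : 'M[R]_(m, n)) : (B^T *m B)^T = B^T *m B.
Proof. by rewrite trmx_mul trmxK. Qed.

Lemma congr_sym m n (A : 'M[R]_m) (B : 'M[R]_(m, n)) :
  A^T = A -> (B^T *m A *m B)^T = B^T *m A *m B.
Proof. by move=> sA; rewrite !trmx_mul trmxK sA mulmxA. Qed.

Lemma posdef_congr p (A B : 'M[R]_p) : B \in unitmx -> posdefmx A ->
  posdefmx (B^T *m A *m B).
Proof.
move=> uB [sA pA]; split; first exact: congr_sym.
move=> x x0; rewrite -[X in 0 < X]/(qf _ x) qf_congr; apply: pA.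
by apply: contra x0 => /eqP Bx; rewrite -(mulKmx uB x) Bx mulmx0.
Qed.

Lemma posdef1 p : posdefmx (1%:M : 'M[R]_p).
Proof.
split; first by rewrite trmx1.
by move=> x x0; rewrite -[X in 0 < X]/(qf _ x) qf1 nsq_gt0.
Qed.

Lemma posdefD p (A B : 'M[R]_p) : posdefmx A -> posdefmx B -> posdefmx (A + B).
Proof.
move=> [sA pA] [sB pB]; split; first by rewrite raddfD/= sA sB.
by move=> x x0; rewrite -[X in 0 < X]/(qf _ x) qfD addr_gt0//; [exact: pA|exact: pB].
Qed.

Lemma posdefZ p a (A : 'M[R]_p) : 0 < a -> posdefmx A -> posdefmx (a *: A).
Proof.
move=> a0 [sA pA]; split; first by rewrite linearZ/= sA.
by move=> x x0; rewrite -[X in 0 < X]/(qf _ x) qfZ mulr_gt0//; exact: pA.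
Qed.

Lemma posdef_inv p (A : 'M[R]_p) : posdefmx A -> posdefmx (invmx A).
Proof.
move=> pA; have uA := posdef_unit pA.
have E : invmx A = (invmx A)^T *m A *m invmx A.
  by rewrite trmx_inv; case: pA => -> _; rewrite mulVmx// mul1mx.
by rewrite E; apply: posdef_congr => //; rewrite unitmx_inv.
Qed.

Lemma posdiag_det p (L : 'M[R]_p) : posdiag L -> \det L = \prod_i L i i.
Proof. by case=> tL _; exact: det_trig. Qed.

Lemma posdiag_det_gt0 p (L : 'M[R]_p) : posdiag L -> 0 < \det L.
Proof. by move=> h; rewrite posdiag_det//; case: h => _ h; exact: prodr_gt0. Qed.

Lemma posdiag_unit p (L : 'M[R]_p) : posdiag L -> L \in unitmx.
Proof. by move=> /posdiag_det_gt0 h; rewrite unitmxE unitfE gt_eqF. Qed.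

(** Peeling off the first coordinate reduces positive definiteness to the
    lower right block and the sign of one determinant, by the Schur complement
    s = a - b^T D^-1 b. *)
Lemma schur_det p (a : 'M[R]_1) (b : 'M[R]_(p, 1)) (D : 'M[R]_p) :
  D^T = D -> D \in unitmx ->
  \det (block_mx a b^T b D) = (a - b^T *m invmx D *m b) 0 0 * \det D.
Proof.
move=> sD uD.
have -> : block_mx a b^T b D = block_mx 1%:M (b^T *m invmx D) 0 1%:M *m
    block_mx (a - b^T *m invmx D *m b) 0 b D.
  rewrite mulmx_block !mul1mx !mul0mx !add0r subrK.
  by rewrite -mulmxA mulVmx// mulmx1.
by rewrite det_mulmx det_ublock !det1 !mul1r det_lblock det_mx11.
Qed.

(** Cholesky factorization with the lower triangular factor on the right, so
    that [A] restricted to its last coordinates is factored by the lower right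
    block of [L]. *)
Lemma cholesky p (A : 'M[R]_p) : posdefmx A ->
  exists2 L : 'M[R]_p, posdiag L & A = L^T *m L.
Proof.
elim: p A => [|p IH]; last rewrite -[p.+1]/(1 + p)%N; move=> A pA.
  exists 0; last by rewrite !flatmx0.
  by split=> [|[]//]; apply/is_trig_mxP => -[].
have [sA _] := pA.
rewrite -[A]submxK in pA sA *.
set a := ulsubmx A in pA sA *; set b := dlsubmx A in pA sA *.
set D := drsubmx A in pA sA *.
have [Ea Eb sD] : [/\ a^T = a, ursubmx A = b^T & D^T = D].
  move: sA; rewrite tr_block_mx => /eq_block_mx [-> <- _ ->]; split=> //.
have pD : posdefmx D.
  split=> // y y0; have [_ /(_ (col_mx 0 y))] := pA.
  rewrite tr_col_mx mul_row_block mul_row_col trmx0 !mul0mx !add0r mulmx0 add0r.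
  apply; apply: contra y0 => /eqP/(congr1 (@dsubmx _ 1 p 1)).
  by rewrite col_mxKd linear0 => ->.
have uD := posdef_unit pD.
rewrite Eb in pA *.
have s0 : 0 < (a - b^T *m invmx D *m b) 0 0.
  have [_ /(_ (col_mx 1%:M (- invmx D *m b)))] := pA.
  rewrite tr_col_mx mul_row_block mul_row_col trmx1 !mul1mx mulmx1.
  have -> : (- invmx D *m b)^T = - (b^T *m invmx D).
    by rewrite mulNmx -scaleN1r linearZ /= trmx_mul trmx_inv sD scaleN1r.
  rewrite !mulNmx -[X in b^T - X]mulmxA mulVmx// mulmx1 subrr mul0mx addr0.
  apply; apply/negP => /eqP/(congr1 (@usubmx _ 1 p 1)).
  rewrite col_mxKu linear0 => /matrixP /(_ 0 0).
  by rewrite !mxE /= => /eqP; rewrite oner_eq0.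
have [L' pL' DL] := IH _ pD.
have uL' := posdiag_unit pL'.
set s := (_ 0 0) in s0.
pose w := (invmx L')^T *m b.
have L'w : L'^T *m w = b by rewrite /w mulmxA trmx_inv mulmxV ?unitmx_tr// mul1mx.
pose L : 'M[R]_(1 + p) := block_mx (Num.sqrt s)%:M 0 w L'.
exists L.
  split.
    by rewrite is_trig_block_mx// eqxx; case: pL' => -> _; rewrite mx11_is_trig.
  move=> i; rewrite /L; case: (splitP i) => j ij.
    rewrite (_ : i = lshift p j); last exact: val_inj.
    by rewrite block_mxEul ord1 !mxE eqxx mulr1n sqrtr_gt0.
  rewrite (_ : i = rshift 1 j); last exact: val_inj.
  by rewrite block_mxEdr; case: pL'.
rewrite /L tr_block_mx mulmx_block trmx0 !mul0mx !mulmx0 !add0r -DL.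
congr block_mx.
- rewrite tr_scalar_mx -scalar_mxM -expr2 sqr_sqrtr ?ltW//.
  have -> : w^T *m w = b^T *m invmx D *m b.
    rewrite {1}/w trmx_mul trmxK -!mulmxA; congr (_ *m _).
    rewrite -[LHS](mulKmx uD); congr (_ *m _).
    by rewrite {1}DL -mulmxA mulKVmx.
  rewrite /s; apply/matrixP => i j; rewrite !ord1 !mxE eqxx mulr1n.
  by rewrite subrK.
- by rewrite -[w^T *m L']trmxK trmx_mul trmxK L'w.
- by rewrite L'w.
Qed.

Lemma posdef_det_gt0 p (A : 'M[R]_p) : posdefmx A -> 0 < \det A.
Proof.
move=> /cholesky [L pL ->]; rewrite det_mulmx det_tr -expr2 exprn_gt0//.
exact: posdiag_det_gt0.
Qed.
End posdef.

Section posdef_order.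
Context {R : realType}.

Lemma posdef_block p (A : 'M[R]_(1 + p)) : A^T = A ->
  posdefmx A <-> posdefmx (drsubmx A) /\ 0 < \det A.
Proof.
move=> sA; split=> [pA|[pD dA]].
  split; last exact: posdef_det_gt0.
  split; first by rewrite -{2}sA trmx_drsub.
  move=> y y0; have := posdef_qf pA (x := col_mx 0 y).
  rewrite /qf -{1}[A]submxK tr_col_mx mul_row_block mul_row_col.
  rewrite trmx0 !mul0mx !add0r mulmx0 add0r.
  apply; apply: contra y0 => /eqP/(congr1 (@dsubmx _ 1 p 1)).
  by rewrite col_mxKd linear0 => ->.
have uD := posdef_unit pD; have [sD _] := pD.
have Eb : ursubmx A = (dlsubmx A)^T by rewrite -{1}sA trmx_dlsub.
set a := ulsubmx A; set b := dlsubmx A; set D := drsubmx A in uD sD pD.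
have AE : A = block_mx a b^T b D by rewrite -[LHS]submxK Eb.
have s0 : 0 < (a - b^T *m invmx D *m b) 0 0.
  by move: dA; rewrite AE schur_det// pmulr_lgt0// posdef_det_gt0.
pose C : 'M[R]_(1 + p) := block_mx 1%:M 0 (invmx D *m b) 1%:M.
pose S : 'M[R]_(1 + p) := block_mx (a - b^T *m invmx D *m b) 0 0 D.
have uC : C \in unitmx by rewrite unitmxE /C det_lblock !det1 mulr1 unitr1.
have -> : A = C^T *m S *m C.
  rewrite /C /S tr_block_mx !mulmx_block !trmx1 trmx0 !mul1mx !mul0mx !mulmx0.
  rewrite !mulmx1 trmx_mul trmx_inv sD !addr0 !add0r mulmxKV//.
  by rewrite mulmxA subrK mulKVmx.
apply: posdef_congr => //; split.
  rewrite /S tr_block_mx !trmx0 sD; congr block_mx.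
  by rewrite [LHS]mx11_scalar mxE -mx11_scalar.
move=> x; rewrite -[x]vsubmxK; set u := usubmx x; set y := dsubmx x => x0.
rewrite /S tr_col_mx mul_row_block mul_row_col !mulmx0 addr0 add0r mxE.
set s := a - _ in s0 *.
have -> : (u^T *m s *m u) 0 0 = s 0 0 * u 0 0 ^+ 2.
  rewrite [s]mx11_scalar mul_mx_scalar -scalemxAl !mxE big_ord1 !mxE.
  by rewrite eqxx mulr1n expr2.
have [y0|y0] := eqVneq y 0.
  rewrite [X in _ + X](_ : _ = 0) ?addr0; last by rewrite y0 mulmx0 mxE.
  rewrite mulr_gt0// exprn_even_gt0//=.
  apply: contra x0 => /eqP u0; rewrite y0 [u]mx11_scalar u0.
  by rewrite raddf0 col_mx0.
apply: ltr_wpDl; first by rewrite mulr_ge0 ?sqr_ge0// ltW.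
exact: pD.2.
Qed.

(** ln x <= x - 1 for the eigenvalues; through the Cholesky factor, det A only
    sees the squared diagonal entries of L whereas the trace of A is the sum of
    all its squared entries. *)
Lemma ln_det_le_trace p (A : 'M[R]_p) : posdefmx A ->
  ln (\det A) <= \tr A - p%:R.
Proof.
move=> /cholesky [L pL ->]; have L0 := pL.2.
rewrite det_mulmx det_tr -expr2 posdiag_det// -prodrXl.
have -> : ln (\prod_i L i i ^+ 2) = \sum_i ln (L i i ^+ 2).
  elim: (index_enum _) => [|i s IH]; first by rewrite !big_nil ln1.
  rewrite !big_cons lnM ?IH// ?posrE ?exprn_gt0//.
  by apply: prodr_gt0 => j _; rewrite exprn_gt0.
rewrite -nsq_trace.
have -> : p%:R = \sum_(i < p) (1 : R) by rewrite sumr_const card_ord.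
rewrite -sumrB ler_sum// => i _; rewrite lerBrDr.
apply: (@le_trans _ _ (L i i ^+ 2)).
  have L2 := exprn_gt0 2 (L0 i).
  have : -1 < L i i ^+ 2 - 1 by lra.
  by move/le_ln1Dx; rewrite addrC subrK; lra.
by rewrite (bigD1 i)//= lerDl; apply: sumr_ge0 => j _; exact: sqr_ge0.
Qed.

Lemma ln_det_gram p (L A : 'M[R]_p) : posdiag L -> posdefmx A ->
  ln (\det (L *m A *m L^T)) = 2 * ln (\det L) + ln (\det A).
Proof.
move=> pL pA; rewrite !det_mulmx det_tr.
have dL := posdiag_det_gt0 pL; have dA := posdef_det_gt0 pA.
by rewrite !lnM ?posrE ?mulr_gt0//; lra.
Qed.

Lemma ln_det_inv p (A : 'M[R]_p) : posdefmx A ->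
  ln (\det (invmx A)) = - ln (\det A).
Proof. by move=> pA; rewrite det_inv lnV// posrE posdef_det_gt0. Qed.

Lemma ln_det_diff_le p (A B : 'M[R]_p) : posdefmx A -> posdefmx B ->
  ln (\det B) - ln (\det A) <= \tr (invmx A *m B) - p%:R.
Proof.
move=> pA pB; have [L pL AE] := cholesky pA; have uL := posdiag_unit pL.
pose C := (invmx L)^T *m B *m invmx L.
have pC : posdefmx C by apply: posdef_congr; rewrite ?unitmx_inv.
have BE : B = L^T *m C *m L.
  by rewrite /C !mulmxA trmx_inv mulmxV ?unitmx_tr// mul1mx mulmxKV.
have -> : \tr (invmx A *m B) = \tr C.
  have -> : invmx A *m B = invmx L *m C *m L.
    have BA : B = A *m (invmx L *m C *m L).
      by rewrite [LHS]BE AE !mulmxA -(mulmxA L^T L) mulmxV// mulmx1.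
    by rewrite [in LHS]BA mulKmx// posdef_unit.
  by rewrite mxtrace_mulC mulmxA mulmxV// mul1mx.
rewrite (le_trans _ (ln_det_le_trace pC))//.
have dL := posdiag_det_gt0 pL; have dC := posdef_det_gt0 pC.
clearbody C; rewrite BE AE !det_mulmx det_tr !lnM ?posrE ?mulr_gt0//; lra.
Qed.

Lemma cauchy_schwarz_qf p (A : 'M[R]_p) x y : posdefmx A ->
  dot x (A *m y) ^+ 2 <= qf A x * qf A y.
Proof.
move=> /cholesky [L _ ->]; rewrite !qf_gram -mulmxA dot_mulmx trmxK.
exact: cauchy_schwarz_dot.
Qed.

(** Inversion reverses the Loewner order. *)
Lemma qf_inv_le p (A B : 'M[R]_p) a : posdefmx A -> posdefmx B -> 0 <= a ->
  (forall x, a * qf A x <= qf B x) ->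
  forall x, a * qf (invmx B) x <= qf (invmx A) x.
Proof.
move=> pA pB a0 AB x; have uA := posdef_unit pA; have uB := posdef_unit pB.
have qfinv (M : 'M[R]_p) : posdefmx M -> qf M (invmx M *m x) = qf (invmx M) x.
  by move=> pM; rewrite !qf_dot mulKVmx ?posdef_unit// dotC.
set y := invmx B *m x; set z := invmx A *m x.
have h1 : qf (invmx B) x = dot y (A *m z).
  by rewrite /z mulKVmx// dotC qf_dot.
have h2 := cauchy_schwarz_qf y z pA; rewrite -h1 in h2.
have h3 := AB y; rewrite (qfinv B pB) in h3; rewrite (qfinv A pA) in h2.
set b := qf (invmx B) x in h1 h2 h3 *; set c := qf (invmx A) x in h2 *.
have b0 : 0 <= b by exact/posdef_qf_ge0/posdef_inv.
have c0 : 0 <= c by exact/posdef_qf_ge0/posdef_inv.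
have [b00|bn0] := eqVneq b 0; first by rewrite b00 mulr0.
have bp : 0 < b by rewrite lt_def bn0.
rewrite -(ler_pM2r bp); nra.
Qed.

Lemma opb_of_qf p (A : 'M[R]_p) c : posdefmx A -> 0 <= c ->
  (forall x, qf A x <= c * nsq x) ->
  forall x : 'cV_p, nsq (A *m x) <= c ^+ 2 * nsq x.
Proof.
move=> pA c0 Ac x; have [Ax0|Ax0] := eqVneq (A *m x) 0.
  by rewrite Ax0 nsq_dot /dot mulmx0 mxE mulr_ge0 ?sqr_ge0 ?nsq_ge0.
have h := cauchy_schwarz_qf (A *m x) x pA; rewrite -nsq_dot in h.
have h1 := Ac (A *m x); have h2 := Ac x; have n0 := nsq_gt0 Ax0.
have q0 := posdef_qf_ge0 x pA; have := posdef_qf_ge0 (A *m x) pA.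
have nx := nsq_ge0 x => q1.
rewrite -(ler_pM2l n0) -expr2 (le_trans h)//.
apply: (@le_trans _ _ ((c * nsq (A *m x)) * (c * nsq x))).
  by apply: ler_pM.
by rewrite le_eqVlt; apply/orP; left; apply/eqP; ring.
Qed.

End posdef_order.

Section spectral.
Context {R : realType}.

Let frob_le1 n (x : 'cV[R]_n) : frobenius x <= 1 -> nsq x <= 1.
Proof. by move=> h; rewrite -frobenius_sqr expr_le1// frobenius_ge0. Qed.

Lemma spectral_norm_has_sup m n (A : 'M[R]_(m, n)) :
  has_sup [set frobenius (A *m x) | x in [set x : 'cV[R]_n | frobenius x <= 1]].
Proof.
split.
  exists (frobenius (A *m (0 : 'cV[R]_n))), 0 => //=.
  rewrite /frobenius big1 ?sqrtr0//= => i _; rewrite big1// => j _.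
  by rewrite mxE expr0n.
exists (frobenius A) => _ [x /frob_le1 x1 <-].
rewrite -(@ler_pXn2r _ 2)// ?nnegrE ?frobenius_ge0// !frobenius_sqr.
rewrite (le_trans (nsq_mulmx_le _ _))//.
by have := nsq_ge0 A; have := nsq_ge0 x; nra.
Qed.

Lemma spectral_norm_le m n (A : 'M[R]_(m, n)) c : 0 <= c ->
  (forall x : 'cV_n, nsq (A *m x) <= c ^+ 2 * nsq x) -> spectral_norm A <= c.
Proof.
move=> c0 Ac; apply: ge_sup; first exact: (spectral_norm_has_sup A).1.
move=> _ [x /frob_le1 x1 <-].
rewrite -(@ler_pXn2r _ 2)// ?nnegrE ?frobenius_ge0// frobenius_sqr.
by rewrite (le_trans (Ac x))// ler_piMr// sqr_ge0.
Qed.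

Lemma spectral_norm_ub m n (A : 'M[R]_(m, n)) c (x : 'cV_n) :
  spectral_norm A <= c -> nsq (A *m x) <= c ^+ 2 * nsq x.
Proof.
move=> Ac; have [->|x0] := eqVneq x 0.
  by rewrite mulmx0 !nsq_dot /dot !mulmx0 mxE mulr0.
have nx := nsq_gt0 x0.
pose y := (Num.sqrt (nsq x))^-1 *: x.
have ny : nsq y = 1.
  by rewrite nsqZ exprVn sqr_sqrtr ?nsq_ge0// mulVf// gt_eqF.
have h : frobenius (A *m y) <= c.
  apply: le_trans Ac; apply: sup_ubound; first exact: (spectral_norm_has_sup A).2.
  by exists y => //=; rewrite -(@ler_pXn2r _ 2)// ?nnegrE ?frobenius_ge0//
    frobenius_sqr ny expr1n.
have c0 := le_trans (frobenius_ge0 _) h.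
move: h; rewrite -(@ler_pXn2r _ 2)// ?nnegrE ?frobenius_ge0// frobenius_sqr.
by rewrite -scalemxAr nsqZ exprVn sqr_sqrtr ?nsq_ge0// ler_pdivrMl// mulrC.
Qed.

Lemma qf_le_spectral p (A : 'M[R]_p) c x : 0 <= c ->
  spectral_norm A <= c -> qf A x <= c * nsq x.
Proof.
move=> c0 Ac; have h1 := spectral_norm_ub x Ac.
have := cauchy_schwarz_dot x (A *m x); rewrite -qf_dot => h2.
have n0 := nsq_ge0 x; apply: le_trans (ler_norm _) _.
rewrite -(@ler_pXn2r _ 2)// ?nnegrE ?normr_ge0 ?mulr_ge0//.
by rewrite real_normK ?num_real//; nra.
Qed.

Lemma spectral_norm_posdef p (A : 'M[R]_p) c : posdefmx A -> 0 <= c ->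
  (forall x, qf A x <= c * nsq x) -> spectral_norm A <= c.
Proof. by move=> pA c0 Ac; apply: spectral_norm_le => //; exact: opb_of_qf. Qed.

End spectral.

(** * Coordinates on symmetric matrices and linear substitutions *)

Section measurable_matrices.
Context d (T : measurableType d) (R : realType).

Definition measurable_mx m n (A : T -> 'M[R]_(m, n)) :=
  forall i j, measurable_fun [set: T] (fun w => A w i j).

Lemma measurable_mx_cst m n (A : 'M[R]_(m, n)) : measurable_mx (fun=> A).
Proof. by move=> i j; exact: measurable_cst. Qed.

Lemma measurable_mx_mul m n k (A : T -> 'M[R]_(m, n)) (B : T -> 'M[R]_(n, k)) :
  measurable_mx A -> measurable_mx B -> measurable_mx (fun w => A w *m B w).
Proof.
move=> mA mB i j; under eq_fun do rewrite mxE.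
by apply: measurable_sum => l; exact: measurable_funM.
Qed.

Lemma measurable_mx_add m n (A B : T -> 'M[R]_(m, n)) :
  measurable_mx A -> measurable_mx B -> measurable_mx (fun w => A w + B w).
Proof.
by move=> mA mB i j; under eq_fun do rewrite mxE; exact: measurable_funD.
Qed.

Lemma measurable_mx_scale m n a (A : T -> 'M[R]_(m, n)) :
  measurable_mx A -> measurable_mx (fun w => a *: A w).
Proof.
by move=> mA i j; under eq_fun do rewrite mxE; exact: measurable_funM.
Qed.

Lemma measurable_mx_opp m n (A : T -> 'M[R]_(m, n)) :
  measurable_mx A -> measurable_mx (fun w => - A w).
Proof.
move=> mA i j; under eq_fun do rewrite mxE.
exact: measurable_funN.
Qed.

Lemma measurable_mx_trace p (A : T -> 'M[R]_p) : measurable_mx A ->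
  measurable_fun [set: T] (fun w => \tr (A w)).
Proof. by move=> mA; apply: measurable_sum => l; exact: mA. Qed.

Lemma measurable_mx_nsq m n (A : T -> 'M[R]_(m, n)) : measurable_mx A ->
  measurable_fun [set: T] (fun w => nsq (A w)).
Proof.
move=> mA; apply: measurable_sum => i; apply: measurable_sum => j.
exact: measurable_funX.
Qed.

Lemma measurable_mx_det p (A : T -> 'M[R]_p) : measurable_mx A ->
  measurable_fun [set: T] (fun w => \det (A w)).
Proof.
move=> mA; rewrite /determinant; apply: measurable_sum => s.
apply: measurable_funM => //.
by apply: measurable_prod => i _; exact: mA.
Qed.

Lemma measurable_mx_ln_det p (A : T -> 'M[R]_p) : measurable_mx A ->
  measurable_fun [set: T] (fun w => ln (\det (A w))).
Proof.
by move=> mA; apply: (measurableT_comp (@measurable_ln R)); exact: measurable_mx_det.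
Qed.

(** Positive definiteness is an uncountable family of inequalities; the
    recursive determinant criterion turns it into finitely many. *)
Lemma measurable_posdef p (A : T -> 'M[R]_p) : measurable_mx A ->
  (forall w, (A w)^T = A w) -> measurable [set w | posdefmx (A w)].
Proof.
elim: p A => [|p IH]; last rewrite -[p.+1]/(1 + p)%N; move=> A mA sA.
  rewrite (_ : [set _ | _] = setT)//; apply/seteqP; split => // w _ /=.
  by split=> // x; rewrite [x]flatmx0 eqxx.
rewrite (_ : [set _ | _] = [set w | posdefmx (drsubmx (A w))] `&`
    (fun w => \det (A w)) @^-1` `]0, +oo[); last first.
  apply/seteqP; split => w /=; rewrite in_itv/= andbT.
    by move/(posdef_block (sA w)).
  by move=> h; apply/(posdef_block (sA w)).
apply: measurableI.
  apply: IH; last by move=> w; rewrite trmx_drsub sA.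
  by move=> i j; under eq_fun do rewrite !mxE; exact: mA.
by rewrite -[X in measurable X]setTI; apply: measurable_mx_det => //; exact: measurable_itv.
Qed.

End measurable_matrices.

Section triangular_index.

Lemma tri_exists k : exists j, (k < 'C(j.+2, 2))%N.
Proof.
by exists k; rewrite binS bin1 (leq_trans (ltnSn k))// leq_addl.
Qed.

(** Inverse of the enumeration (i, j) |-> 'C(j.+1, 2) + i of the upper
    triangle. *)
Definition tri_col k := ex_minn (tri_exists k).
Definition tri_row k := (k - 'C((tri_col k).+1, 2))%N.

Lemma binS2 j : 'C(j.+2, 2) = ('C(j.+1, 2) + j.+1)%N.
Proof. by rewrite binS bin1 addnC. Qed.

Lemma leq_bin2 i j : (i <= j)%N -> ('C(i.+1, 2) <= 'C(j.+1, 2))%N.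
Proof.
move=> /subnK <-; elim: (j - i)%N => // m IH.
by rewrite addSn binS2 (leq_trans IH)// leq_addr.
Qed.

Lemma tri_colP i j : (i <= j)%N -> tri_col ('C(j.+1, 2) + i) = j.
Proof.
move=> ij; rewrite /tri_col; case: ex_minnP => m h1 h2.
apply/eqP; rewrite eqn_leq h2 ?binS2 ?ltn_add2l ?ltnS//= leqNgt; apply/negP => mj.
move: h1; rewrite ltnNge (leq_trans _ (leq_addr _ _))//.
exact: (leq_bin2 mj).
Qed.

Lemma tri_rowP i j : (i <= j)%N -> tri_row ('C(j.+1, 2) + i) = i.
Proof. by move=> ij; rewrite /tri_row tri_colP// addKn. Qed.

Lemma tri_le k : ('C((tri_col k).+1, 2) <= k)%N.
Proof.
rewrite /tri_col; case: ex_minnP => -[//|m] h1 h2.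
by rewrite leqNgt; apply/negP => /h2; rewrite ltnn.
Qed.

Lemma tri_lt k : (k < 'C((tri_col k).+2, 2))%N.
Proof. by rewrite /tri_col; case: ex_minnP. Qed.

Lemma tri_pos k : ('C((tri_col k).+1, 2) + tri_row k)%N = k.
Proof. by rewrite /tri_row subnKC// tri_le. Qed.

Lemma tri_row_le k : (tri_row k <= tri_col k)%N.
Proof.
by rewrite -ltnS -(ltn_add2l 'C((tri_col k).+1, 2)) tri_pos -binS2 tri_lt.
Qed.

Lemma tri_col_lt p k : (k < 'C(p.+1, 2))%N -> (tri_col k < p)%N.
Proof.
move=> kp; rewrite ltnNge; apply/negP => /leq_bin2 h.
by move: kp; rewrite ltnNge (leq_trans h)// tri_le.
Qed.

Lemma tri_pos_lt p i j : (i <= j)%N -> (j < p)%N -> ('C(j.+1, 2) + i < 'C(p.+1, 2))%N.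
Proof.
move=> ij jp; apply: (@leq_trans 'C(j.+2, 2)); last exact: leq_bin2.
by rewrite binS2 ltn_add2l ltnS.
Qed.

Lemma tri_pos_mono a b i j : (a <= i)%N -> (i <= j)%N -> (b <= j)%N ->
  ((a, b) != (i, j)) ->
  ('C((maxn a b).+1, 2) + minn a b < 'C(j.+1, 2) + i)%N.
Proof.
move=> ai ij bj; rewrite xpair_eqE => ne.
have [mj|] := ltnP (maxn a b) j.
  apply: (@leq_trans 'C(j.+1, 2)); last exact: leq_addr.
  apply: (@leq_trans 'C((maxn a b).+2, 2)); last exact: leq_bin2.
  by rewrite binS2 ltn_add2l ltnS (leq_trans (geq_minl _ _))// leq_maxl.
move=> jm; have mj : maxn a b = j.
  by apply/eqP; rewrite eqn_leq jm geq_max bj (leq_trans ai ij).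
rewrite mj ltn_add2l; move: mj jm ne; rewrite /maxn /minn.
by case: ltnP => ab mj jm; lia.
Qed.

Lemma prod_tri (R : comNzRingType) p (l : nat -> R) :
  \prod_(k < 'C(p.+1, 2)) (l (tri_row k) * l (tri_col k)) =
  (\prod_(i < p) l i) ^+ p.+1.
Proof.
elim: p => [|p IH]; first by rewrite !big_ord0 expr1n.
rewrite binS2 big_split_ord /= IH.
under [X in _ * X = _]eq_bigr => i _.
  have ip : (i <= p)%N by rewrite -ltnS.
  rewrite tri_rowP// tri_colP//; over.
rewrite big_split /= prodr_const card_ord big_ord_recr /=.
by rewrite exprMn !(exprS _ p.+1); ring.
Qed.

End triangular_index.

Section symmetric_coordinates.
Context {R : realType}.

Lemma symmxE p (v : 'C(p.+1, 2).-tuple R) i j :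
  symmx v i j = nth 0 v ('C((maxn i j).+1, 2) + minn i j)%N.
Proof. by rewrite mxE. Qed.

Lemma symmx_sym p (v : 'C(p.+1, 2).-tuple R) : (symmx v)^T = symmx v.
Proof. by apply/matrixP => i j; rewrite !mxE maxnC minnC. Qed.

Lemma tri_row_lt p k : (k < 'C(p.+1, 2))%N -> (tri_row k < p)%N.
Proof. by move=> /tri_col_lt; apply: leq_ltn_trans; exact: tri_row_le. Qed.

Definition ord_row p (k : 'I_('C(p.+1, 2))) := Ordinal (tri_row_lt (ltn_ord k)).
Definition ord_col p (k : 'I_('C(p.+1, 2))) := Ordinal (tri_col_lt (ltn_ord k)).

Definition coords p (M : 'M[R]_p) : 'C(p.+1, 2).-tuple R :=
  [tuple M (ord_row k) (ord_col k) | k < 'C(p.+1, 2)].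

Lemma symmx_coords p (M : 'M[R]_p) : M^T = M -> symmx (coords M) = M.
Proof.
move=> sM; have sM' i j : M j i = M i j by rewrite -[in LHS]sM mxE.
have h (i j : 'I_p) : (i <= j)%N -> symmx (coords M) i j = M i j.
  move=> ij; rewrite symmxE (maxn_idPr ij) (minn_idPl ij).
  have kp := tri_pos_lt ij (ltn_ord j).
  rewrite -[X in nth _ _ X]/(nat_of_ord (Ordinal kp)) -tnth_nth tnth_mktuple.
  by congr (M _ _); apply: val_inj; rewrite /= ?tri_rowP ?tri_colP.
apply/matrixP => i j; have [ij|/ltnW ji] := leqP i j; first exact: h.
by rewrite -symmx_sym mxE h.
Qed.

Lemma tnth_symmx p (v : 'C(p.+1, 2).-tuple R) k :
  tnth v k = symmx v (ord_row k) (ord_col k).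
Proof.
rewrite symmxE /= (maxn_idPr (tri_row_le k)) (minn_idPl (tri_row_le k)) tri_pos.
by rewrite (tnth_nth 0).
Qed.

Lemma measurable_mx_symmx p : measurable_mx (@symmx R p).
Proof.
move=> i j; rewrite (_ : (fun w => _) =
  (fun v : 'C(p.+1, 2).-tuple R => nth 0 v ('C((maxn i j).+1, 2) + minn i j)%N));
  last by apply/funext => v; rewrite symmxE.
have kp : ('C((maxn i j).+1, 2) + minn i j < 'C(p.+1, 2))%N.
  apply: tri_pos_lt; first by rewrite (leq_trans (geq_minl _ _))// leq_maxl.
  by rewrite gtn_max !ltn_ord.
rewrite (_ : (fun w => _) = (fun v => tnth v (Ordinal kp))).
  exact: measurable_tnth.
by apply/funext => v; rewrite (tnth_nth 0).
Qed.

Lemma measurable_coords d (T : measurableType d) p (A : T -> 'M[R]_p) : measurable_mx A ->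
  measurable_fun setT (fun w => coords (A w)).
Proof.
move=> mA; apply/measurable_fun_tnthP => i.
rewrite (_ : _ \o _ = fun w => A w (ord_row i) (ord_col i)); first exact: mA.
by apply/funext => w; rewrite /= tnth_mktuple.
Qed.

Definition congr_coords p (L : 'M[R]_p) (v : 'C(p.+1, 2).-tuple R) :=
  coords (L *m symmx v *m L^T).

Lemma symmx_congr p (L : 'M[R]_p) v :
  symmx (congr_coords L v) = L *m symmx v *m L^T.
Proof. by rewrite symmx_coords// !trmx_mul trmxK symmx_sym mulmxA. Qed.

Definition diag_nat p (L : 'M[R]_p) (i : nat) : R :=
  if insub i is Some j then L j j else 1.

Lemma diag_natE p (L : 'M[R]_p) (i : 'I_p) : diag_nat L i = L i i.
Proof. by rewrite /diag_nat insubT //= => h; congr (L _ _); exact: val_inj. Qed.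

Lemma diag_nat_gt0 p (L : 'M[R]_p) i : posdiag L -> 0 < diag_nat L i.
Proof. by case=> _ h; rewrite /diag_nat; case: insubP. Qed.

Lemma prod_diag_nat p (L : 'M[R]_p) : posdiag L ->
  \prod_(i < p) diag_nat L i = \det L.
Proof.
by move=> pL; rewrite posdiag_det//; apply: eq_bigr => i _; rewrite diag_natE.
Qed.

Let seqmx p (s : seq R) : 'M[R]_p :=
  \matrix_(i, j) nth 0 s ('C((maxn i j).+1, 2) + minn i j)%N.

Lemma congr_triangular p (L D : 'M[R]_p) (i j : 'I_p) : is_trig_mx L ->
  (forall a b : 'I_p, (a <= i)%N -> (b <= j)%N -> (a, b) != (i, j) ->
    D a b = 0) ->
  (L *m D *m L^T) i j = L i i * L j j * D i j.
Proof.
move=> /is_trig_mxP tL D0.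
rewrite mxE (bigD1 j)//= [X in _ + X]big1 ?addr0; last first.
  move=> b bj; rewrite [L^T b j]mxE; have [jb|bj'] := ltnP j b.
    by rewrite tL// mulr0.
  rewrite mxE big1 ?mul0r// => a _; have [ia|ai] := ltnP i a.
    by rewrite tL// mul0r.
  by rewrite D0 ?mulr0//; apply: contra bj => /eqP[_ ->].
rewrite [L^T j j]mxE mxE (bigD1 i)//= [X in _ + X]big1 ?addr0; last first.
  move=> a ai; have [ia|ai'] := ltnP i a; first by rewrite tL// mul0r.
  by rewrite D0 ?mulr0//; apply: contra ai => /eqP[->].
by rewrite mulrAC.
Qed.

(** In the column-by-column enumeration of the upper triangle, the congruence
    S |-> L S L^T with L lower triangular is itself triangular, with slopes
    L i i * L j j; hence its Jacobian (det L)^(p+1). *)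
Lemma integral_congr_coords p (L : 'M[R]_p) (f : 'C(p.+1, 2).-tuple R -> \bar R) :
  posdiag L -> measurable_fun setT f -> (forall v, (0 <= f v)%E) ->
  (\int[lebesgue_tuple 'C(p.+1, 2)]_v f (congr_coords L v) =
  ((\det L ^+ p.+1)^-1)%:E * \int[lebesgue_tuple 'C(p.+1, 2)]_v f v)%E.
Proof.
move=> pL mf f0.
pose a k := diag_nat L (tri_row k) * diag_nat L (tri_col k).
pose c k s := if insub k is Some k' then
  (L *m seqmx p s *m L^T) (ord_row k') (ord_col k') else 0.
rewrite (@integral_triangular _ _ a c)//.
- by rewrite prod_tri prod_diag_nat.
- by move=> i; rewrite mulr_gt0// diag_nat_gt0.
- apply: measurable_coords; apply: measurable_mx_mul; last exact: measurable_mx_cst.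
  by apply: measurable_mx_mul; [exact: measurable_mx_cst|exact: measurable_mx_symmx].
move=> v k; rewrite tnth_mktuple /c insubT ?ltn_ord//= => kp.
have -> : Sub (nat_of_ord k) kp = k by exact: val_inj.
rewrite -[symmx v](subrK (seqmx p (take k v))) mulmxDr mulmxDl mxE; congr (_ + _).
have rc := tri_row_le k.
rewrite congr_triangular; last 2 first.
- by case: pL.
- move=> x y xi yj xy; rewrite 3!mxE /seqmx mxE nth_take ?subrr//.
  rewrite -[X in (_ < X)%N](tri_pos k); apply: tri_pos_mono => //.
rewrite /a -(diag_natE L (ord_row k)) -(diag_natE L (ord_col k)); congr (_ * _).
rewrite mxE -tnth_symmx [X in _ + X]mxE [X in - X]mxE nth_default ?subr0//.
rewrite /= (maxn_idPr rc) (minn_idPl rc) tri_pos size_take.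
by rewrite size_tuple kp.
Qed.

Definition mulmx_tuple p (L : 'M[R]_p) (x : p.-tuple R) : p.-tuple R :=
  [tuple (L *m colv x) i 0 | i < p].

Lemma colv_mulmx_tuple p (L : 'M[R]_p) x :
  colv (mulmx_tuple L x) = L *m colv x.
Proof. by apply/matrixP => i j; rewrite ord1 mxE tnth_mktuple. Qed.

Lemma measurable_mx_colv p : measurable_mx (@colv R p).
Proof.
by move=> i j; under eq_fun do rewrite mxE; exact: measurable_tnth.
Qed.

Lemma integral_mulmx_tuple p (L : 'M[R]_p) (f : p.-tuple R -> \bar R) :
  posdiag L -> measurable_fun setT f -> (forall v, (0 <= f v)%E) ->
  (\int[lebesgue_tuple p]_v f (mulmx_tuple L v) =
  ((\det L)^-1)%:E * \int[lebesgue_tuple p]_v f v)%E.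
Proof.
move=> pL mf f0.
pose c k s := if insub k is Some k' then
  (L *m (\col_(i < p) nth 0 s i)) k' 0 else 0.
rewrite (@integral_triangular _ _ (diag_nat L) c)//.
- by rewrite prod_diag_nat.
- by move=> i; rewrite diag_nat_gt0.
- apply/measurable_fun_tnthP => i.
  rewrite (_ : _ \o _ = fun x => (L *m colv x) i 0).
    by apply: measurable_mx_mul; [exact: measurable_mx_cst|exact: measurable_mx_colv].
  by apply/funext => w; rewrite /= tnth_mktuple.
move=> v k; rewrite tnth_mktuple /c insubT ?ltn_ord//= => kp.
have -> : Sub (nat_of_ord k) kp = k by exact: val_inj.
set w := \col_i _.
rewrite -[colv v](subrK w) mulmxDr mxE; congr (_ + _).
rewrite mxE (bigD1 k)//= [X in _ + X]big1 ?addr0; last first.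
  move=> b bk; have [kb|kb] := ltnP k b.
    by case: pL => /is_trig_mxP -> //; rewrite mul0r.
  rewrite 4!mxE nth_take -?tnth_nth ?subrr ?mulr0//.
  by rewrite ltn_neqAle kb andbT.
rewrite diag_natE !mxE nth_default ?subr0// size_take.
by rewrite size_tuple kp.
Qed.

End symmetric_coordinates.

(** * Second moments from Laplace transforms *)

Section second_moment.
Context {R : realType}.

Lemma expR_le_1D (u : R) : -2^-1 <= u -> expR (u - 2 * u ^+ 2) <= 1 + u.
Proof.
move=> u2; have u1 : 0 < 1 + u by lra.
have h : expR (u / (1 + u)) <= 1 + u.
  have := expR_ge1Dx (- (u / (1 + u))).
  rewrite (_ : 1 + - (u / (1 + u)) = (1 + u)^-1); last by field; lra.
  by rewrite expRN lef_pV2// posrE ?expR_gt0.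
apply: le_trans h; rewrite ler_expR ler_pdivlMr//.
rewrite -subr_ge0 (_ : _ - _ = u ^+ 2 * (1 + 2 * u)); last by ring.
by rewrite mulr_ge0 ?sqr_ge0//; lra.
Qed.

Lemma sqr_le_expRD (x : R) : x ^+ 2 <= 4 * (expR x + expR (- x)).
Proof.
have key (y : R) : 0 <= y -> y ^+ 2 <= 4 * expR y.
  move=> y0; have -> : expR y = expR (y / 2) ^+ 2.
    by rewrite -expRM_natr; congr expR; field.
  by have := expR_ge1Dx (y / 2); nra.
have := expR_ge0 x; have := expR_ge0 (- x).
have [x0|x0] := leP 0 x; first by have := key _ x0; lra.
by have := key (- x) ltac:(lra); rewrite sqrrN; lra.
Qed.

(** The triangular factors that isolate one entry of G in tr(W^T W G): the Gram
    matrix differs from 1 only at (i, i) and, by [b], at (i, j) and (j, i). *)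
Definition elem_mx p (i j : 'I_p) (a b : R) : 'M[R]_p :=
  1%:M + a *: delta_mx i i + b *: delta_mx j i.

Lemma elem_posdiag p (i j : 'I_p) a b : (i < j)%N \/ b = 0 -> 0 < 1 + a ->
  posdiag (elem_mx i j a b) /\ \det (elem_mx i j a b) = 1 + a.
Proof.
move=> ijb a1.
have diag k : elem_mx i j a b k k = if k == i then 1 + a else 1.
  rewrite !mxE eqxx mulr1n; case: eqVneq => [->|ki] /=; last by rewrite andbF !mulr0 !addr0.
  rewrite andbT; case: ijb => [ij|->]; last by rewrite mul0r addr0 mulr1.
  by rewrite (_ : (i == j) = false) ?mulr0 ?addr0 ?mulr1//; apply/eqP => E; rewrite E ltnn in ij.
have pd : posdiag (elem_mx i j a b).
  split; last by move=> k; rewrite diag; case: ifP.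
  apply/is_trig_mxP => k l kl; rewrite !mxE.
  have -> : (k == l) = false by apply/eqP => E; rewrite E ltnn in kl.
  have -> : (k == i) && (l == i) = false.
    by apply/andP => -[/eqP E1 /eqP E2]; rewrite E1 E2 ltnn in kl.
  case: ijb => [ij|->]; last by rewrite mul0r mulr0 !addr0.
  have -> : (k == j) && (l == i) = false.
    apply/andP => -[/eqP E1 /eqP E2]; rewrite E1 E2 in kl.
    by have := ltn_trans ij kl; rewrite ltnn.
  by rewrite !mulr0 !addr0.
split=> //; rewrite posdiag_det// (bigD1 i)//= big1 ?mulr1.
  by rewrite diag eqxx.
by move=> k ki; rewrite diag (negbTE ki).
Qed.

Lemma elem_gram_trace p (i j : 'I_p) a b (G : 'M[R]_p) : G^T = G ->
  (i < j)%N \/ b = 0 ->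
  \tr ((1%:M - (elem_mx i j a b)^T *m elem_mx i j a b) *m G) =
  - (2 * a + a ^+ 2 + b ^+ 2) * G i i - 2 * b * G i j.
Proof.
move=> sG ijb.
have trd k l : \tr (delta_mx k l *m G) = G l k.
  rewrite /mxtrace (bigD1 k)//= big1 ?addr0.
    rewrite mxE (bigD1 l)//= big1 ?addr0 ?mxE ?eqxx ?mul1r//.
    by move=> m ml; rewrite mxE (negbTE ml) andbF mul0r.
  move=> m mk; rewrite mxE big1// => t _.
  by rewrite mxE (negbTE mk) mul0r.
have -> : 1%:M - (elem_mx i j a b)^T *m elem_mx i j a b =
    - (2 * a + a ^+ 2 + b ^+ 2) *: delta_mx i i
    - b *: delta_mx i j - b *: delta_mx j i.
  have ab : (a * b * (i == j)%:R) = 0.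
    case: ijb => [ij|->]; last by rewrite mulr0 mul0r.
    by rewrite (_ : (i == j) = false) ?mulr0//; apply/eqP => E; rewrite E ltnn in ij.
  have -> : (elem_mx i j a b)^T =
      1%:M + a *: delta_mx i i + b *: delta_mx i j.
    apply/matrixP => k l; rewrite !mxE (eq_sym l k).
    by rewrite [(l == i) && (k == i)]andbC [(l == j) && _]andbC.
  rewrite /elem_mx !(mulmxDl, mulmxDr) !mul1mx !mulmx1 -!scalemxAl -!scalemxAr !scalerA.
  rewrite !mul_delta_mx_cond (eq_sym j i).
  apply/matrixP => k l; rewrite !mxE.
  case: ijb => [ij|->].
    have -> : (i == j) = false by apply/eqP => E; rewrite E ltnn in ij.
    by rewrite !eqxx /= !mulr0n !mulr1n !mxE; ring.
  by rewrite !eqxx /= !mulr1n !mxE !(mul0r, mulr0); ring.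
rewrite !mulmxDl !mulNmx !raddfD /= !raddfN /= -!scalemxAl !mxtraceZ !trd.
by rewrite -[in G j i]sG mxE; ring.
Qed.

Lemma inv_sqrt_exp_le (t : R) m : -2^-1 <= t ->
  (Num.sqrt (1 + t))^-1 ^+ m <= expR (- m%:R * ((t - 2 * t ^+ 2) / 2)).
Proof.
move=> t2; have h := expR_le_1D t2.
have e : expR ((t - 2 * t ^+ 2) / 2) <= Num.sqrt (1 + t).
  rewrite -(@ler_pXn2r _ 2)// ?nnegrE ?expR_ge0 ?sqrtr_ge0//.
  rewrite sqr_sqrtr; last by lra.
  by rewrite -expRM_natr (le_trans _ h)// ler_expR; lra.
rewrite [X in expR X](_ : _ = - ((t - 2 * t ^+ 2) / 2) * m%:R); last by ring.
rewrite expRM_natr lerXn2r ?nnegrE ?expR_ge0 ?invr_ge0 ?sqrtr_ge0//.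
by rewrite expRN lef_pV2 ?posrE ?expR_gt0// (lt_le_trans _ e)// expR_gt0.
Qed.

(** The hypothesis is the form of the Laplace transform shared by the sample
    covariance (m = n) and by the Wishart-type density (m = n + p + 1).  At the
    factors [elem_mx] it gives exponential moments of sqrt n (G - 1) i j, which
    dominate the square; each entry thus has a second moment O(1/n). *)
Lemma second_moment d (T : measurableType d) (mu : {measure set T -> \bar R})
    (n m p : nat) (H : T -> R) (G : T -> 'M[R]_p) (Z : R) :
  (16 <= n)%N -> (n <= m)%N -> (m <= n.*2)%N -> ((m - n) ^ 2 <= n)%N ->
  measurable_fun setT H -> (forall w, 0 <= H w) -> measurable_mx G ->
  (forall w, (G w)^T = G w) ->
  (forall W : 'M[R]_p, posdiag W ->
    \int[mu]_w (H w * expR (n%:R / 2 * \tr ((1%:M - W^T *m W) *m G w)))%:E =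
    ((\det W)^-1 ^+ m * Z)%:E)%E ->
  (\int[mu]_w (H w * nsq (G w - 1%:M))%:E <=
   (8 * expR 9 * (p ^ 2)%:R / n%:R * Z)%:E)%E.
Proof.
move=> n16 nm m2n mn2 mH H0 mG sG MGF.
have n0 : 0 < n%:R :> R by rewrite ltr0n (leq_trans _ n16).
have n16R : 16 <= n%:R :> R by rewrite (ler_nat R 16).
have nmR : n%:R <= m%:R :> R by rewrite ler_nat.
have m2nR : m%:R <= 2 * n%:R :> R.
  by rewrite -natrM ler_nat mul2n.
have mn2R : (m%:R - n%:R) ^+ 2 <= n%:R :> R.
  by rewrite -natrB// -natrX ler_nat.
pose s : R := Num.sqrt n%:R.
have s2 : s ^+ 2 = n%:R by rewrite sqr_sqrtr// ltW.
have s0 : 0 < s by rewrite sqrtr_gt0.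
have s4 : 4 <= s.
  have : (4 : R) ^+ 2 <= s ^+ 2 by rewrite s2 (_ : 4 ^+ 2 = 16)//; ring.
  by rewrite ler_pXn2r// nnegrE ltW.
have mns : m%:R - n%:R <= s.
  by rewrite -(@ler_pXn2r _ 2)// ?nnegrE ?subr_ge0 ?(ltW s0)// s2.
have Z0 : 0 <= Z.
  have pd1 : posdiag (1%:M : 'M[R]_p).
    split; last by move=> i; rewrite mxE eqxx ltr01.
    by apply/is_trig_mxP => i j ij; rewrite mxE (_ : (i == j) = false)//;
      apply/eqP => E; rewrite E ltnn in ij.
  have := MGF _ pd1; rewrite det1 invr1 expr1n mul1r => E.
  rewrite -lee_fin -E; apply: integral_ge0 => w _.
  by rewrite lee_fin mulr_ge0// expR_ge0.
have mGe i j (c e : R) : measurable_fun setT (fun w => H w * expR (c * (G w i j - e))).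
  apply: measurable_funM => //; apply: measurableT_comp => //.
  by apply: measurable_funM => //; exact: measurable_funB.
have lap (sg : R) (i j : 'I_p) : sg ^+ 2 = 1 -> (i <= j)%N ->
    (\int[mu]_w (H w * expR (sg * s * (G w i j - (i == j)%:R)))%:E <=
     (expR 9 * Z)%:E)%E.
  move=> sg1 ij.
  have sgb : -1 <= sg <= 1 by apply/andP; split; nra.
  pose eq := i == j.
  (* in tr((1 - W^T W) G) only (2 sg / s) G i j is to remain: for i = j it comes
     from t = 2 a + a^2, for i != j from b, and then t cancels b^2 *)
  pose t : R := if eq then - 2 * sg / s else - s ^- 2.
  have t2 : - 2^-1 <= t.
    rewrite /t; case: ifP => _.
      by rewrite -subr_ge0 (_ : _ - _ = (s - 4 * sg) / (2 * s)) ?divr_ge0//;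
        [lra|lra|field; lra].
    rewrite lerN2 lef_pV2 ?posrE ?exprn_gt0// s2; lra.
  pose a : R := Num.sqrt (1 + t) - 1.
  pose b : R := if eq then 0 else - sg / s.
  have ijb : (i < j)%N \/ b = 0.
    by rewrite /b /eq; case: eqVneq => [|ne]; [right|left; rewrite ltn_neqAle ne].
  have a1 : 1 + a = Num.sqrt (1 + t) by rewrite /a; ring.
  have a0 : 0 < 1 + a by rewrite a1 sqrtr_gt0; lra.
  have [pW dW] := elem_posdiag ijb a0.
  have aE : 2 * a + a ^+ 2 = t.
    have := sqr_sqrtr (a := 1 + t) ltac:(lra); rewrite -a1; nra.
  have key w : H w * expR (sg * s * (G w i j - (i == j)%:R)) =
      expR (- sg * s * eq%:R) *
      (H w * expR (n%:R / 2 * \tr ((1%:M - (elem_mx i j a b)^T *m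
         elem_mx i j a b) *m G w))).
    rewrite elem_gram_trace// aE mulrCA -expRD; congr (_ * expR _).
    rewrite -s2 /b /t /eq; case: eqVneq => [->|ne] /=; first by field; lra.
    by rewrite exprMn sqrrN sg1 exprVn mul1r addNr; field; lra.
  under eq_integral do rewrite key EFinM.
  rewrite ge0_integralZl_EFin ?expR_ge0//; last 2 first.
  - by move=> w _; rewrite lee_fin mulr_ge0// expR_ge0.
  - apply/measurable_EFinP; apply: measurable_funM => //.
    apply: measurableT_comp => //; apply: measurable_funM => //.
    apply: measurable_mx_trace; apply: measurable_mx_mul => //; exact: measurable_mx_cst.
  rewrite MGF// dW a1 -EFinM lee_fin mulrA ler_wpM2r//.
  apply: (@le_trans _ _ (expR (- sg * s * eq%:R) *
      expR (- m%:R * ((t - 2 * t ^+ 2) / 2)))).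
    by rewrite ler_wpM2l ?expR_ge0// inv_sqrt_exp_le.
  rewrite -expRD ler_expR /t /eq; case: eqVneq => _ /=.
    rewrite [leLHS](_ : _ = sg * ((m%:R - s ^+ 2) / s) +
      4 * sg ^+ 2 * (m%:R / s ^+ 2)); last by field; lra.
    have h1 : 0 <= (m%:R - s ^+ 2) / s <= 1.
      apply/andP; split; last by rewrite ler_pdivrMr// mul1r s2.
      by rewrite divr_ge0 ?(ltW s0)// s2 subr_ge0.
    have h2 : m%:R / s ^+ 2 <= 2 by rewrite s2 ler_pdivrMr.
    rewrite sg1; nra.
  rewrite [leLHS](_ : _ = (m%:R / s ^+ 2) * (2^-1 + s ^- 2)); last by field; lra.
  have h2 : 0 <= m%:R / s ^+ 2 <= 2 by rewrite s2 ler_pdivrMr// m2nR divr_ge0// ltW.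
  have h3 : 0 <= s ^- 2 <= 1.
    by rewrite s2 invr_ge0 invf_le1// (ltW n0)/=; lra.
  nra.
have entry i j : (\int[mu]_w (H w * (G w - 1%:M) i j ^+ 2)%:E <=
    (8 * expR 9 / n%:R * Z)%:E)%E.
  wlog ij : i j / (i <= j)%N.
    move=> h; have [/h//|/ltnW /h] := leqP i j.
    by under eq_integral do rewrite -[in X in _ * X ^+ 2](trmxK (G _ - _)) mxE
      raddfB /= sG trmx1.
  apply: (@le_trans _ _ (\int[mu]_w (4 / n%:R *
     (H w * expR (1 * s * (G w i j - (i == j)%:R)) +
      H w * expR (- 1 * s * (G w i j - (i == j)%:R))))%:E)%E).
    apply: ge0_le_integral_nomeas => w.
      by rewrite lee_fin mulr_ge0// sqr_ge0.
    rewrite lee_fin !mxE -[X in _ <= _ * X]mulrDr [leRHS]mulrCA ler_wpM2l//.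
    have := sqr_le_expRD (s * (G w i j - (i == j)%:R)).
    rewrite exprMn s2 mul1r mulN1r mulNr => h.
    by rewrite mulrAC ler_pdivlMr// mulrC.
  under eq_integral do rewrite EFinM.
  rewrite ge0_integralZl_EFin; last 4 first.
  - exact: measurableT.
  - by move=> w _; rewrite lee_fin addr_ge0// mulr_ge0// expR_ge0.
  - by apply/measurable_EFinP; apply: measurable_funD; exact: mGe.
  - by rewrite divr_ge0// ltW.
  under eq_integral do rewrite EFinD.
  rewrite ge0_integralD//; last 4 first.
  - by move=> w _; rewrite lee_fin mulr_ge0// expR_ge0.
  - by apply/measurable_EFinP; exact: mGe.
  - by move=> w _; rewrite lee_fin mulr_ge0// expR_ge0.
  - by apply/measurable_EFinP; exact: mGe.
  apply: (@le_trans _ _ ((4 / n%:R)%:E * ((expR 9 * Z)%:E + (expR 9 * Z)%:E))%E).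
    apply: lee_wpmul2l; first by rewrite lee_fin divr_ge0// ltW.
    by apply: leeD; apply: lap => //; rewrite ?sqrrN expr1n.
  by rewrite -EFinD -EFinM lee_fin le_eqVlt; apply/orP; left; apply/eqP; field; lra.
have mE i j : measurable_fun setT (fun w => (H w * (G w - 1%:M) i j ^+ 2)%:E : \bar R).
  apply/measurable_EFinP; apply: measurable_funM => //; apply: measurable_funX.
  by under eq_fun do rewrite !mxE; exact: measurable_funB.
have nnE i j w : (0 <= (H w * (G w - 1%:M) i j ^+ 2)%:E)%E.
  by rewrite lee_fin mulr_ge0// sqr_ge0.
under eq_integral => w _.
  rewrite /nsq mulr_sumr -sumEFin.
  under eq_bigr do rewrite mulr_sumr -sumEFin.
  over.
rewrite ge0_integral_sum//; last 2 first.
- by move=> i; apply: emeasurable_sum.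
- by move=> i w _; apply: sume_ge0.
apply: (@le_trans _ _
    (\sum_(i < p) \sum_(j < p) (8 * expR 9 / n%:R * Z))%R%:E).
  rewrite -sumEFin; apply: lee_sum => i _; rewrite ge0_integral_sum// -sumEFin.
  by apply: lee_sum => j _; exact: entry.
rewrite lee_fin !sumr_const !card_ord -mulrnA -mulr_natr mulnn.
by rewrite le_eqVlt; apply/orP; left; apply/eqP; field; lra.
Qed.

End second_moment.

(** * Wishart-type densities *)

Section wishart.
Context {R : realType}.
Local Notation lambda := (@lebesgue_measure R).

Definition cone p : set ('C(p.+1, 2).-tuple R) :=
  [set v | posdefmx (symmx v)].

Lemma measurable_cone p : measurable (@cone p).
Proof. by apply: measurable_posdef; [exact: measurable_mx_symmx|exact: symmx_sym]. Qed.

(** The posterior density for a flat prior and sample covariance B, before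
    normalization: a Wishart density with n + p + 1 degrees of freedom. *)
Definition wishart_density n p (B : 'M[R]_p) (v : 'C(p.+1, 2).-tuple R) : R :=
  \1_(@cone p) v *
  expR (n%:R / 2 * ln (\det (symmx v)) - n%:R / 2 * \tr (symmx v *m B)).

Lemma wishart_density_ge0 n p (B : 'M[R]_p) v : 0 <= wishart_density n B v.
Proof. by rewrite mulr_ge0// expR_ge0. Qed.

Lemma measurable_wishart_density n p (B : 'M[R]_p) :
  measurable_fun setT (wishart_density n B).
Proof.
apply: measurable_funM.
  by apply: measurable_indic; exact: measurable_cone.
apply: measurableT_comp => //; apply: measurable_funB.
  apply: measurable_funM => //; apply: measurable_mx_ln_det; exact: measurable_mx_symmx.
apply: measurable_funM => //; apply: measurable_mx_trace; apply: measurable_mx_mul.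
  exact: measurable_mx_symmx.
exact: measurable_mx_cst.
Qed.

Lemma cone_congr p (L : 'M[R]_p) v : posdiag L ->
  (congr_coords L v \in @cone p) = (v \in @cone p).
Proof.
move=> pL; have uL := posdiag_unit pL.
apply/idP/idP; rewrite !inE /cone /= symmx_congr => h.
  have := @posdef_congr _ _ _ (invmx L)^T _ h.
  rewrite unitmx_tr unitmx_inv trmxK => /(_ uL).
  by rewrite !mulmxA mulVmx// mul1mx trmx_inv -mulmxA mulmxV ?unitmx_tr// mulmx1.
have := @posdef_congr _ _ _ L^T _ h.
by rewrite unitmx_tr trmxK => /(_ uL).
Qed.

Lemma wishart_density_congr n p (L B : 'M[R]_p) v : posdiag L ->
  wishart_density n (L^T *m B *m L) v =
  (\det L)^-1 ^+ n * wishart_density n B (congr_coords L v).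
Proof.
move=> pL; rewrite /wishart_density !indicE cone_congr// mulrCA.
case: (boolP (v \in _)) => vc; last by rewrite !mul0r.
rewrite !mul1r symmx_congr ln_det_gram//; last by move: vc; rewrite inE.
have dL := posdiag_det_gt0 pL.
have -> : (\det L)^-1 ^+ n = expR (- (n%:R * ln (\det L))).
  by rewrite expRN expRM_natl lnK ?posrE// exprVn.
rewrite -expRD; congr expR.
have -> : \tr (L *m symmx v *m L^T *m B) = \tr (symmx v *m (L^T *m B *m L)).
  by rewrite -!mulmxA mxtrace_mulC !mulmxA.
by field.
Qed.

Lemma wishart_scale n p (L B : 'M[R]_p) : posdiag L ->
  (\int[lebesgue_tuple 'C(p.+1, 2)]_v (wishart_density n (L^T *m B *m L) v)%:E =
  ((\det L)^-1 ^+ (n + p.+1))%:E *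
  \int[lebesgue_tuple 'C(p.+1, 2)]_v (wishart_density n B v)%:E)%E.
Proof.
move=> pL; have dL := posdiag_det_gt0 pL.
under eq_integral do rewrite wishart_density_congr//.
have mW := measurable_wishart_density n B.
have mL : measurable_fun setT (@congr_coords R p L).
  apply: measurable_coords; apply: measurable_mx_mul; last exact: measurable_mx_cst.
  by apply: measurable_mx_mul; [exact: measurable_mx_cst|exact: measurable_mx_symmx].
rewrite (integral_scale _ _ (measurableT_comp mW mL)); last 2 first.
- by rewrite exprn_ge0// invr_ge0 ltW.
- by move=> v; exact: wishart_density_ge0.
rewrite (integral_congr_coords (f := fun v => (wishart_density n B v)%:E) pL).
- by rewrite muleA -EFinM exprD (exprVn _ p.+1).
- exact/measurable_EFinP.
- by move=> v; rewrite lee_fin wishart_density_ge0.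
Qed.

Lemma integral_lebesgue_opp (f : R -> \bar R) :
  measurable_fun setT f -> (forall x, (0 <= f x)%E) ->
  (\int[lambda]_x f (- x)%R = \int[lambda]_x f x)%E.
Proof.
move=> mf f0.
pose op : measurableTypeR R -> measurableTypeR R := @GRing.opp R.
have mop : measurable_fun setT op by exact: measurable_funN.
pose m : {measure set (measurableTypeR R) -> \bar R} :=
  measure_function_pushforward__canonical__measure_function_Measure
    lambda mop.
have pf : (\int[m]_x f x = \int[lambda]_x f (- x)%R)%E.
  by rewrite (@ge0_integral_pushforward _ _ (measurableTypeR R)
    (measurableTypeR R) R op mop lambda setT f).
rewrite -pf; apply/esym/eq_measure_integral => A mA _.
apply: lebesgue_measure_unique => // _ [[x y] _ <-] /=.
rewrite /pushforward (_ : op @^-1` _ = `[- y, - x[%classic); last first.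
  apply/seteqP; split => z /=; rewrite /op !in_itv /= => /andP[h1 h2];
    by apply/andP; split; lra.
by rewrite !lebesgue_measure_itv /= !lte_fin ltrN2; case: ifP => // _;
  rewrite -!EFinD opprK addrC.
Qed.

Lemma integral_exp_abs_lty (c : R) : 0 < c ->
  (\int[lambda]_x (expR (- (c * `|x|)))%:E < +oo)%E.
Proof.
move=> c0.
have mpdf : measurable_fun setT (fun x : R => (exponential_pdf c x)%:E).
  by apply/measurable_EFinP; exact: measurable_exponential_pdf.
have pdf0 x : (0 <= (exponential_pdf c x)%:E)%E.
  by rewrite lee_fin exponential_pdf_ge0// ltW.
apply: (@le_lt_trans _ _ (\int[lambda]_x ((c^-1)%:E *
    ((exponential_pdf c x)%:E + (exponential_pdf c (- x))%:E)))%E).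
  apply: ge0_le_integral_nomeas => x; first by rewrite lee_fin expR_ge0.
  rewrite -EFinD -EFinM lee_fin ler_pdivlMl//.
  have h y : 0 <= y -> exponential_pdf c y = c * expR (- c * y).
    by move=> y0; rewrite /exponential_pdf patchE mem_set//= in_itv/= y0.
  have [x0|x0] := leP 0 x.
    rewrite ger0_norm// h// mulNr lerDl -lee_fin; exact: pdf0.
  rewrite ltr0_norm// (h (- x)) ?mulNr; last by lra.
  by rewrite lerDr -lee_fin; exact: pdf0.
have mpdfN : measurable_fun setT (fun x : R => (exponential_pdf c (- x))%:E).
  exact: (measurableT_comp mpdf (@measurable_funN _ _ _ _ _ _)).
rewrite ge0_integralZl_EFin; last 4 first.
- exact: measurableT.
- by move=> x _; rewrite adde_ge0.
- exact: emeasurable_funD.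
- by rewrite invr_ge0 ltW.
rewrite ge0_integralD//.
rewrite (integral_lebesgue_opp mpdf pdf0) integral_exponential_pdf//.
by rewrite -EFinD -EFinM ltry.
Qed.

Lemma posdef_entry_le_trace p (A : 'M[R]_p) i j : posdefmx A ->
  `|A i j| <= \tr A.
Proof.
move=> pA; have dg k : 0 <= A k k by rewrite -qf_delta posdef_qf_ge0.
have dt k : A k k <= \tr A.
  by rewrite /mxtrace (bigD1 k)//= lerDl; apply: sumr_ge0.
have := cauchy_schwarz_qf (delta_mx i 0) (delta_mx j 0) pA; rewrite !qf_delta.
have -> : dot (delta_mx i 0) (A *m delta_mx j 0) = A i j.
  by rewrite /dot trmx_delta -colE -rowE !mxE.
have tr0 := le_trans (dg i) (dt i).
move=> h; rewrite -(@ler_pXn2r _ 2)// ?nnegrE// real_normK ?num_real//.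
rewrite (le_trans h)// expr2; exact: ler_pM.
Qed.

(** The bound ln det (A / 2) <= tr A / 2 - p uses up half of the exponential, and
    the trace in the other half dominates every coordinate. *)
Lemma wishart_lty n p : (0 < n)%N -> (0 < p)%N ->
  (\int[lebesgue_tuple 'C(p.+1, 2)]_v
     (wishart_density n (1%:M : 'M[R]_p) v)%:E < +oo)%E.
Proof.
move=> n0 p0; set N := 'C(p.+1, 2).
have N0 : 0 < N%:R :> R by rewrite ltr0n bin_gt0.
have n0R : 0 < n%:R :> R by rewrite ltr0n.
pose c : R := n%:R / (4 * N%:R); have c0 : 0 < c by rewrite divr_gt0// mulr_gt0.
pose K : R := expR (n%:R / 2 * (- p%:R - p%:R * ln 2^-1)).
apply: (@le_lt_trans _ _ (\int[lebesgue_tuple N]_v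
    (K * \prod_(k < N) expR (- (c * `|tnth v k|)))%:E)%E).
  apply: ge0_le_integral_nomeas => v; rewrite lee_fin.
    exact: wishart_density_ge0.
  rewrite /wishart_density indicE; case: (boolP (v \in _)) => [vc|_]; last first.
    by rewrite mul0r mulr_ge0 ?expR_ge0// prodr_ge0// => k _; exact: expR_ge0.
  have pS : posdefmx (symmx v) by move: vc; rewrite inE.
  rewrite mul1r mulmx1 -expR_sum -expRD ler_expR.
  have := ln_det_le_trace (posdefZ (a := 2^-1) ltac:(by rewrite invr_gt0) pS).
  have dS := posdef_det_gt0 pS.
  rewrite detZ mxtraceZ lnM ?posrE ?exprn_gt0 ?invr_gt0// lnXn ?invr_gt0//.
  have h : \sum_(k < N) `|tnth v k| <= N%:R * \tr (symmx v).
    have -> : N%:R * \tr (symmx v) = \sum_(k < N) \tr (symmx v).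
      by rewrite sumr_const card_ord mulr_natl.
    by apply: ler_sum => k _; rewrite tnth_symmx posdef_entry_le_trace.
  rewrite sumrN -mulr_sumr.
  have h2 : c * \sum_(k < N) `|tnth v k| <= n%:R / 4 * \tr (symmx v).
    have -> : c = n%:R / 4 * N%:R^-1 by rewrite /c invfM mulrA.
    by rewrite -[X in X <= _]mulrA ler_wpM2l ?ler_pdivrMl// divr_ge0// ltW.
  rewrite -(mulr_natl (ln _)).
  set l := ln _; set m := ln _; set t := \tr _ in h2 *; move=> h3.
  have : n%:R / 2 * (p%:R * l + m) <= n%:R / 2 * (2^-1 * t - p%:R).
    by rewrite ler_wpM2l// divr_ge0// ltW.
  lra.
rewrite integral_scale ?expR_ge0//; last 2 first.
- apply: measurable_prod => k _; apply: measurableT_comp => //.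
  apply: (measurableT_comp (@measurable_funN _ _ _ _ _ _)) => //.
  by apply: measurableT_comp => //; exact: measurable_tnth.
- by move=> v; apply: prodr_ge0 => k _; exact: expR_ge0.
rewrite (integral_prod_lebesgue_tuple N (h := fun _ x => expR (- (c * `|x|)))).
- have := integral_exp_abs_lty c0.
  have : (0 <= \int[lambda]_x (expR (- (c * `|x|)))%:E)%E.
    by apply: integral_ge0 => x _; rewrite lee_fin expR_ge0.
  case: (\int[_]_x _)%E => // r _ _.
  by rewrite prodEFin -EFinM ltry.
- move=> _; apply: measurableT_comp => //.
  apply: (measurableT_comp (@measurable_funN _ _ _ _ _ _)) => //.
- by move=> _ x; exact: expR_ge0.
Qed.

(** The cone has nonempty interior: it contains a box around the identity. *)
Lemma cone_gt0 p : (0 < \int[lebesgue_tuple 'C(p.+1, 2)]_v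
  (\1_(@cone p) v : R)%:E)%E.
Proof.
set N := 'C(p.+1, 2).
pose e : R := (2 * p.+1%:R)^-1; have e0 : 0 < e by rewrite invr_gt0 mulr_gt0.
pose d (k : nat) : R := (tri_row k == tri_col k)%:R.
pose h k (x : R) : R := \1_`[d k - e, d k + e]%classic x.
have ih k : (\int[lambda]_x (h k x)%:E = (2 * e)%:E)%E.
  rewrite /h integral_indic//= setIT lebesgue_measure_itv/= lte_fin.
  rewrite (_ : d k - e < d k + e); last by lra.
  by rewrite -EFinD; congr EFin; ring.
apply: (@lt_le_trans _ _
    (\int[lebesgue_tuple N]_v (\prod_(k < N) h k (tnth v k))%:E)%E).
  rewrite integral_prod_lebesgue_tuple.
  - under eq_bigr do rewrite ih.
    by rewrite prodEFin lte_fin prodr_gt0// => _ _; rewrite mulr_gt0.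
  - by move=> k; apply: measurable_indic.
  - by move=> k x.
apply: ge0_le_integral_nomeas => v; rewrite lee_fin.
  by apply: prodr_ge0 => k _.
have [all1|] := boolP [forall k, tnth v k \in `[d k - e, d k + e]]; last first.
  rewrite negb_forall => /existsP[k vk].
  rewrite (bigD1 k)//= {1}/h indicE (_ : (_ \in _) = false) ?mul0r//.
  by apply/negbTE; apply: contra vk => /set_mem.
apply: (@le_trans _ _ 1).
  rewrite [leRHS](_ : 1 = \prod_(k < N) 1); last by rewrite big1.
  apply: ler_prod => k _; rewrite /h indicE; case: (_ \in _) => /=;
  by rewrite ?ler01 ?lexx.
rewrite indicE mem_set// /cone /=; split; first exact: symmx_sym.
move=> x x0; rewrite -[X in 0 < X]/(qf _ x) -[symmx v](subrK 1%:M) qfD qf1.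
have nx := nsq_gt0 x0.
have entry i j : (symmx v - 1%:M) i j ^+ 2 <= e ^+ 2.
  wlog ij : i j / (i <= j)%N.
    move=> hw; have [/hw//|/ltnW /hw] := leqP i j.
    by rewrite -[in X in X ^+ 2 <= _](trmxK (_ - _)) mxE raddfB /= symmx_sym trmx1.
  have kN := tri_pos_lt ij (ltn_ord j).
  have := forallP all1 (Ordinal kN).
  rewrite (tnth_nth 0) /= in_itv /= /d tri_rowP// tri_colP// => /andP[a1 a2].
  rewrite !mxE (maxn_idPr ij) (minn_idPl ij).
  rewrite -val_eqE /= in a1 a2 *.
  rewrite -real_normK ?num_real// lerXn2r ?nnegrE ?normr_ge0 ?(ltW e0)//.
  by rewrite ler_norml; apply/andP; split; lra.
have hn : nsq (symmx v - 1%:M) <= (2^-1) ^+ 2.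
  apply: (@le_trans _ _ (\sum_(i < p) \sum_(j < p) e ^+ 2)).
    by apply: ler_sum => i _; apply: ler_sum => j _; exact: entry.
  rewrite !sumr_const !card_ord -mulrnA -[X in X <= _]mulr_natr natrM -expr2 -exprMn.
  rewrite lerXn2r ?nnegrE ?mulr_ge0 ?invr_ge0 ?(ltW e0)//.
  rewrite /e invfM -mulrA ler_piMr ?invr_ge0// mulrC ler_pdivrMr// mul1r.
  by rewrite ler_nat.
have := qf_le_nsq x (ltac:(by rewrite invr_ge0) : 0 <= 2^-1 :> R) hn.
by rewrite ler_norml => /andP[+ _]; lra.
Qed.

Lemma wishart_gt0 n p :
  (0 < \int[lebesgue_tuple 'C(p.+1, 2)]_v
     (wishart_density n (1%:M : 'M[R]_p) v)%:E)%E.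
Proof.
set N := 'C(p.+1, 2).
have ge0 : (0 <= \int[lebesgue_tuple N]_v
     (wishart_density n (1%:M : 'M[R]_p) v)%:E)%E.
  by apply: integral_ge0 => v _; rewrite lee_fin wishart_density_ge0.
rewrite lt_def ge0 andbT; apply/eqP => Z0.
have mW := measurable_wishart_density n (1%:M : 'M[R]_p).
have /ae_eq_integral_abs : (\int[lebesgue_tuple N]_v
    `|(wishart_density n (1%:M : 'M[R]_p) v)%:E| = 0)%E.
  rewrite -[RHS]Z0; apply: eq_integral => v _.
  by rewrite gee0_abs// lee_fin wishart_density_ge0.
have /measurable_EFinP mE := mW.
move=> /(_ measurableT mE) ae0.
have := cone_gt0 p.
rewrite (@ae_eq_integral _ _ _ (lebesgue_tuple N) setT (cst 0%E))//.
- by rewrite integral0 ltxx.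
- by apply/measurable_EFinP; apply: measurable_indic; exact: measurable_cone.
apply: filterS ae0 => v /(_ Logic.I) + _ => /eqP.
rewrite /wishart_density eqe mulf_eq0 (gt_eqF (expR_gt0 _)) orbF => /eqP h.
by rewrite h.
Qed.

End wishart.

(** * Concentration of the reference posterior and of the sample covariance *)

Section posdiag_mul.
Context {R : realType}.

Lemma posdiag_mul p (W V : 'M[R]_p) : posdiag W -> posdiag V ->
  posdiag (W *m V).
Proof.
move=> [/is_trig_mxP tW W0] [/is_trig_mxP tV V0]; split.
  apply/is_trig_mxP => i j ij; rewrite mxE big1// => k _.
  have [ik|ki] := ltnP i k; first by rewrite tW// mul0r.
  by rewrite tV ?mulr0// (leq_ltn_trans ki ij).
move=> i; rewrite mxE (bigD1 i)//= big1 ?addr0 ?mulr_gt0// => k ki.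
have [ik|ki'] := ltnP i k; first by rewrite tW// mul0r.
by rewrite tV ?mulr0// ltn_neqAle ki ki'.
Qed.

End posdiag_mul.

Section wishart_concentration.
Context {R : realType}.

Lemma wishart_total n p (V : 'M[R]_p) : posdiag V -> (0 < n)%N -> (0 < p)%N ->
  exists2 Z : R, 0 < Z &
  (\int[lebesgue_tuple 'C(p.+1, 2)]_v (wishart_density n (V^T *m V) v)%:E =
   Z%:E)%E.
Proof.
move=> pV n0 p0; have := wishart_scale n (1%:M : 'M[R]_p) pV.
rewrite mulmx1 => ->.
have := wishart_gt0 (R := R) n p; have := wishart_lty (R := R) n0 p0.
case: (\int[_]_v _)%E => // r _; rewrite lte_fin => r0.
exists ((\det V)^-1 ^+ (n + p.+1) * r); last by rewrite EFinM.
by rewrite mulr_gt0// exprn_gt0// invr_gt0 posdiag_det_gt0.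
Qed.

(** The factor exp(n/2 tr((1 - W^T W) G)) turns the scale V^T V into
    (W V)^T (W V), so the Laplace transform of G is given by [wishart_scale]. *)
Lemma wishart_moment n p (V : 'M[R]_p) (Z : R) : posdiag V ->
  (16 <= n)%N -> (p.+1 ^ 2 <= n)%N -> (0 < p)%N ->
  (\int[lebesgue_tuple 'C(p.+1, 2)]_v (wishart_density n (V^T *m V) v)%:E =
   Z%:E)%E ->
  (\int[lebesgue_tuple 'C(p.+1, 2)]_v (wishart_density n (V^T *m V) v *
     nsq (V *m symmx v *m V^T - 1%:M))%:E <=
   (8 * expR 9 * (p ^ 2)%:R / n%:R * Z)%:E)%E.
Proof.
move=> pV n16 pn p0 ZE.
have n0 : (0 < n)%N by rewrite (leq_trans _ n16).
have pn' : (p.+1 <= n)%N by rewrite (leq_trans _ pn)// -mulnn leq_pmulr.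
apply: (@second_moment _ _ _ _ n (n + p.+1)) => //.
- exact: leq_addr.
- by rewrite -addnn leq_add2l.
- by rewrite addKn.
- exact: measurable_wishart_density.
- by move=> v; exact: wishart_density_ge0.
- apply: measurable_mx_mul; last exact: measurable_mx_cst.
  by apply: measurable_mx_mul; [exact: measurable_mx_cst|exact: measurable_mx_symmx].
- by move=> v; rewrite !trmx_mul trmxK symmx_sym mulmxA.
move=> W pW.
have E v : wishart_density n (V^T *m V) v *
    expR (n%:R / 2 * \tr ((1%:M - W^T *m W) *m (V *m symmx v *m V^T))) =
    wishart_density n ((W *m V)^T *m 1%:M *m (W *m V)) v.
  rewrite /wishart_density -[LHS]mulrA -expRD; congr (_ * expR _).
  rewrite mulmxBl mul1mx raddfB /= mulmx1 trmx_mul.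
  have -> : \tr (V *m symmx v *m V^T) = \tr (symmx v *m (V^T *m V)).
    by rewrite -mulmxA mxtrace_mulC mulmxA.
  have -> : \tr (W^T *m W *m (V *m symmx v *m V^T)) =
      \tr (symmx v *m (V^T *m W^T *m (W *m V))).
    by rewrite mxtrace_mulC -!mulmxA mxtrace_mulC !mulmxA.
  by ring.
under eq_integral do rewrite E.
rewrite wishart_scale; last exact: posdiag_mul.
have := wishart_scale n (1%:M : 'M[R]_p) pV; rewrite mulmx1 ZE => hZ.
by rewrite [RHS]EFinM hZ muleA -EFinM det_mulmx -exprMn -invfM.
Qed.

End wishart_concentration.

Section gaussian.
Context {R : realType}.

Lemma measurable_mvnormal_pdf p (Sigma : 'M[R]_p) :
  measurable_fun setT (mvnormal_pdf Sigma).
Proof.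
apply: measurable_funM => //; apply: measurableT_comp => //.
apply: measurable_funM => //; apply: measurable_funN.
have -> : (fun x : p.-tuple R => ((colv x)^T *m invmx Sigma *m colv x) 0 0) =
    (fun x => \tr ((colv x)^T *m invmx Sigma *m colv x)).
  by apply/funext => x; rewrite /mxtrace big_ord1.
apply: measurable_mx_trace; apply: measurable_mx_mul; last exact: measurable_mx_colv.
apply: measurable_mx_mul; last exact: measurable_mx_cst.
by move=> i j; under eq_fun do rewrite mxE; exact: measurable_mx_colv.
Qed.

Lemma mvnormal_pdf_ge0 p (Sigma : 'M[R]_p) x : 0 <= mvnormal_pdf Sigma x.
Proof. by rewrite mulr_ge0 ?expR_ge0// invr_ge0 sqrtr_ge0. Qed.

(** The integrand is the Gaussian density after the triangular substitution
    x |-> W U x instead of U x, so its integral is the total mass divided by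
    det W. *)
Lemma mvnormal_mgf p (Sigma U W : 'M[R]_p) : posdiag U -> posdiag W ->
  invmx Sigma = U^T *m U -> mvnormal_prob Sigma setT = 1%E ->
  (\int[lebesgue_tuple p]_x (mvnormal_pdf Sigma x *
     expR (2^-1 * \tr ((1%:M - W^T *m W) *m
       (U *m (colv x *m (colv x)^T) *m U^T))))%:E = ((\det W)^-1)%:E)%E.
Proof.
move=> pU pW SU mass.
pose k : R := (Num.sqrt ((2 * pi) ^+ p * \det Sigma))^-1.
have k0 : 0 <= k by rewrite invr_ge0 sqrtr_ge0.
pose g (x : p.-tuple R) : R := expR (- (nsq (colv x) / 2)).
have mg : measurable_fun setT g.
  apply: measurableT_comp => //; apply: measurable_funN.
  by apply: measurable_funM => //; apply: measurable_mx_nsq; exact: measurable_mx_colv.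
have g0 x : 0 <= g x by exact: expR_ge0.
have scale (L : 'M[R]_p) : posdiag L ->
    (\int[lebesgue_tuple p]_x (k * g (mulmx_tuple L x))%:E =
     ((\det L)^-1)%:E * \int[lebesgue_tuple p]_x (k * g x)%:E)%E.
  move=> pL; rewrite (integral_mulmx_tuple (f := fun x => (k * g x)%:E) pL)//.
    by apply/measurable_EFinP; exact: measurable_funM.
  by move=> v; rewrite lee_fin mulr_ge0.
have pdfE x : mvnormal_pdf Sigma x = k * g (mulmx_tuple U x).
  by rewrite /mvnormal_pdf /g colv_mulmx_tuple -qf_gram SU mulNr.
have E x : mvnormal_pdf Sigma x * expR (2^-1 * \tr ((1%:M - W^T *m W) *m
       (U *m (colv x *m (colv x)^T) *m U^T))) = k * g (mulmx_tuple (W *m U) x).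
  rewrite pdfE -[LHS]mulrA /g -expRD !colv_mulmx_tuple; congr (_ * expR _).
  set y := U *m colv x.
  have -> : U *m (colv x *m (colv x)^T) *m U^T = y *m y^T.
    by rewrite /y trmx_mul !mulmxA.
  rewrite -(mulmxA W U) -/y; clearbody y.
  rewrite mulmxBl mul1mx raddfB /=.
  have -> : \tr (y *m y^T) = nsq y by rewrite mxtrace_mulC -nsq_trace.
  have -> : \tr (W^T *m W *m (y *m y^T)) = nsq (W *m y).
    rewrite nsq_trace trmx_mul mulmxA mxtrace_mulC.
    by rewrite !mulmxA.
  by field.
under eq_integral do rewrite E.
rewrite scale; last exact: posdiag_mul.
move: mass; rewrite /mvnormal_prob.
under eq_integral do rewrite pdfE.
rewrite scale// det_mulmx invfM EFinM -muleA => ->.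
by rewrite mule1.
Qed.

End gaussian.

Section independence.
Context d d' (T : measurableType d) (T' : measurableType d') (R : realType).

(** Independence is a product rule for indicators.  They are exchanged for
    functions one variable at a time, by [transfer_integral] with the product of
    the other factors as weight. *)
Lemma independent_prod (P : probability T R) n (X : 'I_n -> {RV P >-> T'})
    (f : T' -> R) (e : R) : mutually_independent X ->
  measurable_fun setT f -> (forall y, 0 <= f y) ->
  (forall i, \int[P]_w (f (X i w))%:E = e%:E)%E ->
  (\int[P]_w (\prod_i f (X i w))%:E = (e ^+ n)%:E)%E.
Proof.
move=> indep mf f0 fe.
pose q i A : R := fine (P (X i @^-1` A)).
have mX i : measurable_fun setT (X i) by [].
have mXA i A : measurable A -> measurable (X i @^-1` A).
  by move=> mA; rewrite -[X in measurable X]setTI; exact: mX.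
have qE i A : measurable A -> P (X i @^-1` A) = (q i A)%:E.
  by move=> mA; rewrite fineK// fin_num_measure//; exact: mXA.
have q0 i A : 0 <= q i A by rewrite fine_ge0.
have e0 : (0 < n)%N -> 0 <= e.
  move=> n0; rewrite -lee_fin -(fe (Ordinal n0)).
  by apply: integral_ge0 => w _; rewrite lee_fin.
have claim k : (k <= n)%N -> forall A : 'I_n -> set T',
    (forall i, measurable (A i)) ->
    (\int[P]_w (\prod_(i < n) (if (i < k)%N then f (X i w) else \1_(A i) (X i w)))%:E =
     (\prod_(i < n) (if (i < k)%N then e else q i (A i)))%:E)%E.
  elim: k => [_ A mA|k IH kn A mA].
    have := indep [set: 'I_n]%SET A mA.
    under [X in _ = X -> _]eq_bigr do rewrite qE//.
    rewrite prodEFin => h.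
    rewrite [RHS](_ : _ = (\prod_(i in [set: 'I_n]%SET) q i (A i))%:E); last first.
      by congr EFin; apply: eq_bigl => i; rewrite inE.
    rewrite -h -[X in P X]setIT -integral_indic//; last first.
      by apply: fin_bigcap_measurable => // i _; exact: mXA.
    apply: eq_integral => w _; congr EFin; rewrite indicE.
    have [Aw|/existsNP[i iw]] := pselect (forall i, A i (X i w)).
      rewrite mem_set; last by move=> i _; exact: Aw.
      by rewrite big1// => i _; rewrite indicE mem_set//; exact: Aw.
    rewrite memNset; last by move=> /(_ i); rewrite /= inE => /(_ isT).
    by rewrite (bigD1 i)//= indicE memNset// mul0r.
  pose kk := Ordinal kn.
  pose H w := \prod_(i < n | i != kk) (if (i < k.+1)%N then f (X i w) else \1_(A i) (X i w)).
  pose c := \prod_(i < n | i != kk) (if (i < k.+1)%N then e else q i (A i)).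
  have lt_kk i : i != kk -> (i < k.+1)%N = (i < k)%N.
    by move=> ik; rewrite ltnS leq_eqVlt -(inj_eq val_inj) /= in ik *; rewrite (negbTE ik).
  have mH : measurable_fun setT H.
    rewrite (_ : H = fun w => \prod_(i <- [seq i <- index_enum 'I_n | i != kk])
        (if (i < k.+1)%N then f (X i w) else \1_(A i) (X i w))); last first.
      by apply/funext => w; rewrite big_filter.
    apply: (@measurable_prod _ _ _ _ _ _ (fun (i : 'I_n) w =>
        if (i < k.+1)%N then f (X i w) else \1_(A i) (X i w))) => i _ /=.
    case: (i < k.+1)%N; first exact: (measurableT_comp mf (mX i)).
    exact: (measurableT_comp (measurable_indic (mA i)) (mX i)).
  have H0 w : 0 <= H w by apply: prodr_ge0 => i _; case: ifP.
  have c0 : 0 <= c.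
    apply: prodr_ge0 => i _; case: ifP => _ //; apply: e0.
    exact: leq_ltn_trans (leq0n i) (ltn_ord i).
  have step B : measurable B -> (\int[P]_(w in X kk @^-1` B) (H w)%:E =
      \int[distribution P (X kk)]_(y in B) c%:E)%E.
    move=> mB; rewrite integral_cst// [X in _ = (_ * X)%E](qE kk B mB).
    pose A' i := if i == kk then B else A i.
    have mA' i : measurable (A' i) by rewrite /A'; case: ifP.
    have := IH (ltnW kn) A' mA'.
    rewrite [X in _ = X%:E](bigD1 kk)//= ltnn /A' eqxx => h.
    rewrite integral_mkcond epatch_indic.
    transitivity (\int[P]_w (\prod_(i < n) (if (i < k)%N then f (X i w)
        else \1_(A' i) (X i w)))%:E)%E.
      apply: eq_integral => w _ /=; rewrite (bigD1 kk)//= ltnn /A' eqxx -EFinM.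
      congr EFin; rewrite mulrC; congr (_ * _).
      by apply: eq_bigr => i ik; rewrite lt_kk// (negbTE ik).
    rewrite h -EFinM mulrC; congr EFin; congr (_ * _).
    by apply: eq_bigr => i ik; rewrite lt_kk// (negbTE ik).
  have := transfer_integral (mX kk) mH (measurable_cst c) H0 (fun _ => c0) step.
  move=> /(_ (EFin \o f)); rewrite /= => tr.
  transitivity (\int[P]_w ((H w)%:E * (f (X kk w))%:E))%E.
    apply: eq_integral => w _; rewrite (bigD1 kk)//= ltnSn EFinM muleC.
    by [].
  rewrite tr; last 2 first.
  - exact/measurable_EFinP.
  - by move=> y; rewrite lee_fin.
  under eq_integral do rewrite -EFinM.
  rewrite integral_scale//.
  rewrite (bigD1 kk)//= ltnSn [RHS]EFinM muleC; congr (_ * _)%E.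
  rewrite -(fe kk) ge0_integral_pushforward//; first exact/measurable_EFinP.
  by move=> y _; rewrite lee_fin.
have := claim n (leqnn n) (fun=> setT) (fun=> measurableT).
under eq_integral => w _.
  under eq_bigr do rewrite ltn_ord.
  over.
move=> ->; under eq_bigr do rewrite ltn_ord.
by rewrite prodr_const card_ord.
Qed.

End independence.

Section sampling.
Context {R : realType}.

Lemma sample_cov_sym n p (x : 'I_n -> p.-tuple R) :
  (sample_cov x)^T = sample_cov x.
Proof.
rewrite /sample_cov linearZ /= raddf_sum; congr (_ *: _).
by apply: eq_bigr => i _; rewrite /= trmx_mul trmxK.
Qed.

Lemma measurable_mx_sample_cov d (T : measurableType d) n p (P : probability T R)
    (X : 'I_n -> {RV P >-> p.-tuple R}) :
  measurable_mx (fun w => sample_cov (fun i => X i w)).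
Proof.
apply: measurable_mx_scale => i j.
under eq_fun do rewrite summxE.
apply: measurable_sum => k; under eq_fun do rewrite mxE big_ord1 !mxE.
apply: measurable_funM;
  exact: (measurableT_comp (measurable_tnth _)).
Qed.

(** In the coordinates U x the Laplace transform of the sample covariance is the
    n-th power of the one of a single standard Gaussian vector. *)
Lemma sampling_moment d (T : measurableType d) (P : probability T R) n p
    (X : 'I_n -> {RV P >-> p.-tuple R}) (Sigma U : 'M[R]_p) :
  iid_mvnormal X Sigma -> posdiag U -> invmx Sigma = U^T *m U ->
  (16 <= n)%N ->
  (\int[P]_w (nsq (U *m sample_cov (fun i => X i w) *m U^T - 1%:M))%:E <=
   (8 * expR 9 * (p ^ 2)%:R / n%:R)%:E)%E.
Proof.
move=> [indep law] pU SU n16.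
have n0 : (0 < n)%N by rewrite (leq_trans _ n16).
have n0R : 0 < n%:R :> R by rewrite ltr0n.
have mass : mvnormal_prob Sigma setT = 1%E.
  by rewrite -(law (Ordinal n0))// probability_setT.
under eq_integral do rewrite -[nsq _]mul1r.
rewrite -[X in (_ <= X%:E)%E]mulr1.
apply: (@second_moment _ _ _ _ n n _ (fun=> 1)) => //.
- by rewrite -addnn leq_addr.
- by rewrite subnn exp0n.
- apply: measurable_mx_mul; last exact: measurable_mx_cst.
  by apply: measurable_mx_mul; [exact: measurable_mx_cst|exact: measurable_mx_sample_cov].
- by move=> w; rewrite !trmx_mul trmxK sample_cov_sym mulmxA.
move=> W pW.
pose f (y : p.-tuple R) : R := expR (2^-1 * \tr ((1%:M - W^T *m W) *m
       (U *m (colv y *m (colv y)^T) *m U^T))).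
have mf : measurable_fun setT f.
  apply: measurableT_comp => //; apply: measurable_funM => //.
  apply: measurable_mx_trace; apply: measurable_mx_mul; first exact: measurable_mx_cst.
  apply: measurable_mx_mul; last exact: measurable_mx_cst.
  apply: measurable_mx_mul; first exact: measurable_mx_cst.
  apply: measurable_mx_mul; first exact: measurable_mx_colv.
  by move=> i j; under eq_fun do rewrite mxE; exact: measurable_mx_colv.
have fe i : (\int[P]_w (f (X i w))%:E = ((\det W)^-1)%:E)%E.
  have := @transfer_integral _ _ _ _ R P (lebesgue_tuple p) (X i) (cst 1)
    (mvnormal_pdf Sigma).
  move=> /(_ ltac:(by []) (measurable_cst _) (measurable_mvnormal_pdf _)).
  move=> /(_ (fun _ => ler01) (@mvnormal_pdf_ge0 _ _ _)).
  have h A : measurable A -> (\int[P]_(x in X i @^-1` A) (cst 1 x)%:E =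
      \int[lebesgue_tuple p]_(y in A) (mvnormal_pdf Sigma y)%:E)%E.
    move=> mA; rewrite -[LHS]/(\int[P]_(x in X i @^-1` A) (cst 1 x))%E.
    rewrite integral_cst ?mul1e; first exact: law.
    by rewrite -[X in measurable X]setTI; exact: measurable_funP.
  move=> /(_ h (EFin \o f)) tr.
  transitivity (\int[P]_w ((cst 1 w)%:E * (EFin \o f) (X i w)))%E.
    by apply: eq_integral => w _; rewrite mul1e.
  rewrite tr; last 2 first.
  - exact/measurable_EFinP.
  - by move=> y; rewrite lee_fin expR_ge0.
  rewrite -(mvnormal_mgf pU pW SU mass); apply: eq_integral => y _.
  by rewrite /= EFinM.
have := independent_prod indep mf (fun y => expR_ge0 _) fe.
rewrite mulr1 => <-; apply: eq_integral => w _; congr EFin.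
rewrite mul1r /f -expR_sum; congr expR.
rewrite -mulr_sumr /sample_cov -scalemxAr -scalemxAl -scalemxAr mxtraceZ.
have -> t : n%:R / 2 * (n%:R^-1 * t) = 2^-1 * t :> R.
  by field; rewrite gt_eqF.
congr (_ * _); rewrite mulmx_sumr mulmx_suml mulmx_sumr raddf_sum.
by apply: eq_bigr.
Qed.

End sampling.

(** * Normal limit of a log-gamma density *)

Section log_gamma.
Context {R : realType}.
Local Notation lambda := (@lebesgue_measure R).

(** Unnormalized density of - sqrt k * ln Y, where Y has a gamma law of shape
    k + t * sqrt k and rate k. *)
Definition log_gamma (k t : R) (x : R) : R :=
  expR (- (k * (expR (- (x / Num.sqrt k)) - 1 + x / Num.sqrt k)) - t * x).

Definition gauss (x : R) : R := expR (- (x ^+ 2 / 2)).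

Lemma expR_sub1_le (c : R) : c <= 2^-1 -> expR c - 1 - c <= 2 * c ^+ 2.
Proof.
move=> c2; have h := expR_ge1Dx (- c).
have c1 : 0 < 1 - c by lra.
have : expR c <= (1 - c)^-1.
  by rewrite -[expR c]invrK -expRN lef_pV2// posrE ?expR_gt0.
suff : (1 - c)^-1 - 1 - c <= 2 * c ^+ 2 by lra.
have -> : (1 - c)^-1 - 1 - c = c ^+ 2 / (1 - c) by field; lra.
rewrite ler_pdivrMr//; have := sqr_ge0 c; nra.
Qed.

Lemma expR_taylor2 (t : R) : `|t| <= 2^-1 ->
  `|expR t - 1 - t - t ^+ 2 / 2| <= 2 * `|t| ^+ 3.
Proof.
move=> t2; have [->|t0] := eqVneq t 0.
  by rewrite expR0 normr0 !expr0n /= !mul0r mulr0 !subr0 subrr normr0.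
pose f (x : R) := expR x - 1 - x - x ^+ 2 / 2.
pose df (x : R) := expR x - 1 - x.
have fd (x : R) : is_derive x 1 f (df x).
  rewrite /f /df.
  apply: is_derive_eq; rewrite ?scaler0.
  by rewrite /GRing.scale /= !mulr1 subr0; field.
have fc (a b : R) : {within `[a, b], continuous f}.
  by apply: derivable_within_continuous => x _; exact: ex_derive.
have f0 : f 0 = 0 by rewrite /f expR0 expr0n /= mul0r !subr0 subrr.
have bound (c : R) : `|c| <= `|t| -> `|df c| <= 2 * `|t| ^+ 2.
  move=> ct; rewrite /df ger0_norm; last by have := expR_ge1Dx c; lra.
  apply: (le_trans (expR_sub1_le _)).
    by rewrite (le_trans (ler_norm _))// (le_trans ct).
  by rewrite -(real_normK (num_real c)) ler_pM2l// lerXn2r ?nnegrE.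
have fin (c : R) : f t = df c * t -> `|c| <= `|t| ->
    `|f t| <= 2 * `|t| ^+ 3.
  move=> -> ct; rewrite normrM exprSr mulrA ler_wpM2r//; exact: bound.
have [tp|tn] := ltP 0 t.
  have [c] := MVT tp (fun x _ => fd x) (fc _ _).
  rewrite in_itv/= f0 subr0 subr0 => /andP[c0 ct] E; apply: (fin c E).
  by rewrite !gtr0_norm// ltW.
have tn' : t < 0 by rewrite lt_neqAle t0.
have [c] := MVT tn' (fun x _ => fd x) (fc _ _).
rewrite in_itv/= f0 !sub0r => /andP[c0 ct] E; apply: (fin c).
  by apply: oppr_inj; rewrite E mulrN.
by rewrite !ltr0_norm// lerN2 ltW.
Qed.

(** The exponent is - x^2 / 2 up to the cubic Taylor remainder of exp and the
    tilt. *)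
Lemma log_gamma_close (k t x : R) : 0 < k -> 2 * `|x| <= Num.sqrt k ->
  0 <= t ->
  `|(- (k * (expR (- (x / Num.sqrt k)) - 1 + x / Num.sqrt k)) - t * x)
    + x ^+ 2 / 2| <= 2 * `|x| ^+ 3 / Num.sqrt k + t * `|x|.
Proof.
move=> k0 xk t0; set s := Num.sqrt k in xk *.
have s0 : 0 < s by rewrite sqrtr_gt0.
have ks : k = s ^+ 2 by rewrite sqr_sqrtr// ltW.
set u := - (x / s).
have u2 : `|u| <= 2^-1.
  by rewrite normrN normrM normfV (gtr0_norm s0) ler_pdivrMr// mulrC; lra.
have := expR_taylor2 u2.
have -> : - (k * (expR u - 1 + x / s)) - t * x + x ^+ 2 / 2 =
    - (k * (expR u - 1 - u - u ^+ 2 / 2)) - t * x.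
  by rewrite /u ks; field; lra.
set r := expR u - 1 - u - u ^+ 2 / 2 => hr.
apply: (le_trans (ler_normB _ _)); rewrite normrN !normrM (gtr0_norm k0).
rewrite (ger0_norm t0) lerD2r.
apply: (@le_trans _ _ (k * (2 * `|u| ^+ 3))); first by rewrite ler_pM2l.
rewrite normrN normrM normfV (gtr0_norm s0) ks.
by rewrite le_eqVlt; apply/orP; left; apply/eqP; field; lra.
Qed.

(** Tangent lines of exp at distance 3 / sqrt k give an integrable envelope
    that does not depend on the parameters. *)
Lemma log_gamma_le (k t x : R) : 36 <= k -> 0 <= t <= 1 ->
  log_gamma k t x <= expR 9 * expR (- `|x|).
Proof.
move=> k36 /andP[t0 t1]; rewrite /log_gamma -expRD ler_expR.
set s := Num.sqrt k.
have k0 : 0 < k by lra.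
have s0 : 0 < s by rewrite sqrtr_gt0.
have ks : k = s ^+ 2 by rewrite sqr_sqrtr// ltW.
have s6 : 6 <= s.
  have : (6 : R) ^+ 2 <= s ^+ 2 by rewrite -ks (_ : 6 ^+ 2 = 36)//; ring.
  by rewrite ler_pXn2r// nnegrE ltW.
have [x0|x0] := leP 0 x.
  rewrite ger0_norm//; set a := 3 / s.
  have a0 : 0 < a by rewrite divr_gt0.
  have a2 : a <= 2^-1 by rewrite ler_pdivrMr//; lra.
  have v0 : 0 <= x / s by rewrite divr_ge0// ltW.
  (* tangent at -a *)
  have h1 : expR (- a) * (1 + (a - x / s)) <= expR (- (x / s)).
    rewrite [X in _ <= expR X](_ : _ = - a + (a - x / s)); last by ring.
    by rewrite expRD ler_pM2l ?expR_gt0// expR_ge1Dx.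
  have h2 : expR (- a) <= (1 + a)^-1.
    by rewrite expRN lef_pV2 ?posrE ?expR_gt0 ?expR_ge1Dx//; lra.
  have h3 : 1 - a <= expR (- a) by exact: expR_ge1Dx.
  have h4 : (1 + a)^-1 <= 1 - 2 / 3 * a.
    have -> : 1 - 2 / 3 * a = (1 + a)^-1 * ((1 - 2 / 3 * a) * (1 + a)).
      by field; lra.
    by rewrite ler_peMr ?invr_ge0; nra.
  have h5 : - a ^+ 2 + 2 / 3 * a * (x / s) <= expR (- (x / s)) - 1 + x / s.
    have : (expR (- a)) * (x / s) <= (1 - 2 / 3 * a) * (x / s).
      by rewrite ler_wpM2r//; lra.
    have : (1 - a) * (1 + a) <= expR (- a) * (1 + a) by rewrite ler_pM2r//; lra.
    lra.
  have h6 : k * (- a ^+ 2 + 2 / 3 * a * (x / s)) = 2 * x - 9.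
    by rewrite /a ks; field; lra.
  have h7 : 2 * x - 9 <= k * (expR (- (x / s)) - 1 + x / s).
    by rewrite -h6 ler_pM2l.
  have : 0 <= t * x by rewrite mulr_ge0.
  lra.
rewrite ltr0_norm//; set w := - x; have w0 : 0 < w by rewrite /w; lra.
have -> : x = - w by rewrite /w opprK.
set a := 2 / s.
have a0 : 0 < a by rewrite divr_gt0.
have v0 : 0 <= w / s by rewrite divr_ge0// ltW.
rewrite mulNr opprK.
have h1 : expR a * (1 + (w / s - a)) <= expR (w / s).
  rewrite [X in _ <= expR X](_ : _ = a + (w / s - a)); last by ring.
  by rewrite expRD ler_pM2l ?expR_gt0// expR_ge1Dx.
have h3 : 1 + a <= expR a by exact: expR_ge1Dx.
have h5 : - a ^+ 2 + a * (w / s) <= expR (w / s) - 1 - w / s.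
  have a1 : a <= 1 by rewrite ler_pdivrMr//; lra.
  have : (1 + a) * (w / s) <= expR a * (w / s) by rewrite ler_wpM2r.
  have : (1 + a) * (1 - a) <= expR a * (1 - a) by rewrite ler_wpM2r//; lra.
  lra.
have h6 : k * (- a ^+ 2 + a * (w / s)) = 2 * w - 4.
  by rewrite /a ks; field; lra.
have h7 : 2 * w - 4 <= k * (expR (w / s) - 1 - w / s).
  by rewrite -h6 ler_pM2l.
have : t * w <= w by nra.
lra.
Qed.

End log_gamma.

Section log_gamma_limit.
Context {R : realType}.
Local Notation lambda := (@lebesgue_measure R).

Lemma measurable_log_gamma (k t : R) : measurable_fun [set: R] (log_gamma k t).
Proof.
apply: measurableT_comp => //; apply: measurable_funB; last exact: measurable_funM.
apply: measurable_funN; apply: measurable_funM => //.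
apply: measurable_funD; last exact: measurable_funM.
apply: measurable_funB => //; apply: measurableT_comp => //.
by apply: measurable_funN; exact: measurable_funM.
Qed.

Lemma measurable_gauss : measurable_fun [set: R] gauss.
Proof.
apply: measurableT_comp => //; by apply: measurable_funN; exact: measurable_funM.
Qed.

Lemma integrable_envelope : lambda.-integrable setT
  (fun x => (expR 9 * expR (- `|x|))%:E).
Proof.
have mE0 : measurable_fun [set: R] (fun x => expR (- `|x|)).
  apply: measurableT_comp => //.
  by apply: measurable_funN; exact: normr_measurable.
have mE : measurable_fun [set: R] (fun x => expR 9 * expR (- `|x|)).
  exact: measurable_funM.
apply/integrableP; split; first exact/measurable_EFinP.
have fin : (\int[lambda]_x (expR (- `|x|))%:E < +oo)%E.
  have := integral_exp_abs_lty (R := R) ltr01.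
  by under eq_integral do rewrite mul1r.
rewrite (_ : (\int[_]_x _)%E = ((expR 9)%:E * \int[lambda]_x (expR (- `|x|))%:E)%E).
  have : (0 <= \int[lambda]_x (expR (- `|x|))%:E)%E.
    by apply: integral_ge0 => x _; rewrite lee_fin expR_ge0.
  by case: (\int[_]_x _)%E fin => // r _ _; rewrite -EFinM ltry.
rewrite -[RHS](integral_scale lambda (expR_ge0 9) mE0 (fun x => expR_ge0 _)).
by apply: eq_integral => x _; rewrite gee0_abs// lee_fin mulr_ge0 ?expR_ge0.
Qed.

Lemma integrable_log_gamma k t : 36 <= k -> 0 <= t <= 1 ->
  lambda.-integrable setT (EFin \o log_gamma k t).
Proof.
move=> k36 t01; apply: le_integrable integrable_envelope => //.
  by apply/measurable_EFinP; exact: measurable_log_gamma.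
move=> x _ /=; rewrite lee_fin [leLHS]ger0_norm ?expR_ge0//.
by rewrite [leRHS]ger0_norm ?mulr_ge0 ?expR_ge0//; exact: log_gamma_le.
Qed.

Lemma gaussE (x : R) : normal_pdf 0 1 x = normal_peak 1 * gauss x.
Proof.
rewrite normal_pdfE ?oner_neq0// /normal_fun /gauss subr0 expr1n.
by congr (_ * expR _); rewrite mulNr.
Qed.

Lemma integral_normal_pdf_gauss (D : set R) : measurable D ->
  normal_prob 0 1 D = ((normal_peak 1)%:E * \int[lambda]_(x in D) (gauss x)%:E)%E.
Proof.
move=> mD; rewrite /normal_prob.
under eq_integral do rewrite gaussE EFinM.
rewrite ge0_integralZl_EFin//.
- by move=> x _; rewrite lee_fin expR_ge0.
- apply/measurable_EFinP; apply: measurable_funTS; exact: measurable_gauss.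
- exact: normal_peak_ge0.
Qed.

Lemma integrable_gauss : lambda.-integrable setT (EFin \o gauss).
Proof.
have := integrable_normal_pdf (0 : R) 1.
have pk : normal_peak (1 : R) != 0 by rewrite gt_eqF// normal_peak_gt0// oner_neq0.
move=> /(integrableZl measurableT (normal_peak (1 : R))^-1).
apply: eq_integrable => // x _ /=.
by rewrite -EFinM gaussE mulKf.
Qed.

Lemma log_gamma_cvg (k t : nat -> R) (x : R) :
  (forall n, n%:R + 36 <= k n) -> (forall n, 0 <= t n) ->
  (forall n, (n%:R + 36) * t n <= 1) ->
  log_gamma (k n) (t n) x @[n --> \oo] --> gauss x.
Proof.
move=> kn t0 tn; apply: continuous_cvg; first exact: continuous_expR.
apply/cvgrPdist_le => e e0.
pose Y : R := 2 * `|x| ^+ 3 + `|x|; pose M : R := 2 * `|x| + 2 * (Y / e).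
have x3 : 0 <= 2 * `|x| ^+ 3 by rewrite mulr_ge0// exprn_ge0.
have Y0 : 0 <= Y / e by rewrite mulr_ge0 ?invr_ge0 ?(ltW e0)// addr_ge0.
have M0 : 0 <= M by have := normr_ge0 x; rewrite /M; lra.
near=> n.
have nM : (M + 1) ^+ 2 <= n%:R by near: n; exact: nbhs_infty_ger.
have n0 : 0 <= n%:R :> R by [].
have knn := kn n; have k0 : 0 < k n by lra.
set s := Num.sqrt (k n).
have s0 : 0 < s by rewrite sqrtr_gt0.
have s2 : s ^+ 2 = k n by rewrite sqr_sqrtr// ltW.
have sM : M + 1 <= s.
  by rewrite -(@ler_pXn2r _ 2)// ?nnegrE ?(ltW s0)// ?s2; lra.
have xs : 2 * `|x| <= s by rewrite /M in sM; lra.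
rewrite distrC opprK; apply: (le_trans (log_gamma_close k0 xs (t0 n))).
rewrite -/s [leRHS](splitr e); apply: lerD.
  apply: (@le_trans _ _ (Y / s)).
    by rewrite ler_pM2r ?invr_gt0// /Y lerDl.
  have h0 : Y / (e / 2) <= s.
    rewrite invfM invrK mulrA (mulrC _ 2); have := normr_ge0 x.
    by rewrite /M in sM; lra.
  rewrite ler_pdivrMr ?divr_gt0// in h0.
  by rewrite ler_pdivrMr// [leRHS]mulrC.
have h1 : `|x| <= n%:R * (e / 2).
  have : Y / e <= n%:R / 2.
    by have := normr_ge0 x; rewrite /M in nM M0 *; nra.
  by rewrite ler_pdivrMr// /Y; lra.
apply: (@le_trans _ _ (t n * (n%:R * (e / 2)))); first by rewrite ler_wpM2l.
have e2 : 0 < e / 2 by rewrite divr_gt0.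
rewrite [leLHS]mulrA -[leRHS]mul1r ler_pM2r//.
by have := tn n; have := t0 n; lra.
Unshelve. all: by end_near. Qed.

Lemma ratio_close (A B J I del e : R) : 0 < I -> 0 < e -> 0 <= B -> B <= I ->
  `|A - B| <= del -> `|J - I| <= del -> del <= I / 2 -> del <= e * I / 4 ->
  `|A / J - I^-1 * B| <= e.
Proof.
move=> I0 e0 B0 BI; rewrite !ler_norml => /andP[a1 a2] /andP[a3 a4] d1 d2.
have J0 : 0 < J by lra.
have -> : A / J - I^-1 * B = ((A - B) * I + B * (I - J)) / (I * J).
  by field; rewrite !gt_eqF.
rewrite ler_pdivrMr ?mulr_gt0// ler_pdivlMr ?mulr_gt0//.
by apply/andP; split; nra.
Qed.

(** Dominated convergence gives convergence in L1 of the densities, hence of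
    the distribution functions uniformly.  The normalizing constants converge
    as well, which replaces Stirling's formula. *)
Lemma log_gamma_normal (e : R) : 0 < e -> exists2 K : R, 36 <= K &
  forall k t, K <= k -> 0 <= t -> K * t <= 1 ->
  forall s, `|\int[lambda]_(x in `]-oo, s]) log_gamma k t x /
    \int[lambda]_x log_gamma k t x - fine (normal_prob 0 1 `]-oo, s])| <= e.
Proof.
move=> e0; apply: contrapT => notK.
(* a sequence of counterexamples, to which dominated convergence applies *)
have bad n : exists u : R * R * R, [/\ n%:R + 36 <= u.1.1, 0 <= u.1.2,
    (n%:R + 36) * u.1.2 <= 1 &
    e < `|\int[lambda]_(x in `]-oo, u.2]) log_gamma u.1.1 u.1.2 x /
    \int[lambda]_x log_gamma u.1.1 u.1.2 x - fine (normal_prob 0 1 `]-oo, u.2])|].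
  apply: contrapT => h; apply: notK; exists (n%:R + 36); first by rewrite lerDr.
  move=> k t Kk t0 Kt s; rewrite leNgt; apply/negP => es; apply: h.
  by exists (k, t, s).
pose u n := projT1 (cid (bad n)).
have uP n := projT2 (cid (bad n)).
pose g n x := log_gamma (u n).1.1 (u n).1.2 x.
have k36 n : 36 <= (u n).1.1.
  by have [h _ _ _] := uP n; apply: le_trans h; rewrite lerDr.
have t01 n : 0 <= (u n).1.2 <= 1.
  have [_ t0 h _] := uP n; rewrite t0 /=; apply: le_trans h.
  by rewrite ler_peMl// ler_wpDl// ler1n.
have ig n : lambda.-integrable setT (EFin \o g n) by exact: integrable_log_gamma.
have [] := @dominated_convergence _ _ R lambda setT measurableT
  (fun n => EFin \o g n) (EFin \o gauss) (fun x => (expR 9 * expR (- `|x|))%:E).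
- by move=> n; apply/measurable_EFinP; exact: measurable_log_gamma.
- by apply/measurable_EFinP; exact: measurable_gauss.
- apply: aeW => x _ /=; apply: cvg_EFin; first exact: nearW.
  apply: log_gamma_cvg => n; by have [] := uP n.
- exact: integrable_envelope.
- apply: aeW => x n _ /=; rewrite lee_fin ger0_norm ?expR_ge0//.
  exact: log_gamma_le.
move=> _ cvg0 _.
pose I : R := \int[lambda]_x gauss x.
have pk0 : 0 < normal_peak (1 : R) by rewrite normal_peak_gt0// oner_neq0.
have gint D : measurable D -> lambda.-integrable D (EFin \o gauss).
  by move=> mD; exact: (integrableS measurableT mD (@subsetT _ _) integrable_gauss).
have pE (D : set R) : measurable D ->
    fine (normal_prob 0 1 D) = normal_peak 1 * \int[lambda]_(x in D) gauss x.
  move=> mD; rewrite integral_normal_pdf_gauss// fineM//.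
  exact: integrable_fin_num (gint _ mD).
have pI : normal_peak 1 * I = 1.
  by rewrite -pE// /normal_prob integral_normal_pdf.
have I0 : 0 < I by rewrite -(pmulr_rgt0 _ pk0) pI.
pose del n : R := \int[lambda]_x `|g n x - gauss x|.
have idel n : lambda.-integrable setT (EFin \o (fun x => g n x - gauss x)).
  by apply: eq_integrable (integrableB measurableT (ig n) integrable_gauss).
have idelN n : lambda.-integrable setT (EFin \o (fun x => `|g n x - gauss x|)).
  have := integrable_abse (idel n); apply: eq_integrable => // x _.
have delE n : (\int[lambda]_x `|(EFin \o g n) x - (EFin \o gauss) x|)%E = (del n)%:E.
  rewrite /del /Rintegral fineK; last exact: integrable_fin_num (idelN n).
  by apply: eq_integral.
have /fine_cvgP[_ cvgdel] : (fun n => (del n)%:E) @ \oo --> (0 : R)%:E.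
  rewrite (_ : (fun n => _) =
    (fun n => \int[lambda]_x `|(EFin \o g n) x - (EFin \o gauss) x|)%E).
    exact: cvg0.
  by apply/funext => n; rewrite delE.
have [n hn] : exists n, del n <= Num.min (I / 2) (e * I / 4).
  have m0 : 0 < Num.min (I / 2) (e * I / 4) by rewrite lt_min !divr_gt0// mulr_gt0.
  move/cvgrPdist_le : cvgdel => /(_ _ m0) [N _ /(_ N (leqnn _))] /=.
  rewrite sub0r normrN => h; exists N; exact: le_trans (ler_norm _) h.
move: hn; rewrite le_min => /andP[d1 d2].
set s := (u n).2.
suff : `|\int[lambda]_(x in `]-oo, s]) g n x / \int[lambda]_x g n x -
    fine (normal_prob 0 1 `]-oo, s])| <= e.
  by have [_ _ _] := uP n; rewrite ltNge => /negP.
have diff (D : set (measurableTypeR R)) : measurable D ->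
    `|\int[lambda]_(x in D) g n x - \int[lambda]_(x in D) gauss x| <= del n.
  move=> mD.
  have iD := integrableS measurableT mD (@subsetT _ _) (ig n).
  rewrite -RintegralB//; last exact: gint.
  apply: (le_trans (le_normr_Rintegral mD _)).
    exact: (integrableS measurableT mD (@subsetT _ _) (idel n)).
  rewrite /del; apply: fine_le.
  - exact/integrable_fin_num/(integrableS measurableT mD (@subsetT _ _) (idelN n)).
  - exact: integrable_fin_num (idelN n).
  - by apply: ge0_le_integral_sub => // x _; rewrite lee_fin.
rewrite pE//.
set A := \int[lambda]_(x in _) g n x; set J := \int[lambda]_x g n x.
set B := \int[lambda]_(x in _) gauss x.
have AB : `|A - B| <= del n by exact: diff.
have JI : `|J - I| <= del n by exact: diff.
have pkE : normal_peak 1 = I^-1 by apply: (mulIf (lt0r_neq0 I0)); rewrite pI mulVf// gt_eqF.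
have B0 : 0 <= B by apply: Rintegral_ge0 => x _; exact: expR_ge0.
have BI : B <= I.
  apply: fine_le; [exact/integrable_fin_num/gint|exact/integrable_fin_num/gint|].
  by apply: ge0_le_integral_sub => // x _; rewrite lee_fin expR_ge0.
rewrite pkE; exact: (ratio_close I0 e0 B0 BI AB JI d1 d2).
Qed.

End log_gamma_limit.

Section normal_cdf.
Context {R : realType}.
Local Notation lambda := (@lebesgue_measure R).

Lemma normal_cdf_lip (s t : R) : s <= t ->
  fine (normal_prob 0 1 `]-oo, t]) <= fine (normal_prob 0 1 `]-oo, s]) + (t - s).
Proof.
move=> st; rewrite -lee_fin EFinD !fineK ?fin_num_measure//.
rewrite (_ : `]-oo, t]%classic = `]-oo, s] `|` `]s, t]); last first.
  apply/seteqP; split => x /=; rewrite !in_itv/=.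
    by move=> xt; have [xs|sx] := leP x s; [left|right].
  by case=> [xs|/andP[]//]; exact: le_trans st.
rewrite measureU//; last first.
  apply/seteqP; split => x //= [] /=; rewrite !in_itv/= => xs /andP[sx _].
  by move: (lt_le_trans sx xs); rewrite ltxx.
rewrite leeD2l//.
apply: (@le_trans _ _ (\int[lambda]_(x in `]s, t]) (cst 1 x)%:E)%E).
  apply: ge0_le_integral_sub => // x _; first by rewrite lee_fin normal_pdf_ge0.
  rewrite lee_fin (le_trans (normal_pdf_ub _ _ _)) ?oner_neq0//.
  rewrite /normal_peak invf_le1; last first.
    by rewrite sqrtr_gt0 expr1n mul1r mulrn_wgt0// pi_gt0.
  rewrite -[leLHS]sqrtr1 ler_wsqrtr// expr1n mul1r.
  by have := pi_ge2 R; rewrite mulr2n; lra.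
rewrite -[leLHS]/(\int[lambda]_(x in `]s, t]) (cst 1 x))%E integral_cst// mul1e.
rewrite [leLHS](lebesgue_measure_itv `]s, t]) /= lte_fin; case: ifP => // _.
by rewrite lee_fin subr_ge0.
Qed.

End normal_cdf.

(** * The law of the trace *)

Section radial.
Context {R : realType}.
Local Notation lambda := (@lebesgue_measure R).
Variables (n p : nat) (B : 'M[R]_p).
Hypotheses (n0 : (0 < n)%N) (p0 : (0 < p)%N) (pB : posdefmx B).
Local Notation N := 'C(p.+1, 2).
Local Notation nu := (@lebesgue_tuple R N).

Definition trace_shape : R := n%:R * p%:R / 2.
Local Notation k := trace_shape.
Local Notation s := (Num.sqrt k).

(** The scaled and centred log-determinant when the eigenvalues are nearly equal:
    p ln(T / p), for T the trace, then replaces ln det. *)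
Definition trace_stat (v : N.-tuple R) : R :=
  - (s * ln (\tr (symmx v *m B) / p%:R)).
Local Notation X := trace_stat.
Let D := wishart_density n (0 : 'M[R]_p).

Let k0 : 0 < k.
Proof. by rewrite divr_gt0// mulr_gt0// ltr0n. Qed.

Let s0 : 0 < s. Proof. by rewrite sqrtr_gt0. Qed.
Let s2 : s ^+ 2 = k. Proof. by rewrite sqr_sqrtr// ltW. Qed.

Lemma trace_posdef_gt0 (S : 'M[R]_p) : posdefmx S -> 0 < \tr (S *m B).
Proof.
move=> pS; have [L pL ->] := cholesky pS.
rewrite -mulmxA mxtrace_mulC.
have pC : posdefmx (L *m B *m L^T).
  have := @posdef_congr _ _ _ L^T _ pB.
  by rewrite unitmx_tr trmxK => /(_ (posdiag_unit pL)).
rewrite /mxtrace (bigD1 (Ordinal p0))//=.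
have dg i : 0 < (L *m B *m L^T) i i.
  rewrite -qf_delta posdef_qf//; apply/negP => /eqP/matrixP/(_ i 0).
  by rewrite !mxE !eqxx => /eqP; rewrite oner_eq0.
by rewrite ltr_wpDr//; apply: sumr_ge0 => i _; exact/ltW.
Qed.

Lemma measurable_trace_stat : measurable_fun setT X.
Proof.
apply: measurable_funN; apply: measurable_funM => //.
apply: (measurableT_comp (@measurable_ln R)); apply: measurable_funM => //.
apply: measurable_mx_trace; apply: measurable_mx_mul; last exact: measurable_mx_cst.
exact: measurable_mx_symmx.
Qed.

Let D0 v : 0 <= D v. Proof. exact: wishart_density_ge0. Qed.
Let mD : measurable_fun setT D. Proof. exact: measurable_wishart_density. Qed.

Lemma wishart_density_trace v : wishart_density n B v =
  D v * expR (- (k * expR (- (X v / s)))).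
Proof.
rewrite /D /wishart_density mulmx0 mxtrace0 mulr0 subr0 -[RHS]mulrA -expRD.
rewrite indicE; case: (boolP (v \in _)) => [vc|_]; last by rewrite !mul0r.
have pS : posdefmx (symmx v) by move: vc; rewrite inE.
have T0 := trace_posdef_gt0 pS.
have pR : 0 < p%:R :> R by rewrite ltr0n.
congr (_ * expR (_ - _)).
have -> : - (X v / s) = ln (\tr (symmx v *m B) / p%:R).
  by rewrite /X; field; rewrite gt_eqF.
rewrite lnK ?posrE ?divr_gt0//.
by rewrite /k; field; rewrite gt_eqF.
Qed.

Let dil (y : R) : 'M[R]_p := (expR (y / (2 * s)))%:M.

Let dil_posdiag y : posdiag (dil y).
Proof.
split; last by move=> i; rewrite mxE eqxx mulr1n expR_gt0.
apply/is_trig_mxP => i j ij; rewrite mxE (_ : (i == j) = false)//.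
by apply/eqP => E; rewrite E ltnn in ij.
Qed.

Let dil_det y : \det (dil y) = expR (p%:R * (y / (2 * s))).
Proof. by rewrite det_scalar expRM_natl. Qed.

Let D_dil y v : D (congr_coords (dil y) v) = \det (dil y) ^+ n * D v.
Proof.
have := wishart_density_congr n (0 : 'M[R]_p) v (dil_posdiag y).
rewrite mulmx0 mul0mx /D => ->; rewrite mulrA -exprMn mulfV ?expr1n ?mul1r//.
by rewrite dil_det gt_eqF// expR_gt0.
Qed.

Let X_dil y v : v \in @cone R p -> X (congr_coords (dil y) v) = X v - y.
Proof.
rewrite inE => pS; have T0 := trace_posdef_gt0 pS.
have pR : 0 < p%:R :> R by rewrite ltr0n.
rewrite /X symmx_congr /dil tr_scalar_mx mul_scalar_mx mul_mx_scalar scalerA.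
rewrite -scalemxAl mxtraceZ -expRD -mulrA lnM ?posrE ?expR_gt0 ?divr_gt0//.
by rewrite expRK; field; rewrite gt_eqF.
Qed.

Lemma bin2_double : (N * 2 = p * p.+1)%N.
Proof.
by clear; elim: p => [|q IH]; [rewrite bin_small|rewrite binS2; lia].
Qed.

Let beta : R := (k + N%:R) / s.

Lemma integral_reflect (c : R) (f : R -> \bar R) : measurable_fun setT f ->
  (forall x, (0 <= f x)%E) ->
  (\int[lambda]_y f (c - y)%R = \int[lambda]_y f y)%E.
Proof.
move=> mf f0.
have := @integral_affine R 1 c (fun x => f x) ltr01 mf f0.
rewrite invr1 mul1e => <-.
under [RHS]eq_integral do rewrite mul1r.
rewrite -[RHS]integral_lebesgue_opp.
- by apply: eq_integral => y _; rewrite addrC.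
- apply: (measurableT_comp mf); exact: measurable_funD.
- by move=> x; exact: f0.
Qed.

(** Integrating over dilations separates the radial part X of the measure from
    the rest: both sides are the double integral of D(v) G(X v) H(X v - y)
    e^(beta y) over v and y, using translation of y on one side and the
    homogeneity of D(v) dv on the other. *)
Lemma radial_identity (G H : R -> R) :
  measurable_fun setT G -> measurable_fun setT H ->
  (forall x, 0 <= G x) -> (forall x, 0 <= H x) ->
  ((\int[lambda]_x (H x * expR (- (beta * x)))%:E) *
   (\int[nu]_v (D v * (G (X v) * expR (beta * X v)))%:E) =
   (\int[nu]_v (D v * H (X v))%:E) * \int[lambda]_x (G x)%:E)%E.
Proof.
move=> mG mH G0 H0.
have mX := measurable_trace_stat.
pose K (z : R * N.-tuple R) : R :=
  D z.2 * G (X z.2) * (H (X z.2 - z.1) * expR (beta * z.1)).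
have mX2 : measurable_fun setT (fun z : R * N.-tuple R => X z.2).
  exact: (measurableT_comp mX).
have mK : measurable_fun setT (fun z : measurableTypeR R * N.-tuple R => (K z)%:E).
  apply/measurable_EFinP; apply: measurable_funM; apply: measurable_funM.
  - exact: (measurableT_comp mD).
  - exact: (measurableT_comp mG).
  - by apply: (measurableT_comp mH); apply: measurable_funB.
  - by apply: measurableT_comp => //; exact: measurable_funM.
have K0 z : (0 <= (K z)%:E)%E.
  by rewrite lee_fin !mulr_ge0// expR_ge0.
pose h : \bar R := (\int[lambda]_x (H x * expR (- (beta * x)))%:E)%E.
have mHe (c : R) : measurable_fun setT (fun x : R => (H x * expR (beta * (c - x)))%:E).
  apply/measurable_EFinP; apply: measurable_funM => //.
  by apply: measurableT_comp => //; apply: measurable_funM => //; exact: measurable_funB.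
have mHe' : measurable_fun [set: R] (fun x => H x * expR (- (beta * x))).
  apply: measurable_funM => //; apply: measurableT_comp => //.
  by apply: measurable_funN; exact: measurable_funM.
have first v : (\int[lambda]_y (K (y, v))%:E =
    (D v * (G (X v) * expR (beta * X v)))%:E * h)%E.
  have mr : measurable_fun [set: R] (fun y => H (X v - y) * expR (beta * y)).
    apply: measurable_funM; last by apply: measurableT_comp => //; exact: measurable_funM.
    by apply: (measurableT_comp mH); exact: measurable_funB.
  rewrite /K /= integral_scale; last 3 first.
  - exact: mulr_ge0.
  - exact: mr.
  - by move=> y; rewrite mulr_ge0// expR_ge0.
  have -> : (\int[lambda]_y (H (X v - y) * expR (beta * y))%:E =
      \int[lambda]_x (expR (beta * X v) * (H x * expR (- (beta * x))))%:E)%E.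
    rewrite -[RHS](integral_reflect (X v)).
    - apply: eq_integral => y _; congr EFin.
      rewrite mulrCA -expRD; congr (_ * expR _); ring.
    - by apply/measurable_EFinP; exact: measurable_funM.
    - by move=> y; rewrite lee_fin !mulr_ge0// expR_ge0.
  rewrite integral_scale//; last by move=> y; rewrite mulr_ge0// expR_ge0.
  by rewrite muleA -EFinM !mulrA.
have second y : (\int[nu]_v (K (y, v))%:E =
    \int[nu]_v (D v * H (X v) * G (X v + y))%:E)%E.
  pose f (v : N.-tuple R) : R := D v * H (X v) * G (X v + y).
  have f0 v : 0 <= f v by rewrite /f !mulr_ge0.
  have mf : measurable_fun setT f.
    apply: measurable_funM.
      by apply: measurable_funM => //; exact: (measurableT_comp mH).
    by apply: (measurableT_comp mG); exact: measurable_funD.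
  have dy := posdiag_det_gt0 (dil_posdiag y).
  have := integral_congr_coords (f := fun v => (f v)%:E) (dil_posdiag y).
  move=> /(_ ltac:(exact/measurable_EFinP)).
  move=> /(_ ltac:(by move=> v; rewrite lee_fin)) E.
  have fE v : (K (y, v))%:E = (expR (beta * y) * \det (dil y) ^- n *
      f (congr_coords (dil y) v))%:E.
    rewrite /K /f /= D_dil; congr EFin.
    have [vc|vc] := boolP (v \in @cone R p); last first.
      have -> : D v = 0 by rewrite /D /wishart_density indicE (negbTE vc) mul0r.
      by rewrite mulr0 !mul0r mulr0.
    rewrite X_dil// subrK; field.
    by rewrite expf_neq0// gt_eqF.
  under eq_integral do rewrite fE.
  rewrite integral_scale.
  - rewrite E muleA -EFinM [X in (X%:E * _)%E](_ : _ = 1) ?mul1e//.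
    rewrite -mulrA -invfM -exprD dil_det -expRM_natl -expRN -expRD.
    rewrite -[RHS]expR0; congr expR; rewrite /beta.
    have := congr1 (fun m => m%:R : R) bin2_double; rewrite !natrM => hN.
    have -> : N%:R = p%:R * p.+1%:R / 2 :> R by rewrite -hN; field.
    rewrite natrD /k; field; by rewrite gt_eqF.
  - by rewrite mulr_ge0 ?expR_ge0// invr_ge0 exprn_ge0// ltW.
  - apply: (measurableT_comp mf); apply: measurable_coords.
    apply: measurable_mx_mul; last exact: measurable_mx_cst.
    by apply: measurable_mx_mul; [exact: measurable_mx_cst|exact: measurable_mx_symmx].
  - by move=> v; exact: f0.
have third v : (\int[lambda]_y (D v * H (X v) * G (X v + y))%:E =
    (D v * H (X v))%:E * \int[lambda]_x (G x)%:E)%E.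
  rewrite integral_scale.
  - congr (_ * _)%E.
    have := @integral_affine R 1 (X v) (fun x => (G x)%:E) ltr01.
    rewrite invr1 mul1e => <-.
    + by apply: eq_integral => y _; rewrite mul1r addrC.
    + exact/measurable_EFinP.
    + by move=> x; rewrite lee_fin.
  - exact: mulr_ge0.
  - by apply: (measurableT_comp mG); exact: measurable_funD.
  - by move=> y.
have mL : measurable_fun setT (fun v => D v * (G (X v) * expR (beta * X v))).
  apply: measurable_funM => //; apply: measurable_funM.
    exact: (measurableT_comp mG).
  by apply: measurableT_comp => //; exact: measurable_funM.
have L0 v : 0 <= D v * (G (X v) * expR (beta * X v)).
  by rewrite !mulr_ge0// expR_ge0.
have h0 : (0 <= h)%E.
  by apply: integral_ge0 => x _; rewrite lee_fin mulr_ge0// expR_ge0.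
have g0 : (0 <= \int[lambda]_x (G x)%:E)%E.
  by apply: integral_ge0 => x _; rewrite lee_fin.
transitivity (\int[nu]_v \int[lambda]_y (K (y, v))%:E)%E.
  under [RHS]eq_integral do rewrite first.
  rewrite ge0_integralZr; last 4 first.
  - exact: measurableT.
  - exact/measurable_EFinP.
  - by move=> v _; rewrite lee_fin.
  - exact: h0.
  by rewrite muleC.
rewrite -(fubini_tonelli (m1 := lambda) (m2 := nu) (fun z => (K z)%:E) mK K0).
under eq_integral do rewrite second.
rewrite (fubini_tonelli (m1 := lambda) (m2 := nu)
  (fun z => (D z.2 * H (X z.2) * G (X z.2 + z.1))%:E)); last 2 first.
- apply/measurable_EFinP; apply: measurable_funM.
    by apply: measurable_funM; [exact: (measurableT_comp mD)|exact: (measurableT_comp mH)].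
  by apply: (measurableT_comp mG); exact: measurable_funD.
- by move=> z; rewrite lee_fin !mulr_ge0.
under eq_integral do rewrite third.
rewrite ge0_integralZr//.
- apply/measurable_EFinP; apply: measurable_funM => //.
  exact: (measurableT_comp mH).
- by move=> v _; rewrite lee_fin mulr_ge0.
Qed.

(** The trace has a gamma law of shape k + N; the excess N over k tilts
    [log_gamma] by N / sqrt k, which is of order (p^3 / n)^(1/2). *)
Definition trace_tilt : R := N%:R / s.
Local Notation theta := trace_tilt.

Let H x : R := expR (- (k * expR (- (x / s)))).

Let H_beta x : H x * expR (- (beta * x)) = expR (- k) * log_gamma k theta x.
Proof.
rewrite /H /log_gamma -!expRD; congr expR; rewrite /beta /trace_tilt.
by field; rewrite gt_eqF.
Qed.

Let mH : measurable_fun [set: R] H.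
Proof.
apply: measurableT_comp => //; apply: measurable_funN; apply: measurable_funM => //.
apply: measurableT_comp => //; apply: measurable_funN; exact: measurable_funM.
Qed.

Let mlg : measurable_fun [set: R] (log_gamma k theta).
Proof. exact: measurable_log_gamma. Qed.

(** Under the normalized density the statistic X has density proportional to
    [log_gamma]. *)
Lemma trace_law (Z : R) : 36 <= k -> 0 <= theta <= 1 -> 0 < Z ->
  (\int[nu]_v (wishart_density n B v)%:E = Z%:E)%E -> forall t,
  (\int[nu]_v (wishart_density n B v * \1_(X @^-1` `]-oo, t]) v)%:E =
   (Z * (\int[lambda]_(x in `]-oo, t]) log_gamma k theta x /
         \int[lambda]_x log_gamma k theta x))%:E)%E.
Proof.
move=> k36 th01 Z0 ZE t.
have ilg := integrable_log_gamma k36 th01.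
set I := \int[lambda]_x log_gamma k theta x.
set F := \int[lambda]_(x in _) log_gamma k theta x.
have IE : (\int[lambda]_x (log_gamma k theta x)%:E = I%:E)%E.
  by rewrite fineK//; exact: integrable_fin_num ilg.
have ek0 : 0 <= expR (- k) by exact: expR_ge0.
have lg0 x : 0 <= log_gamma k theta x by exact: expR_ge0.
have HE : (\int[lambda]_x (H x * expR (- (beta * x)))%:E =
    (expR (- k) * I)%:E)%E.
  under eq_integral do rewrite H_beta.
  by rewrite [LHS](integral_scale lambda ek0 mlg lg0) IE.
have DZ : (\int[nu]_v (D v * H (X v))%:E = Z%:E)%E.
  by rewrite -ZE; apply: eq_integral => v _; rewrite wishart_density_trace.
have H0 x : 0 <= H x by exact: expR_ge0.
have I0 : 0 < I.
  have I0 : 0 <= I by apply: Rintegral_ge0.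
  rewrite lt_def I0 andbT; apply/eqP => I00.
  have mi : measurable_fun setT (\1_(`[0, 1]%classic : set R) : R -> R).
    by apply: measurable_indic; exact: measurable_itv.
  have := radial_identity mi mH (fun x => ltac:(by [])) H0.
  rewrite HE I00 mulr0 mul0e DZ.
  have -> : (\int[lambda]_x (\1_(`[0, 1]%classic : set R) x)%:E = 1)%E.
    rewrite integral_indic// setIT [LHS](lebesgue_measure_itv `[0, 1])/=.
    by rewrite lte01 oppr0 adde0.
  by rewrite mule1 => /eqP; rewrite eq_sym eqe gt_eqF.
have iF : lambda.-integrable (`]-oo, t] : set (measurableTypeR R))
    (EFin \o log_gamma k theta).
  apply: (integrableS measurableT _ (@subsetT _ _) ilg).
  exact: measurable_itv.
pose G x : R := expR (- k) * (log_gamma k theta x * \1_`]-oo, t]%classic x).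
have mi : measurable_fun setT (\1_(`]-oo, t]%classic : set R) : R -> R).
  by apply: measurable_indic; exact: measurable_itv.
have mlgi : measurable_fun [set: R]
    (fun x => log_gamma k theta x * \1_`]-oo, t]%classic x).
  exact: measurable_funM.
have mG : measurable_fun [set: R] G by exact: measurable_funM.
have G0 x : 0 <= G x by rewrite mulr_ge0// mulr_ge0.
have GE : (\int[lambda]_x (G x)%:E = (expR (- k) * F)%:E)%E.
  rewrite [LHS](integral_scale lambda ek0 mlgi (fun x => mulr_ge0 (lg0 x) (ler0n _ _))).
  rewrite EFinM; congr (_ * _)%E.
  rewrite fineK; last first.
    exact: integrable_fin_num iF.
  by rewrite [RHS]integral_mkcond epatch_indic; apply: eq_integral => x _; rewrite EFinM.
have GE' x : G x = H x * expR (- (beta * x)) * \1_`]-oo, t]%classic x.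
  by rewrite H_beta /G mulrA.
have := radial_identity mG mH G0 H0.
rewrite HE DZ GE.
have -> : (\int[nu]_v (D v * (G (X v) * expR (beta * X v)))%:E =
    \int[nu]_v (wishart_density n B v * \1_(X @^-1` `]-oo, t]) v)%:E)%E.
  apply: eq_integral => v _; congr EFin; rewrite wishart_density_trace.
  rewrite GE' -/(H (X v)) -[RHS]mulrA; congr (_ * _).
  rewrite (mulrAC (H (X v) * _)) -(mulrA (H (X v))) -expRD addNr expR0 mulr1.
  by congr (_ * _); rewrite !indicE.
set A := (\int[nu]_v _)%E.
have A0 : (0 <= A)%E.
  by apply: integral_ge0 => v _; rewrite lee_fin mulr_ge0// wishart_density_ge0.
have AZ : (A <= Z%:E)%E.
  rewrite -ZE; apply: ge0_le_integral_nomeas => v.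
    by rewrite lee_fin mulr_ge0// wishart_density_ge0.
  by rewrite lee_fin ler_piMr ?wishart_density_ge0.
case: A A0 AZ => // a _ _; rewrite -!EFinM => -[E]; congr EFin.
have c0 : expR (- k) * I != 0 by rewrite mulf_neq0 ?gt_eqF ?expR_gt0.
by apply: (mulfI c0); rewrite E; field; rewrite gt_eqF.
Qed.

End radial.

(** * Deterministic comparison near the truth *)

Section perturbation.
Context {R : realType}.

Lemma posdef_near1 p (G : 'M[R]_p) e : G^T = G -> 0 <= e -> e < 1 ->
  nsq (G - 1%:M) <= e ^+ 2 ->
  posdefmx G /\ forall x, (1 - e) * nsq x <= qf G x <= (1 + e) * nsq x.
Proof.
move=> sG e0 e1 Ge.
have bnd x : (1 - e) * nsq x <= qf G x <= (1 + e) * nsq x.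
  have := qf_le_nsq x e0 Ge; rewrite qfD qfN qf1 ler_norml => /andP[h1 h2].
  by apply/andP; split; lra.
split=> //; split=> // x x0; rewrite -[X in 0 < X]/(qf _ x).
have /andP[h _] := bnd x; apply: lt_le_trans h.
by rewrite mulr_gt0 ?nsq_gt0//; lra.
Qed.

Lemma qf_inv_near1 p (G : 'M[R]_p) a : posdefmx G -> 0 < a ->
  (forall x, a * nsq x <= qf G x) -> forall x, qf (invmx G) x <= a^-1 * nsq x.
Proof.
move=> pG a0 Ga x.
have h y : a * qf 1%:M y <= qf G y by rewrite qf1.
have := qf_inv_le (@posdef1 R p) pG (ltW a0) h x.
by rewrite invmx1 qf1 -ler_pdivlMl.
Qed.

Lemma trace_congr_le m p (B : 'M[R]_(m, p)) (C : 'M[R]_m) c :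
  (forall x, qf C x <= c * nsq x) -> \tr (B^T *m C *m B) <= c * nsq B.
Proof.
move=> Cc; rewrite nsq_col mulr_sumr; apply: ler_sum => j _.
apply: le_trans (Cc _); rewrite -qf_delta qf_congr -colE; exact: lexx.
Qed.

(** The gap in the arithmetic-geometric mean inequality for the spectrum of G,
    bounded using ln det G^-1 <= tr G^-1 - p. *)
Lemma amgm_gap p (G : 'M[R]_p) e : (0 < p)%N -> G^T = G ->
  0 <= e -> e <= 2^-1 -> nsq (G - 1%:M) <= e ^+ 2 ->
  0 <= p%:R * ln (\tr G / p%:R) - ln (\det G) <= 2 * e ^+ 2.
Proof.
move=> p0 sG e0 e2 Ge.
have [pG bnd] := posdef_near1 sG e0 (ltac:(lra) : e < 1) Ge.
have pR : 0 < p%:R :> R by rewrite ltr0n.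
have T0 : 0 < \tr G.
  have := trace_posdef_gt0 p0 (@posdef1 R p) pG; by rewrite mulmx1.
have dG := posdef_det_gt0 pG.
apply/andP; split.
  have a0 : 0 < p%:R / \tr G by rewrite divr_gt0.
  have := ln_det_le_trace (posdefZ a0 pG).
  rewrite detZ mxtraceZ divfK ?gt_eqF// subrr.
  have -> : ln ((p%:R / \tr G) ^+ p * \det G) =
      - (p%:R * ln (\tr G / p%:R)) + ln (\det G).
    rewrite [LHS]lnM ?posrE ?exprn_gt0// lnXn//; congr (_ + _).
    by rewrite -[p%:R / _]invf_div lnV ?posrE ?divr_gt0// mulNrn mulr_natl.
  by lra.
have h1 : ln (\tr G / p%:R) <= \tr G / p%:R - 1.
  have a0 : 0 < \tr G / p%:R by rewrite divr_gt0.
  have := @le_ln1Dx _ (\tr G / p%:R - 1) ltac:(lra).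
  by rewrite addrC subrK.
have h2 : p%:R * ln (\tr G / p%:R) <= \tr G - p%:R.
  have -> : \tr G - p%:R = p%:R * (\tr G / p%:R - 1) by field; rewrite gt_eqF.
  by rewrite ler_pM2l.
have h3 := ln_det_le_trace (posdef_inv pG).
rewrite ln_det_inv// in h3.
have uG := posdef_unit pG.
have h4 : \tr ((G - 1%:M)^T *m invmx G *m (G - 1%:M)) <= 2 * nsq (G - 1%:M).
  apply: trace_congr_le => x; rewrite -[2]invrK.
  apply: qf_inv_near1 => // y; have /andP[+ _] := bnd y.
  have := nsq_ge0 y; nra.
have h5 : \tr ((G - 1%:M)^T *m invmx G *m (G - 1%:M)) =
    \tr G + \tr (invmx G) - 2 * p%:R.
  have -> : (G - 1%:M)^T = G - 1%:M by rewrite raddfB /= sG trmx1.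
  rewrite mulmxBl mulmxV// mul1mx mulmxBl mul1mx mulmxBr.
  by rewrite mulVmx// mulmx1 !raddfB /= mxtrace1; ring.
by lra.
Qed.

End perturbation.

Section truth.
Context {R : realType}.
Variables (n p : nat) (Lam eta : R) (Sigma S U : 'M[R]_p).
Hypotheses (n0 : (0 < n)%N) (p0 : (0 < p)%N) (Lam0 : 0 < Lam).
Hypotheses (pSigma : posdefmx Sigma) (pU : posdiag U).
Hypotheses (SU : invmx Sigma = U^T *m U).
Hypotheses (Sigma_le : spectral_norm Sigma <= Lam).
Hypotheses (Omega_le : spectral_norm (invmx Sigma) <= Lam).
Hypotheses (eta0 : 0 <= eta) (eta_le : eta <= 16^-1).
Hypotheses (n_le : 4 * Lam ^+ 4 * p%:R / n%:R ^+ 2 <= eta ^+ 2).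
Hypotheses (sS : S^T = S) (S_near : nsq (U *m S *m U^T - 1%:M) <= eta ^+ 2).

Local Notation Omega0 := (invmx Sigma).

(** The scale matrix obtained when the square in the prior is completed around
    the true precision, see [posterior_tilt]. *)
Definition tilted_cov : 'M[R]_p := S + (2 / n%:R) *: Omega0.
Local Notation St := tilted_cov.

Let eta1 : eta < 1.
Proof. by rewrite (le_lt_trans eta_le)// invf_lt1// ltr1n. Qed.
Let eta_le2 : eta <= 2^-1.
Proof. by rewrite (le_trans eta_le)// lef_pV2 ?posrE// ler_nat. Qed.
Let uU := posdiag_unit pU.
Let nR : 0 < n%:R :> R. Proof. by rewrite ltr0n. Qed.
Let pR : 0 < p%:R :> R. Proof. by rewrite ltr0n. Qed.
Let pO : posdefmx Omega0. Proof. exact: posdef_inv. Qed.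

Let U_op (x : 'cV[R]_p) : nsq (U *m x) <= Lam * nsq x.
Proof. by rewrite -qf_gram -SU qf_le_spectral// ltW. Qed.

Let UT_op (x : 'cV[R]_p) : nsq (U^T *m x) <= Lam * nsq x.
Proof. by apply: opb_tr; [exact: ltW|exact: U_op]. Qed.

Let nsq_Omega0 : nsq Omega0 <= Lam ^+ 2 * p%:R.
Proof.
have := opb_mulmx 1%:M (fun x => spectral_norm_ub x Omega_le).
rewrite mulmx1 => h; apply: le_trans h _; rewrite ler_wpM2l ?sqr_ge0//.
by rewrite nsq_trace trmx1 mulmx1 mxtrace1.
Qed.

Let congr_U_le (D : 'M[R]_p) : nsq (U *m D *m U^T) <= Lam ^+ 2 * nsq D.
Proof.
rewrite -mulmxA (le_trans (opb_mulmx _ U_op))// expr2 -mulrA ler_pM2l//.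
by rewrite -nsq_tr trmx_mul trmxK (le_trans (opb_mulmx _ U_op))// nsq_tr.
Qed.

Let congr_UT_le (D : 'M[R]_p) : nsq (U^T *m D *m U) <= Lam ^+ 2 * nsq D.
Proof.
rewrite -mulmxA (le_trans (opb_mulmx _ UT_op))// expr2 -mulrA ler_pM2l//.
by rewrite -nsq_tr trmx_mul (le_trans (opb_mulmx _ UT_op))// nsq_tr.
Qed.

Lemma sample_cov_posdef : posdefmx S.
Proof.
have sG : (U *m S *m U^T)^T = U *m S *m U^T.
  by rewrite !trmx_mul trmxK sS mulmxA.
have [pG _] := posdef_near1 sG eta0 eta1 S_near.
have -> : S = ((invmx U)^T)^T *m (U *m S *m U^T) *m (invmx U)^T.
  rewrite trmxK !mulmxA mulVmx// mul1mx -mulmxA trmx_inv mulmxV ?unitmx_tr//.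
  by rewrite mulmx1.
by apply: posdef_congr => //; rewrite unitmx_tr unitmx_inv.
Qed.

Lemma tilted_cov_posdef : posdefmx St.
Proof.
apply: posdefD; first exact: sample_cov_posdef.
by apply: posdefZ => //; rewrite divr_gt0.
Qed.

Let St_near : nsq (U *m St *m U^T - 1%:M) <= (2 * eta) ^+ 2.
Proof.
rewrite /tilted_cov mulmxDr mulmxDl addrAC (le_trans (nsq_add_le _ _))//.
have h : nsq (U *m ((2 / n%:R) *: Omega0) *m U^T) <= eta ^+ 2.
  apply: (le_trans (congr_U_le _)); rewrite nsqZ; apply: le_trans n_le.
  apply: (@le_trans _ _ (Lam ^+ 2 * ((2 / n%:R) ^+ 2 * (Lam ^+ 2 * p%:R)))).
    by rewrite ler_wpM2l ?sqr_ge0// ler_wpM2l ?sqr_ge0.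
  by rewrite le_eqVlt; apply/orP; left; apply/eqP; field; rewrite gt_eqF.
by move: h S_near; rewrite exprMn; lra.
Qed.

Lemma ln_det_tilt : 0 <= ln (\det St) - ln (\det S) <= 4 * Lam ^+ 2 * p%:R / n%:R.
Proof.
have pS := sample_cov_posdef; have pSt := tilted_cov_posdef.
have uS := posdef_unit pS; have uSt := posdef_unit pSt.
apply/andP; split.
  have := ln_det_diff_le pSt pS.
  have -> : invmx St *m S = 1%:M - (2 / n%:R) *: (invmx St *m Omega0).
    by rewrite -(mulVmx uSt) scalemxAr -mulmxBr /tilted_cov addrK.
  rewrite raddfB /= mxtrace1 mxtraceZ.
  have := trace_posdef_gt0 p0 pO (posdef_inv pSt).
  set t := \tr _ => t0.
  have : 0 < 2 / n%:R * t by rewrite mulr_gt0// divr_gt0.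
  lra.
have := ln_det_diff_le pS pSt.
have -> : invmx S *m St = 1%:M + (2 / n%:R) *: (invmx S *m Omega0).
  by rewrite /tilted_cov mulmxDr mulVmx// scalemxAr.
rewrite raddfD /= mxtrace1 mxtraceZ addrAC subrr add0r => h.
apply: (le_trans h).
pose G := U *m S *m U^T.
have sG : G^T = G by rewrite /G !trmx_mul trmxK sS mulmxA.
have [pG bnd] := posdef_near1 sG eta0 eta1 S_near.
have eta2 := eta_le2.
have GE : G = U *m S *m U^T by [].
clearbody G.
have iS : invmx S = U^T *m invmx G *m U.
  have uG := posdef_unit pG.
  have SE : S = invmx U *m G *m invmx U^T.
    by rewrite GE !mulmxA mulVmx// mul1mx -mulmxA mulmxV ?unitmx_tr// mulmx1.
  have SM : S *m (U^T *m invmx G *m U) = 1%:M.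
    rewrite [X in X *m _]SE !mulmxA mulmxKV ?unitmx_tr//.
    by rewrite mulmxK// mulVmx.
  by rewrite -[LHS]mulmx1 -SM mulKmx.
have -> : \tr (invmx S *m Omega0) = \tr ((U *m U^T)^T *m invmx G *m (U *m U^T)).
  rewrite iS SU trmx_mul trmxK -!mulmxA mxtrace_mulC !mulmxA.
  by rewrite mxtrace_mulC !mulmxA mxtrace_mulC !mulmxA mxtrace_mulC !mulmxA.
have t2 : \tr ((U *m U^T)^T *m invmx G *m (U *m U^T)) <= 2 * nsq (U *m U^T).
  apply: trace_congr_le => x; rewrite -[2]invrK.
  apply: qf_inv_near1 => // y; have /andP[+ _] := bnd y.
  have := nsq_ge0 y; nra.
have t3 : nsq (U *m U^T) = nsq Omega0.
  rewrite SU !nsq_trace !trmx_mul !trmxK mulmxA mxtrace_mulC !mulmxA.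
  by [].
rewrite t3 in t2.
apply: (@le_trans _ _ (2 / n%:R * (2 * (Lam ^+ 2 * p%:R)))).
  rewrite ler_wpM2l ?divr_ge0 ?(ltW nR)//.
  by apply: (le_trans t2); rewrite ler_pM2l.
by rewrite le_eqVlt; apply/orP; left; apply/eqP; field; rewrite gt_eqF.
Qed.

(** In the coordinates J = U^-T Omega U^-1, in which the true precision is the
    identity, the two relative errors combine: with W = V U^T one has
    G = W J W^T and U St U^T = W^T W, so J - 1 is controlled by G - 1 and
    W^T W - 1 in Frobenius norm, only operator norms of W^-1 entering. *)
Lemma near_truth (V Omega : 'M[R]_p) : posdiag V -> St = V^T *m V ->
  posdefmx Omega -> nsq (V *m Omega *m V^T - 1%:M) <= eta ^+ 2 ->
  prior_support Lam Omega /\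
  nsq (Omega - Omega0) <= Lam ^+ 2 * (40 * eta ^+ 2).
Proof.
move=> pV SV pOm Gnear; have uV := posdiag_unit pV.
pose W := V *m U^T.
have uW : W \in unitmx by rewrite unitmx_mul uV unitmx_tr.
have WW : W^T *m W = U *m St *m U^T by rewrite SV /W trmx_mul trmxK !mulmxA.
pose J := (invmx U)^T *m Omega *m invmx U.
have pJ : posdefmx J by apply: posdef_congr => //; rewrite unitmx_inv.
have OJ : Omega = U^T *m J *m U.
  by rewrite /J trmx_inv !mulmxA mulmxV ?unitmx_tr// mul1mx mulmxKV.
have GJ : V *m Omega *m V^T = W *m J *m W^T.
  by rewrite OJ /W trmx_mul trmxK !mulmxA.
set G := V *m Omega *m V^T in Gnear GJ.
clearbody W J G.
have sT : (W^T *m W)^T = W^T *m W by exact: gram_sym.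
have eta20 : 0 <= 2 * eta by rewrite mulr_ge0.
have eta21 : 2 * eta < 1.
  by have := eta_le; rewrite -(@ler_pM2l _ 2)//; lra.
have eta22 : 2^-1 <= 1 - 2 * eta.
  by have := eta_le; rewrite -(@ler_pM2l _ 2)//; lra.
have Tnear : nsq (W^T *m W - 1%:M) <= (2 * eta) ^+ 2 by rewrite WW.
have [pT Tbnd] := posdef_near1 sT eta20 eta21 Tnear.
have Tinv x : qf (invmx (W^T *m W)) x <= 2 * nsq x.
  rewrite -[2]invrK; apply: qf_inv_near1 => // y.
  have /andP[h _] := Tbnd y; apply: le_trans h.
  by rewrite ler_wpM2r ?nsq_ge0.
have iT : invmx (W^T *m W) = invmx W *m (invmx W)^T.
  have uT := posdef_unit pT.
  rewrite -[LHS]mulmx1 -[in LHS](_ : (W^T *m W) *m (invmx W *m (invmx W)^T) = 1%:M).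
    by rewrite mulKmx.
  by rewrite !mulmxA mulmxK// trmx_inv mulmxV ?unitmx_tr.
have WiT_op (x : 'cV[R]_p) : nsq ((invmx W)^T *m x) <= 2 * nsq x.
  by rewrite -qf_gram trmxK -iT.
have Wi_op (x : 'cV[R]_p) : nsq (invmx W *m x) <= 2 * nsq x.
  by rewrite -[invmx W]trmxK; apply: opb_tr.
have JE : J - 1%:M = invmx W *m (G - 1%:M) *m (invmx W)^T
    - invmx (W^T *m W) *m (W^T *m W - 1%:M).
  have uT := posdef_unit pT.
  have h1 : invmx (W^T *m W) *m (W^T *m W - 1%:M) = 1%:M - invmx (W^T *m W).
    by rewrite mulmxBr mulVmx// mulmx1.
  have h2 : invmx W *m (G - 1%:M) *m (invmx W)^T = J - invmx (W^T *m W).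
    rewrite mulmxBr mulmxBl mulmx1 -iT; congr (_ - _).
    rewrite GJ !mulmxA mulVmx// mul1mx -mulmxA trmx_inv.
    by rewrite mulmxV ?unitmx_tr// mulmx1.
  by rewrite h1 h2 opprB addrA subrK.
have J_le : nsq (J - 1%:M) <= 40 * eta ^+ 2.
  rewrite JE (le_trans (nsq_add_le _ _))// nsqN.
  have h1 : nsq (invmx W *m (G - 1%:M) *m (invmx W)^T) <= 2 * (2 * eta ^+ 2).
    rewrite -mulmxA (le_trans (opb_mulmx _ Wi_op))// ler_pM2l//.
    rewrite -nsq_tr trmx_mul trmxK (le_trans (opb_mulmx _ Wi_op))// nsq_tr.
    by rewrite ler_pM2l.
  have h2 : nsq (invmx (W^T *m W) *m (W^T *m W - 1%:M)) <= 2 ^+ 2 * (2 * eta) ^+ 2.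
    have := opb_mulmx (W^T *m W - 1%:M)
      (opb_of_qf (posdef_inv pT) (ler0n _ 2) Tinv).
    move=> h; apply: (le_trans h); rewrite ler_pM2l//.
  by rewrite exprMn in h2; lra.
have J_half : nsq (J - 1%:M) <= (2^-1) ^+ 2.
  apply: (le_trans J_le).
  have : eta ^+ 2 <= 16^-1 ^+ 2.
    by rewrite lerXn2r ?nnegrE ?invr_ge0//; exact: eta_le.
  by rewrite -(@ler_pM2l _ 40)// => h; apply: (le_trans h); rewrite !exprVn
    ler_pdivrMr// mulrC ler_pdivlMr// -!natrX -!natrM ler_nat.
have half0 : (0 : R) <= 2^-1 by rewrite invr_ge0.
have half1 : (2^-1 : R) < 1 by rewrite invf_lt1// ltr1n.
have [_ Jbnd] := posdef_near1 pJ.1 half0 half1 J_half.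
have OmE x : qf Omega x = qf J (U *m x) by rewrite OJ qf_congr.
have O0E x : qf Omega0 x = nsq (U *m x) by rewrite SU qf_gram.
split; last first.
  have -> : Omega - Omega0 = U^T *m (J - 1%:M) *m U.
    by rewrite mulmxBr mulmxBl mulmx1 -OJ -SU.
  by rewrite (le_trans (congr_UT_le _))// ler_wpM2l ?sqr_ge0.
split=> //; split.
  apply: (@le_lt_trans _ _ (3 / 2 * Lam)); last by rewrite ltr_pM2r//; lra.
  apply: spectral_norm_posdef => //; first by rewrite mulr_ge0// ltW.
  move=> x; rewrite OmE; have /andP[_ h] := Jbnd (U *m x).
  have := U_op x; lra.
apply: spectral_norm_posdef; [exact: posdef_inv|by rewrite mulr_ge0// ltW|].
move=> x; have hle y : 2^-1 * qf Omega0 y <= qf Omega y.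
  by rewrite O0E OmE; have /andP[h _] := Jbnd (U *m y); lra.
have := qf_inv_le pO pOm half0 hle x.
rewrite invmxK => h; have := qf_le_spectral x (ltW Lam0) Sigma_le; lra.
Qed.

(** How far the statistic can be from [trace_stat]: the arithmetic-geometric gap
    and the effect of the tilt on ln det, in the units of the statistic. *)
Definition stat_gap : R :=
  Num.sqrt (n%:R / (2 * p%:R)) * (2 * eta ^+ 2 + 4 * Lam ^+ 2 * p%:R / n%:R).

Lemma stat_near_trace (V Omega : 'M[R]_p) x : posdiag V -> St = V^T *m V ->
  posdefmx Omega -> nsq (V *m Omega *m V^T - 1%:M) <= eta ^+ 2 ->
  x = - (Num.sqrt (trace_shape n p) * ln (\tr (Omega *m St) / p%:R)) ->
  x <= Num.sqrt (n%:R / (2 * p%:R)) *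
    (ln (\det (invmx Omega)) - ln (\det S)) <= x + stat_gap.
Proof.
move=> pV SV pOm Gnear ->.
set q := Num.sqrt (n%:R / (2 * p%:R)).
have q0 : 0 <= q by exact: sqrtr_ge0.
have kq : Num.sqrt (trace_shape n p) = q * p%:R.
  have -> : trace_shape n p = n%:R / (2 * p%:R) * p%:R ^+ 2 :> R.
    by rewrite /trace_shape; field; rewrite gt_eqF.
  by rewrite sqrtrM ?sqrtr_sqr ?ger0_norm ?ler0n// divr_ge0 ?mulr_ge0 ?ler0n.
have sG : (V *m Omega *m V^T)^T = V *m Omega *m V^T.
  by rewrite !trmx_mul trmxK pOm.1 mulmxA.
have := amgm_gap p0 sG eta0 eta_le2 Gnear.
have -> : \tr (V *m Omega *m V^T) = \tr (Omega *m St).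
  by rewrite SV -mulmxA mxtrace_mulC mulmxA.
rewrite (ln_det_gram pV pOm) => /andP[g0 g1].
have /andP[l0 l1] := ln_det_tilt.
have lSt : ln (\det St) = 2 * ln (\det V).
  have dV := posdiag_det_gt0 pV.
  by rewrite SV det_mulmx det_tr lnM ?posrE//; lra.
rewrite kq ln_det_inv// /stat_gap -/q.
set L := ln (\tr _ / _) in g0 g1 *; set LO := ln (\det Omega) in g0 g1 *.
set LS := ln (\det S) in l0 l1 *; set LV := ln (\det V) in g0 g1 lSt.
rewrite lSt in l0 l1.
have -> : - (q * p%:R * L) = q * - (p%:R * L) by ring.
rewrite -mulrDr; apply/andP; split; rewrite ler_wpM2l//; lra.
Qed.

End truth.

(** * Perturbing a density *)

Section sandwich.
Context d (T : measurableType d) (R : realType).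
Variable mu : {measure set T -> \bar R}.
Variables (q f : T -> R) (D A0 A1 B : set T) (Z e e' a0 a1 : R).
Hypotheses (mq : measurable_fun [set: T] q) (q0 : forall v, 0 <= q v).
Hypotheses (mD : measurable D) (mA0 : measurable A0) (mA1 : measurable A1).
Hypotheses (Z0 : 0 < Z) (qZ : (\int[mu]_v (q v)%:E)%E = Z%:E).
Hypotheses (qD : (\int[mu]_v (q v * \1_(~` D) v)%:E <= (e' * Z)%:E)%E).
Hypotheses (qA0 : (\int[mu]_v (q v * \1_A0 v)%:E)%E = (a0 * Z)%:E).
Hypotheses (qA1 : (\int[mu]_v (q v * \1_A1 v)%:E)%E = (a1 * Z)%:E).
Hypotheses (f0 : forall v, 0 <= f v) (fq : forall v, f v <= q v).
Hypotheses (fD : forall v, D v -> (1 - e) * q v <= f v).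
Hypotheses (e0 : 0 <= e) (e'0 : 0 <= e') (ee' : e + e' <= 2^-1).
Hypotheses (A0B : A0 `&` D `<=` B) (BA1 : B `&` D `<=` A1).

Let mqI (A : set T) : measurable A -> measurable_fun [set: T] (fun v => q v * \1_A v).
Proof. by move=> mA; apply: measurable_funM => //; exact: measurable_indic. Qed.

Let qI0 (A : set T) v : 0 <= q v * \1_A v.
Proof. by rewrite mulr_ge0// indicE. Qed.

Let mDC : measurable (~` D). Proof. exact: measurableC. Qed.

Let qAD (A : set T) a : measurable A -> (\int[mu]_v (q v * \1_A v)%:E)%E = (a * Z)%:E ->
  (((a - e') * Z)%:E <= \int[mu]_v (q v * \1_(A `&` D) v)%:E)%E.
Proof.
move=> mA qA; rewrite mulrBl EFinB leeBlDr// -qA.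
apply: (@le_trans _ _ (\int[mu]_v ((q v * \1_(A `&` D) v)%:E + (q v * \1_(~` D) v)%:E))%E).
  apply: ge0_le_integral_nomeas => v; first by rewrite lee_fin.
  rewrite -EFinD lee_fin -mulrDr ler_wpM2l//.
  rewrite !indicE in_setI in_setC.
  by case: (v \in A); case: (v \in D); rewrite ?addr0 ?add0r.
rewrite ge0_integralD//; first exact: leeD2l.
- by move=> v _; rewrite lee_fin.
- by apply/measurable_EFinP; apply: mqI; exact: measurableI.
- by move=> v _; rewrite lee_fin.
- by apply/measurable_EFinP; exact: mqI.
Qed.

Let int_f_ge (A : set T) C a : measurable A -> A `&` D `<=` C ->
  (\int[mu]_v (q v * \1_A v)%:E)%E = (a * Z)%:E ->
  (((1 - e) * ((a - e') * Z))%:E <= \int[mu]_(v in C) (f v)%:E)%E.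
Proof.
move=> mA AC qA; have e1 : 0 <= 1 - e by have := e'0; have := ee'; lra.
apply: (@le_trans _ _ (\int[mu]_v ((1 - e) * (q v * \1_(A `&` D) v))%:E)%E).
  rewrite integral_scale//; last by apply: mqI; exact: measurableI.
  by rewrite EFinM lee_wpmul2l ?lee_fin//; exact: qAD.
rewrite [leRHS]integral_mkcond; apply: ge0_le_integral_nomeas => v.
  by rewrite lee_fin mulr_ge0.
rewrite patchE indicE; case: (boolP (v \in A `&` D)) => [vAD|_].
  by have [Av Dv] := set_mem vAD; rewrite (mem_set (AC _ (conj Av Dv)))/=
    lee_fin mulr1 fD.
by rewrite !mulr0; case: ifP => // _; rewrite lee_fin.
Qed.

Let int_f_le : (\int[mu]_(v in B) (f v)%:E <= ((a1 + e') * Z)%:E)%E.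
Proof.
apply: (@le_trans _ _ (\int[mu]_v ((q v * \1_A1 v)%:E + (q v * \1_(~` D) v)%:E))%E).
  rewrite [leLHS]integral_mkcond; apply: ge0_le_integral_nomeas => v.
    by rewrite patchE; case: ifP => // _; rewrite lee_fin.
  rewrite -EFinD patchE; case: ifPn => [vB|_]; last by rewrite lee_fin addr_ge0.
  rewrite lee_fin -mulrDr; apply: (le_trans (fq v)); rewrite ler_peMr//.
  rewrite !indicE in_setC; case: (boolP (v \in D)) => vD /=.
    have -> : v \in A1 by rewrite mem_set//; apply: BA1; split; exact: set_mem.
    by rewrite addr0.
  by rewrite lerDr.
rewrite ge0_integralD//.
- by rewrite qA1 mulrDl EFinD leeD2l.
- by move=> v _; rewrite lee_fin.
- by apply/measurable_EFinP; exact: mqI.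
- by move=> v _; rewrite lee_fin.
- by apply/measurable_EFinP; exact: mqI.
Qed.

(** A density f below q and close to it on a set D of almost full q-mass gives
    nearly the same probabilities as q.  The set B enters only through
    measurable sets A0 and A1 that enclose it inside D, since what happens
    outside D costs at most the mass e' Z. *)
Lemma density_sandwich :
  a0 - (e + e') <= \int[mu]_(v in B) f v / \int[mu]_v f v <= a1 + 4 * (e + e').
Proof.
have qT : (\int[mu]_v (q v * \1_setT v)%:E)%E = (1 * Z)%:E.
  by rewrite mul1r -qZ; apply: eq_integral => v _; rewrite indicT mulr1.
have q_le (A : set T) a : (\int[mu]_v (q v * \1_A v)%:E)%E = (a * Z)%:E ->
    0 <= a <= 1.
  move=> qA; rewrite -(@pmulr_lge0 _ Z a)//.
  rewrite -(ler_pM2r Z0 a) mul1r -!lee_fin -qA.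
  rewrite integral_ge0/=; last by move=> v _; rewrite lee_fin.
  rewrite -qZ; apply: ge0_le_integral_nomeas => v; rewrite lee_fin//.
  by rewrite ler_piMr// indicE; case: (_ \in _).
have /andP[a00 a01] := q_le _ _ qA0; have /andP[a10 a11] := q_le _ _ qA1.
have M_le : (\int[mu]_v (f v)%:E <= Z%:E)%E.
  by rewrite -qZ; apply: ge0_le_integral_nomeas => v; rewrite lee_fin.
have M_ge := int_f_ge measurableT (@subsetT _ _) qT.
have N_ge := int_f_ge mA0 A0B qA0; have N_le := int_f_le.
have N0 : (0 <= \int[mu]_(v in B) (f v)%:E)%E.
  by apply: integral_ge0 => v _; rewrite lee_fin.
have NM : (\int[mu]_(v in B) (f v)%:E <= \int[mu]_v (f v)%:E)%E.
  by apply: ge0_le_integral_sub => // v _; rewrite lee_fin.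
rewrite /Rintegral.
move: N0 NM M_le M_ge N_ge N_le.
move: (integral mu B _) (integral mu setT _) => [N| |] [M| |]//.
rewrite !lee_fin /= => N0 NM M_le M_ge N_ge N_le.
have eZ : (1 - e) * ((1 - e') * Z) >= (1 - (e + e')) * Z.
  by rewrite mulrA ler_pM2r//; have := mulr_ge0 e0 e'0; nra.
have M0 : 0 < M.
  by apply: lt_le_trans M_ge; apply: lt_le_trans eZ; rewrite mulr_gt0//; have := ee'; lra.
have s2 := ee'; have he := e0; have he' := e'0.
rewrite ler_pdivlMr// ler_pdivrMr//; apply/andP; split.
  have [s0|s0] := leP (a0 - (e + e')) 0.
    by apply: le_trans N0; rewrite pmulr_lle0.
  apply: le_trans N_ge; apply: (@le_trans _ _ ((a0 - (e + e')) * Z)).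
    by rewrite ler_pM2l.
  by rewrite mulrA ler_pM2r//; nra.
apply: (le_trans N_le).
apply: (@le_trans _ _ ((a1 + 4 * (e + e')) * ((1 - (e + e')) * Z))).
  by rewrite [leRHS]mulrA ler_pM2r//; nra.
by rewrite ler_wpM2l ?(le_trans eZ)//; lra.
Qed.

End sandwich.

(** * The posterior on a good sample *)

(** Up to a constant, likelihood times prior is a Wishart density for the
    tilted scale S + (2/n) M times a Gaussian factor centred at M: completing
    the square in exp(-|Omega|^2/2) moves its linear term tr(Omega M) into the
    likelihood.  Centring at the true precision keeps the remaining factor
    close to 1 where the posterior concentrates. *)
Lemma posterior_tilt (R : realType) n p (Lam : R) (x : 'I_n -> p.-tuple R)
    (M : 'M[R]_p) v : (0 < n)%N -> M^T = M ->
  expR (loglik x (symmx v)) * prior_weight Lam (symmx v) =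
  expR (nsq M / 2) *
  (wishart_density n (sample_cov x + (2 / n%:R) *: M) v *
   (\1_(prior_support Lam) (symmx v) * expR (- nsq (symmx v - M) / 2))).
Proof.
move=> n0 sM; rewrite /prior_weight /wishart_density frobenius_sqr.
rewrite !indicE; case: (boolP (symmx v \in _)) => [/set_mem sup|_]; last first.
  by rewrite !mul0r !mulr0.
have vc : v \in @cone R p by apply/mem_set; exact: sup.1.
rewrite vc !mul1r -!expRD; congr expR.
have -> : nsq (symmx v - M) = nsq (symmx v) - 2 * \tr (symmx v *m M) + nsq M.
  have -> : nsq (symmx v - M) = \tr ((symmx v - M) *m (symmx v - M)).
    rewrite nsq_trace; congr (\tr (_ *m _)).
    by rewrite raddfB /= symmx_sym sM.
  rewrite mulmxBl !mulmxBr !raddfB /= (mxtrace_mulC M (symmx v)).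
  by rewrite !nsq_trace symmx_sym sM; ring.
rewrite /loglik mulmxDr -(scalemxAr _ _ M) raddfD /= mxtraceZ.
by field; rewrite pnatr_eq0 -lt0n.
Qed.

Section good_sample.
Context {R : realType}.
Variables (n p : nat) (Lam eta : R) (Sigma U : 'M[R]_p) (x : 'I_n -> p.-tuple R).
Hypotheses (n16 : (16 <= n)%N) (pn : (p.+1 ^ 2 <= n)%N) (p0 : (0 < p)%N).
Hypotheses (Lam0 : 0 < Lam).
Hypotheses (pSigma : posdefmx Sigma) (pU : posdiag U).
Hypotheses (SU : invmx Sigma = U^T *m U).
Hypotheses (Sigma_le : spectral_norm Sigma <= Lam).
Hypotheses (Omega_le : spectral_norm (invmx Sigma) <= Lam).
Hypotheses (eta0 : 0 < eta) (eta_le : eta <= 16^-1).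
Hypotheses (n_le : 4 * Lam ^+ 4 * p%:R / n%:R ^+ 2 <= eta ^+ 2).
Hypotheses (S_near : nsq (U *m sample_cov x *m U^T - 1%:M) <= eta ^+ 2).

Local Notation N := 'C(p.+1, 2).
Local Notation nu := (lebesgue_tuple N).
Local Notation M := (invmx Sigma).
Let S := sample_cov x.
Let St := tilted_cov n Sigma S.
Let n0 : (0 < n)%N. Proof. exact: leq_trans n16. Qed.
Let sS : S^T = S. Proof. exact: sample_cov_sym. Qed.
Let sM : M^T = M. Proof. by have [] := posdef_inv pSigma. Qed.
Let pSt : posdefmx St.
Proof. exact: (tilted_cov_posdef n0 pSigma pU (ltW eta0) eta_le sS S_near). Qed.

Variables (V : 'M[R]_p) (Z : R).
Hypotheses (pV : posdiag V) (SV : St = V^T *m V) (Z0 : 0 < Z).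
Hypothesis (ZE : (\int[nu]_v (wishart_density n St v)%:E)%E = Z%:E).

Let q := wishart_density n St.
Let D : set (N.-tuple R) :=
  @cone R p `&` [set v | nsq (V *m symmx v *m V^T - 1%:M) <= eta ^+ 2].

(** Markov bound for the share of the mass farther than eta in Frobenius norm;
    it serves for the posterior and for the sample covariance. *)
Definition tail_mass : R := 8 * expR 9 * (p ^ 2)%:R / n%:R / eta ^+ 2.
(** Relative variation of the Gaussian prior factor over the same ball. *)
Definition prior_flatness : R := 20 * Lam ^+ 2 * eta ^+ 2.

Let mG : measurable_fun [set: N.-tuple R]
  (fun v => nsq (V *m symmx v *m V^T - 1%:M)).
Proof.
apply: measurable_mx_nsq; apply: measurable_mx_add; last first.
  by apply: measurable_mx_opp; exact: measurable_mx_cst.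
apply: measurable_mx_mul; last exact: measurable_mx_cst.
by apply: measurable_mx_mul; [exact: measurable_mx_cst|exact: measurable_mx_symmx].
Qed.

Let mD : measurable D.
Proof.
apply: measurableI; first exact: measurable_cone.
rewrite (_ : [set v | _] = [set: N.-tuple R] `&`
  (fun v => nsq (V *m symmx v *m V^T - 1%:M)) @^-1` `]-oo, eta ^+ 2]).
  exact: mG.
by rewrite setTI; apply/seteqP; split => v /=; rewrite in_itv.
Qed.

Let mq : measurable_fun [set: N.-tuple R] q.
Proof. exact: measurable_wishart_density. Qed.

Let q0 v : 0 <= q v. Proof. exact: wishart_density_ge0. Qed.

Let tail_mass_ge0 : 0 <= tail_mass.
Proof. by rewrite !mulr_ge0 ?invr_ge0 ?expR_ge0 ?sqr_ge0. Qed.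

Let qDC : (\int[nu]_v (q v * \1_(~` D) v)%:E <= (tail_mass * Z)%:E)%E.
Proof.
have e2 : 0 < eta ^+ 2 by rewrite exprn_gt0.
have mqG : measurable_fun [set: N.-tuple R]
    (fun v => q v * nsq (V *m symmx v *m V^T - 1%:M)).
  exact: measurable_funM.
apply: (@le_trans _ _ (\int[nu]_v ((eta ^+ 2)^-1 *
    (q v * nsq (V *m symmx v *m V^T - 1%:M)))%:E)%E).
  apply: ge0_le_integral_nomeas => v; rewrite lee_fin.
    by rewrite mulr_ge0// indicE.
  rewrite mulrCA indicE in_setC in_setI negb_and.
  case: (boolP (v \in @cone R p)) => vc /=; last first.
    by rewrite /q /wishart_density indicE (negbTE vc) !mul0r.
  case: (boolP (v \in _)) => vG /=.
    by rewrite mulr0 mulr_ge0// mulr_ge0 ?nsq_ge0// invr_ge0 sqr_ge0.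
  rewrite mulr1 ler_peMr// mulrC ler_pdivlMr// mul1r ltW// ltNge.
  by apply: contra vG => h; apply/mem_set.
rewrite [leLHS]integral_scale//; last 2 first.
- by rewrite invr_ge0 sqr_ge0.
- by move=> v; rewrite mulr_ge0// nsq_ge0.
have -> : tail_mass * Z =
    (eta ^+ 2)^-1 * (8 * expR 9 * (p ^ 2)%:R / n%:R * Z).
  by rewrite /tail_mass; ring.
rewrite EFinM lee_wpmul2l//; first by rewrite lee_fin invr_ge0 sqr_ge0.
have h := ZE; rewrite /q SV in h *.
exact: (wishart_moment pV n16 pn p0 h).
Qed.

Let near v : D v -> prior_support Lam (symmx v) /\
  nsq (symmx v - M) <= Lam ^+ 2 * (40 * eta ^+ 2).
Proof.
case=> pv Gv.
exact: (near_truth n0 Lam0 pSigma pU SU Sigma_le Omega_le (ltW eta0) eta_le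
  n_le S_near pV SV pv Gv).
Qed.


Let nR : 0 < n%:R :> R. Proof. by rewrite ltr0n. Qed.

(* the prior weight is compared with the Wishart density in both directions:
   its integral is the normalizing constant of the prior, which has to be finite
   and nonzero *)
Let prior_le v : prior_weight Lam (symmx v) <=
  expR (n%:R / 2 * (2 * Lam * p%:R + 2 * Lam * nsq V)) * q v.
Proof.
rewrite /prior_weight indicE; case: (boolP (_ \in _)) => [/set_mem sup|_]; last first.
  by rewrite mul0r mulr_ge0// expR_ge0.
have [pOm [Om_le Omi_le]] := sup.
have vc : v \in @cone R p by exact/mem_set.
have L0 : 0 <= 2 * Lam by rewrite mulr_ge0// ltW.
rewrite mul1r /q /wishart_density indicE vc mul1r -expRD.
apply: (@le_trans _ _ (expR 0)).
  by rewrite ler_expR mulNr oppr_le0 mulr_ge0// sqr_ge0.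
rewrite ler_expR -mulrBr -mulrDr mulr_ge0 ?divr_ge0 ?(ltW nR)//.
have h1 := ln_det_le_trace (posdef_inv pOm).
rewrite ln_det_inv// in h1.
have h2 : \tr (invmx (symmx v)) <= 2 * Lam * p%:R.
  have := trace_congr_le 1%:M (fun y => qf_le_spectral y L0 Omi_le).
  by rewrite trmx1 mul1mx mulmx1 nsq_trace trmx1 mul1mx mxtrace1.
have h3 : \tr (symmx v *m St) <= 2 * Lam * nsq V.
  have := trace_congr_le V^T (fun y => qf_le_spectral y L0 (ltW Om_le)).
  by rewrite trmxK nsq_tr -mulmxA mxtrace_mulC -mulmxA -SV.
have := ler0n R p; lra.
Qed.

Let prior_ge : exists2 k : R, 0 < k &
  forall v, k * (q v * \1_D v) <= prior_weight Lam (symmx v).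
Proof.
pose b := 2 * nsq M + 2 * (Lam ^+ 2 * (40 * eta ^+ 2)).
exists (expR (- b / 2) * expR (n%:R * ln (\det V))).
  by rewrite mulr_gt0// expR_gt0.
move=> v; rewrite indicE; case: (boolP (v \in D)) => [/set_mem vD|_]; last first.
  by rewrite !mulr0 /prior_weight mulr_ge0 ?expR_ge0.
have [sup dist] := near vD; have [pOm _] := vD.
have vc : v \in @cone R p by exact/mem_set.
rewrite mulr1 /prior_weight indicE (mem_set sup) mul1r frobenius_sqr.
rewrite /q /wishart_density indicE vc mul1r -!expRD ler_expR.
have h1 : nsq (symmx v) <= b.
  rewrite -[symmx v in leLHS](subrK M) (le_trans (nsq_add_le _ _))//.
  by rewrite /b; lra.
have pG : posdefmx (V *m symmx v *m V^T).
  have uV : V^T \in unitmx by rewrite unitmx_tr posdiag_unit.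
  by have := posdef_congr uV pOm; rewrite trmxK.
have := ln_det_le_trace pG; rewrite (ln_det_gram pV pOm) -mulmxA mxtrace_mulC.
rewrite -mulmxA -SV => h2.
rewrite -mulrBr.
have h3 : n%:R * ln (\det V) +
    n%:R / 2 * (ln (\det (symmx v)) - \tr (symmx v *m St)) <= 0.
  have -> : n%:R * ln (\det V) +
    n%:R / 2 * (ln (\det (symmx v)) - \tr (symmx v *m St)) =
    n%:R / 2 * (2 * ln (\det V) + ln (\det (symmx v)) - \tr (symmx v *m St)).
    by field.
  rewrite pmulr_rle0 ?divr_gt0//; have := ler0n R p; lra.
by lra.
Qed.

Hypothesis small : prior_flatness + tail_mass <= 2^-1.

Let flatness_ge0 : 0 <= prior_flatness.
Proof.
by rewrite /prior_flatness mulr_ge0 ?sqr_ge0// mulr_ge0 ?sqr_ge0.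
Qed.

Let prior_mass_gt0 : 0 < \int[nu]_v prior_weight Lam (symmx v).
Proof.
have pw0 v : 0 <= prior_weight Lam (symmx v).
  by rewrite mulr_ge0 ?expR_ge0// indicE.
have up : (\int[nu]_v (prior_weight Lam (symmx v))%:E < +oo)%E.
  apply: (@le_lt_trans _ _ (\int[nu]_v (expR (n%:R / 2 *
    (2 * Lam * p%:R + 2 * Lam * nsq V)) * q v)%:E)%E).
    by apply: ge0_le_integral_nomeas => v; rewrite lee_fin.
  by rewrite integral_scale ?expR_ge0// ZE ltry.
have mqI (A : set (N.-tuple R)) : measurable A ->
    measurable_fun setT (fun v => q v * \1_A v).
  by move=> mA; apply: measurable_funM => //; exact: measurable_indic.
have qI0 (A : set (N.-tuple R)) v : 0 <= q v * \1_A v.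
  by rewrite mulr_ge0// indicE.
have qD : (((1 - tail_mass) * Z)%:E <= \int[nu]_v (q v * \1_D v)%:E)%E.
  rewrite mulrBl mul1r EFinB leeBlDr// -ZE.
  apply: (@le_trans _ _ (\int[nu]_v ((q v * \1_D v)%:E + (q v * \1_(~` D) v)%:E))%E).
    apply: ge0_le_integral_nomeas => v; first by rewrite lee_fin.
    rewrite -EFinD lee_fin -mulrDr !indicE in_setC.
    by case: (_ \in _); rewrite ?addr0 ?add0r mulr1.
  rewrite ge0_integralD//; first exact: leeD2l.
  - by move=> v _; rewrite lee_fin.
  - by apply/measurable_EFinP; exact: mqI.
  - by move=> v _; rewrite lee_fin.
  - by apply/measurable_EFinP; apply: mqI; exact: measurableC.
have [k k0 kP] := prior_ge.
have lo : ((k * ((1 - tail_mass) * Z))%:E <=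
    \int[nu]_v (prior_weight Lam (symmx v))%:E)%E.
  apply: (@le_trans _ _ (\int[nu]_v (k * (q v * \1_D v))%:E)%E).
    rewrite integral_scale ?(ltW k0)//; last exact: mqI.
    by rewrite EFinM lee_wpmul2l// lee_fin ltW.
  by apply: ge0_le_integral_nomeas => v; rewrite lee_fin// mulr_ge0// ltW.
have lo0 : 0 < k * ((1 - tail_mass) * Z).
  rewrite !mulr_gt0//; have := small; have := flatness_ge0; lra.
rewrite /Rintegral; move: lo up; case: (integral _ _ _) => [r| |]//=.
by rewrite lee_fin => h _; exact: lt_le_trans h.
Qed.

Let f v := expR (loglik x (symmx v)) * prior_pdf Lam (symmx v).
Let k := expR (nsq M / 2) / \int[nu]_v prior_weight Lam (symmx v).

Let k0 : 0 < k. Proof. by rewrite divr_gt0 ?expR_gt0//; exact: prior_mass_gt0. Qed.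

Let fE v : f v = k * q v *
  (\1_(prior_support Lam) (symmx v) * expR (- nsq (symmx v - M) / 2)).
Proof.
rewrite /f /prior_pdf mulrA (posterior_tilt Lam x v n0 sM) /k.
by rewrite -[wishart_density _ _ _]/(q v); ring.
Qed.

Let f_ge0 v : 0 <= f v.
Proof.
by rewrite fE mulr_ge0//; rewrite mulr_ge0// ltW.
Qed.

Let f_le v : f v <= k * q v.
Proof.
have kq0 : 0 <= k * q v by rewrite mulr_ge0// ltW.
rewrite fE ler_piMr// -[1]mulr1 ler_pM ?expR_ge0//.
by rewrite -expR0 ler_expR mulNr oppr_le0 divr_ge0// nsq_ge0.
Qed.

Let f_near v : D v -> (1 - prior_flatness) * (k * q v) <= f v.
Proof.
move=> vD; have [sup dist] := near vD.
have kq0 : 0 <= k * q v by rewrite mulr_ge0// ltW.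
rewrite fE mulrC ler_wpM2l// indicE (mem_set sup) mul1r.
apply: le_trans (expR_ge1Dx _).
rewrite lerD2l mulNr lerN2 ler_pdivrMr//; apply: (le_trans dist).
by rewrite /prior_flatness le_eqVlt; apply/orP; left; apply/eqP; ring.
Qed.

Variable e : R.
Hypotheses (shape_ge : 36 <= trace_shape n p :> R).
Hypotheses (tilt_le : trace_tilt n p <= 1 :> R).
Let F (t : R) : R := \int[lebesgue_measure]_(y in `]-oo, t])
    log_gamma (trace_shape n p) (trace_tilt n p) y /
  \int[lebesgue_measure]_y log_gamma (trace_shape n p) (trace_tilt n p) y.
Hypothesis normal_approx : forall t,
  `|F t - fine (normal_prob 0 1 `]-oo, t])| <= e.

(** [density_sandwich] for the posterior integrand f and a multiple of the
    Wishart density, D being the ball where the statistic is within [stat_gap]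
    of [trace_stat]; the resulting shift of t is absorbed by the Lipschitz
    continuity of the normal distribution function. *)
Lemma posterior_cdf t :
  `|posterior Lam x [set Omega : 'M[R]_p |
      Num.sqrt (n%:R / (2 * p%:R)) *
      (ln (\det (invmx Omega)) - ln (\det (sample_cov x))) <= t] -
    fine (normal_prob 0 1 `]-oo, t])| <=
  e + stat_gap n p Lam eta + 4 * (prior_flatness + tail_mass).
Proof.
set B := [set _ | _]; set rho := stat_gap n p Lam eta.
have postE : posterior Lam x B =
    \int[nu]_(v in @symmx R p @^-1` B) f v / \int[nu]_v f v.
  by rewrite /posterior /prior_int preimage_setT.
rewrite postE.
have tilt01 : 0 <= (trace_tilt n p : R) <= 1.
  by rewrite tilt_le andbT /trace_tilt divr_ge0 ?sqrtr_ge0.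
have mA s : measurable (trace_stat n St @^-1` `]-oo, s]).
  by rewrite -[X in measurable X]setTI; exact: measurable_trace_stat.
have mqI (A : set (N.-tuple R)) : measurable A ->
    measurable_fun setT (fun v => q v * \1_A v).
  by move=> mA'; apply: measurable_funM => //; exact: measurable_indic.
have scaleI (A : set (N.-tuple R)) : measurable A ->
    (\int[nu]_v (k * q v * \1_A v)%:E = k%:E * \int[nu]_v (q v * \1_A v)%:E)%E.
  move=> mA'; under eq_integral do rewrite -mulrA.
  rewrite [LHS]integral_scale//; [exact: ltW|exact: mqI|].
  by move=> v; rewrite mulr_ge0// indicE.
have law s : (\int[nu]_v (k * q v * \1_(trace_stat n St @^-1` `]-oo, s]) v)%:E =
    (F s * (k * Z))%:E)%E.
  rewrite scaleI// (trace_law n0 p0 pSt shape_ge tilt01 Z0 ZE s) -EFinM.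
  by congr (_%:E); rewrite /F; ring.
have kZ : (\int[nu]_v (k * q v)%:E = (k * Z)%:E)%E.
  by rewrite [LHS]integral_scale ?(ltW k0)// ZE EFinM.
have kDC : (\int[nu]_v (k * q v * \1_(~` D) v)%:E <= (tail_mass * (k * Z))%:E)%E.
  rewrite scaleI; last exact: measurableC.
  have -> : tail_mass * (k * Z) = k * (tail_mass * Z) by ring.
  by rewrite [leRHS]EFinM; apply: lee_wpmul2l => //; rewrite lee_fin ltW.
have near_stat v : D v -> trace_stat n St v <=
    Num.sqrt (n%:R / (2 * p%:R)) *
    (ln (\det (invmx (symmx v))) - ln (\det S)) <= trace_stat n St v + rho.
  case=> pv Gv.
  exact: (stat_near_trace n0 p0 pSigma pU SU Omega_le (ltW eta0) eta_le
    sS S_near pV SV pv Gv erefl).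
have mkq : measurable_fun [set: N.-tuple R] (fun v => k * q v).
  exact: measurable_funM.
have kq0 v : 0 <= k * q v by rewrite mulr_ge0// ltW.
have lo : (trace_stat n St @^-1` `]-oo, t - rho]) `&` D `<=` @symmx R p @^-1` B.
  move=> v [/= Xv vD]; rewrite in_itv /= in Xv.
  by have /andP[_ h] := near_stat v vD; rewrite /B/= (le_trans h)//; lra.
have up : (@symmx R p @^-1` B) `&` D `<=` trace_stat n St @^-1` `]-oo, t].
  move=> v [/= Bv vD]; rewrite /preimage/= in_itv /=.
  by have /andP[h _] := near_stat v vD; exact: le_trans h Bv.
have := density_sandwich mkq kq0 mD (mA (t - rho)) (mA t) (mulr_gt0 k0 Z0) kZ
  kDC (law (t - rho)) (law t) f_ge0 f_le f_near flatness_ge0 tail_mass_ge0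
  small lo up.
have rho0 : 0 <= rho.
  rewrite /rho /stat_gap mulr_ge0 ?sqrtr_ge0// addr_ge0 ?mulr_ge0//;
    exact: ltW.
have lip := @normal_cdf_lip R (t - rho) t (ltac:(by rewrite lerBlDr lerDl)).
have := normal_approx (t - rho); have := normal_approx t.
rewrite !ler_norml => /andP[h1 h2] /andP[h3 h4] /andP[h5 h6].
move: h1 h2 h3 h4 h5 h6 lip flatness_ge0 tail_mass_ge0 rho0.
move: (fine _) (fine _) (F _) (F _) (_ / _) => a b c g r *.
by apply/andP; split; lra.
Qed.

End good_sample.

(** * Rates *)

Section rates.
Context {R : realType}.
Variables (n p : nat).
Hypotheses (p0 : (0 < p)%N) (L1 : 1 <= ln (n%:R : R)).

Local Notation L := (ln (n%:R : R)).
Local Notation r := (p%:R ^+ 3 * L ^+ 2 / n%:R).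

(** The Frobenius radius in which the relative errors are localised; their
    mean square is of order p^2/n, and the factor ln n makes the complement
    negligible. *)
Definition near_radius : R := Num.sqrt (L * p%:R ^+ 2 / n%:R).

Let n0 : 0 < n%:R :> R.
Proof.
rewrite lt_neqAle ler0n andbT; apply: contraTneq L1 => <-.
by rewrite ln0// -ltNge ltr01.
Qed.

Let p1 : 1 <= p%:R :> R. Proof. by rewrite ler1n. Qed.

Let Ln : L <= n%:R.
Proof.
have := @le_ln1Dx R (n%:R - 1) (ltac:(by rewrite ltrBrDr addrC subrr)).
by rewrite addrC subrK; lra.
Qed.

Lemma near_radius_sqr : near_radius ^+ 2 = L * p%:R ^+ 2 / n%:R.
Proof.
by rewrite sqr_sqrtr// divr_ge0 ?mulr_ge0 ?(ltW n0)// (le_trans ler01).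
Qed.

Lemma near_radius_gt0 : 0 < near_radius.
Proof.
rewrite sqrtr_gt0 divr_gt0// mulr_gt0 ?exprn_gt0 ?(lt_le_trans ltr01)//.
Qed.

Lemma near_radius_le : near_radius ^+ 2 <= r.
Proof.
rewrite near_radius_sqr ler_pM2r ?invr_gt0//.
have -> : p%:R ^+ 3 * L ^+ 2 = (L * p%:R ^+ 2) * (p%:R * L) by ring.
rewrite ler_peMr//; first by rewrite mulr_ge0// (le_trans ler01).
by rewrite mulr_ege1.
Qed.

Lemma tail_massE : tail_mass n p near_radius = 8 * expR 9 / L.
Proof.
rewrite /tail_mass near_radius_sqr natrX; field.
by rewrite !gt_eqF// ?(lt_le_trans ltr01).
Qed.

Lemma cube_le : p%:R ^+ 3 <= r * n%:R.
Proof.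
rewrite divfK ?gt_eqF// ler_peMr ?exprn_ge0//.
by rewrite expr_ge1 ?(le_trans ler01).
Qed.

Lemma square_le : r <= 4^-1 -> (p.+1 ^ 2 <= n)%N.
Proof.
move=> r4; rewrite -(ler_nat R) natrX -natr1.
have h := cube_le.
apply: (@le_trans _ _ (4 * p%:R ^+ 3)).
  by have := p1; nra.
rewrite -ler_pdivlMl//; apply: (le_trans h).
by rewrite ler_pM2r.
Qed.

Lemma prior_flatness_le (Lam C : R) : 0 <= Lam <= C ->
  prior_flatness Lam near_radius <= 20 * C ^+ 2 * r.
Proof.
move=> /andP[Lam0 LamC]; rewrite /prior_flatness ler_pM ?sqr_ge0//; first by rewrite mulr_ge0 ?sqr_ge0.
  by rewrite ler_pM2l// lerXn2r ?nnegrE// (le_trans Lam0).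
exact: near_radius_le.
Qed.

Lemma tilt_shift_le (Lam C : R) : 0 <= Lam <= C -> 4 * C ^+ 4 <= L ->
  4 * Lam ^+ 4 * p%:R / n%:R ^+ 2 <= near_radius ^+ 2.
Proof.
move=> /andP[Lam0 LamC] CL; rewrite near_radius_sqr.
have -> : L * p%:R ^+ 2 / n%:R = (L * p%:R * p%:R * n%:R) / n%:R ^+ 2.
  by field; rewrite gt_eqF.
rewrite ler_pM2r ?invr_gt0 ?exprn_gt0//.
have h1 : 4 * Lam ^+ 4 <= L.
  by apply: le_trans CL; rewrite ler_pM2l// lerXn2r ?nnegrE// (le_trans Lam0).
have L0 : 0 <= L by rewrite (le_trans ler01).
rewrite -[leRHS]mulrA ler_pM ?mulr_ge0 ?exprn_ge0//.
  by apply: (le_trans h1); rewrite ler_peMr.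
rewrite ler_peMr//; by rewrite (le_trans L1).
Qed.

Lemma shape_ge : L / 2 <= trace_shape n p.
Proof.
by rewrite /trace_shape ler_pM2r// (le_trans Ln)// ler_peMr// ltW.
Qed.

Lemma trace_tilt_le (K : R) : 0 <= K -> 2 * K ^+ 2 * r <= 1 ->
  K * trace_tilt n p <= 1.
Proof.
move=> K0 Kr.
have t0 : 0 <= trace_tilt n p :> R by rewrite /trace_tilt divr_ge0 ?sqrtr_ge0.
rewrite -(@ler_pXn2r _ 2)// ?nnegrE ?mulr_ge0// expr1n exprMn.
apply: le_trans Kr; have -> : 2 * K ^+ 2 * r = K ^+ 2 * (r * 2) by ring.
rewrite ler_wpM2l ?sqr_ge0//.
have k0 : 0 < trace_shape n p :> R.
  by rewrite /trace_shape divr_gt0// mulr_gt0// (lt_le_trans ltr01).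
rewrite /trace_tilt exprMn exprVn sqr_sqrtr ?(ltW k0)//.
have NE : ('C(p.+1, 2))%:R = p%:R * (p%:R + 1) / 2 :> R.
  elim: (p) => [|j IH]; first by rewrite bin_small// !mul0r.
  by rewrite binS2 natrD IH -natr1; field.
rewrite NE ler_pdivrMr// /trace_shape.
have -> : r * 2 * (n%:R * p%:R / 2) = (r * n%:R) * p%:R.
  by field; rewrite gt_eqF.
apply: (@le_trans _ _ (p%:R ^+ 3 * p%:R)); last first.
  by rewrite ler_pM2r ?(lt_le_trans ltr01)//; exact: cube_le.
rewrite (_ : p%:R ^+ 3 * p%:R = (p%:R * (p%:R + p%:R) / 2) ^+ 2); last by field.
rewrite lerXn2r ?nnegrE ?divr_ge0 ?mulr_ge0 ?addr_ge0//.
by rewrite ler_pM2r// ler_pM2l ?(lt_le_trans ltr01)// lerD2l.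
Qed.

Lemma stat_gap_le (Lam C g : R) : 0 <= Lam <= C -> 0 <= g ->
  (2 + 4 * C ^+ 2) ^+ 2 / 2 * r <= g ^+ 2 ->
  stat_gap n p Lam near_radius <= g.
Proof.
move=> /andP[Lam0 LamC] g0 gr; rewrite /stat_gap near_radius_sqr.
have L0 : 0 <= L by rewrite (le_trans ler01).
have P0 : 0 < p%:R :> R by rewrite (lt_le_trans ltr01).
have q0 : 0 <= n%:R / (2 * p%:R) :> R by rewrite divr_ge0// mulr_ge0.
have b0 : 0 <= 2 * (L * p%:R ^+ 2 / n%:R) + 4 * Lam ^+ 2 * p%:R / n%:R.
  by rewrite addr_ge0 ?mulr_ge0 ?sqr_ge0// invr_ge0 ltW.
rewrite -(@ler_pXn2r _ 2)// ?nnegrE ?mulr_ge0 ?sqrtr_ge0//.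
rewrite exprMn sqr_sqrtr//; apply: le_trans gr.
have C0 : 0 <= C by rewrite (le_trans Lam0).
have h : 2 * (L * p%:R ^+ 2 / n%:R) + 4 * Lam ^+ 2 * p%:R / n%:R <=
    (2 + 4 * C ^+ 2) * (L * p%:R ^+ 2 / n%:R).
  have LC2 : 4 * Lam ^+ 2 <= 4 * C ^+ 2 by rewrite ler_pM2l// lerXn2r ?nnegrE.
  have pLp : p%:R / n%:R <= L * p%:R ^+ 2 / n%:R.
    rewrite ler_pM2r ?invr_gt0// expr2 mulrA ler_peMl ?(ltW P0)//.
    by rewrite mulr_ege1.
  rewrite [leRHS]mulrDl lerD2l -[leLHS]mulrA ler_pM ?mulr_ge0 ?sqr_ge0//.
apply: (@le_trans _ _ (n%:R / (2 * p%:R) *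
    ((2 + 4 * C ^+ 2) * (L * p%:R ^+ 2 / n%:R)) ^+ 2)).
  by rewrite ler_wpM2l// lerXn2r ?nnegrE// (le_trans b0).
by rewrite le_eqVlt; apply/orP; left; apply/eqP; field; rewrite !gt_eqF.
Qed.

End rates.

(** * Expected deviation *)

Section deviation.
Context {R : realType}.

Lemma Rintegral_ratio01 d (T : measurableType d)
    (mu : {measure set T -> \bar R}) (B : set T) (f : T -> R) :
  (forall v, 0 <= f v) -> 0 <= \int[mu]_(v in B) f v / \int[mu]_v f v <= 1.
Proof.
move=> f0; rewrite /Rintegral.
have N0 : (0 <= \int[mu]_(v in B) (f v)%:E)%E.
  by apply: integral_ge0 => v _; rewrite lee_fin.
have NM : (\int[mu]_(v in B) (f v)%:E <= \int[mu]_v (f v)%:E)%E.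
  by apply: ge0_le_integral_sub => // v _; rewrite lee_fin.
move: N0 NM; case: (integral mu B _) => [N| |]; case: (integral mu setT _) => [M| |];
  rewrite ?lee_fin//= ?invr0 ?mulr0 ?mul0r ?ler01 ?lexx// => N0 NM.
rewrite divr_ge0 ?(le_trans N0)//=.
have [->|M0] := eqVneq M 0; first by rewrite invr0 mulr0 ler01.
by rewrite ler_pdivrMr ?mul1r// lt_neqAle eq_sym M0 (le_trans N0).
Qed.

Lemma posterior01 n p (Lam : R) (x : 'I_n -> p.-tuple R) B :
  0 <= posterior Lam x B <= 1.
Proof.
rewrite /posterior /prior_int preimage_setT; apply: Rintegral_ratio01 => v.
have pw0 Omega : 0 <= prior_weight Lam Omega :> R.
  by rewrite mulr_ge0 ?expR_ge0// indicE.
rewrite mulr_ge0 ?expR_ge0// divr_ge0//.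
apply: fine_ge0; apply: integral_ge0 => w _; by rewrite lee_fin.
Qed.

Lemma sup_norm_le (g : R -> R) b : (forall t, `|g t| <= b) ->
  sup [set `|g t| | t in [set: R]] <= b.
Proof.
move=> gb; apply: ge_sup; first by exists `|g 0|, 0.
by move=> _ [t _ <-].
Qed.

Lemma sup_norm_ge0 (g : R -> R) b : (forall t, `|g t| <= b) ->
  0 <= sup [set `|g t| | t in [set: R]].
Proof.
move=> gb; apply: (@le_trans _ _ `|g 0|) => //; apply: ub_le_sup; last by exists 0.
by exists b => _ [t _ <-].
Qed.

(** Outside the event that the sample covariance is within eta of the truth
    the deviation is at most 1, hence at most the squared error over eta^2,
    whose expectation is the same tail mass as for the posterior. *)
Lemma expected_deviation d (T : measurableType d) (P : probability T R) n p
    (X : 'I_n -> {RV P >-> p.-tuple R}) (Sigma : 'M[R]_p) (Lam eta e : R) :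
  (16 <= n)%N -> (p.+1 ^ 2 <= n)%N -> (0 < p)%N -> 0 < Lam ->
  posdefmx Sigma ->
  Num.max (spectral_norm Sigma) (spectral_norm (invmx Sigma)) <= Lam ->
  iid_mvnormal X Sigma ->
  0 < eta -> eta <= 16^-1 ->
  4 * Lam ^+ 4 * p%:R / n%:R ^+ 2 <= eta ^+ 2 ->
  prior_flatness Lam eta + tail_mass n p eta <= 2^-1 ->
  36 <= trace_shape n p :> R -> trace_tilt n p <= 1 :> R ->
  (forall t, `|\int[lebesgue_measure]_(y in `]-oo, t])
      log_gamma (trace_shape n p) (trace_tilt n p) y /
    \int[lebesgue_measure]_y log_gamma (trace_shape n p) (trace_tilt n p) y -
    fine (normal_prob 0 1 `]-oo, t])| <= e) ->
  let dev := 'E_P[(fun w =>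
    sup [set `|posterior Lam (fun i => X i w)
                 [set Omega : 'M[R]_p |
                   Num.sqrt (n%:R / (2 * p%:R)) *
                   (ln (\det (invmx Omega)) -
                    ln (\det (sample_cov (fun i => X i w)))) <= t]
               - fine (normal_prob 0 1 `]-oo, t])|
        | t in [set: R]])%R]%E in
  (0 <= dev)%E /\
  (dev <= (e + stat_gap n p Lam eta + 4 * prior_flatness Lam eta +
    5 * tail_mass n p eta)%:E)%E.
Proof.
move=> n16 pn p0 Lam0 pSigma; rewrite ge_max => /andP[Sle Ole] iid eta0 eta_le.
move=> n_le small k36 th1 approx /=.
have n0 : (0 < n)%N by rewrite (leq_trans _ n16).
have [U pU SU] := cholesky (posdef_inv pSigma).
have bound1 w t : `|posterior Lam (fun i => X i w)
                 [set Omega : 'M[R]_p |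
                   Num.sqrt (n%:R / (2 * p%:R)) *
                   (ln (\det (invmx Omega)) -
                    ln (\det (sample_cov (fun i => X i w)))) <= t]
               - fine (normal_prob 0 1 `]-oo, t])| <= 1.
  have := posterior01 Lam (fun i => X i w) [set Omega : 'M[R]_p |
                   Num.sqrt (n%:R / (2 * p%:R)) *
                   (ln (\det (invmx Omega)) -
                    ln (\det (sample_cov (fun i => X i w)))) <= t].
  move: (posterior _ _ _) => a /andP[a0 a1].
  have b0 : 0 <= fine (normal_prob (0 : R) 1 `]-oo, t]) by rewrite fine_ge0.
  have b1 : fine (normal_prob (0 : R) 1 `]-oo, t]) <= 1.
    by rewrite -lee_fin fineK ?fin_num_measure// probability_le1.
  by rewrite ler_norml; apply/andP; split; lra.
set e1 := e + stat_gap n p Lam eta + 4 * (prior_flatness Lam eta + tail_mass n p eta).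
have e1_ge0 : 0 <= e1.
  have e0 : 0 <= e by exact: le_trans (approx 0).
  have gap0 : 0 <= stat_gap n p Lam eta.
    rewrite /stat_gap mulr_ge0 ?sqrtr_ge0// addr_ge0 ?mulr_ge0//;
      exact: ltW.
  have flat0 : 0 <= prior_flatness Lam eta.
    by rewrite /prior_flatness mulr_ge0 ?sqr_ge0// mulr_ge0 ?sqr_ge0.
  have tail0 : 0 <= tail_mass n p eta.
    by rewrite !mulr_ge0 ?invr_ge0 ?expR_ge0 ?sqr_ge0.
  by rewrite /e1 addr_ge0 ?mulr_ge0 ?addr_ge0.
rewrite expectation.unlock; split.
  by apply: integral_ge0 => w _; rewrite lee_fin; apply: sup_norm_ge0 (bound1 w).
have mG : measurable_fun [set: T] (fun w =>
    nsq (U *m sample_cov (fun i => X i w) *m U^T - 1%:M)).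
  apply: measurable_mx_nsq; apply: measurable_mx_add; last first.
    by apply: measurable_mx_opp; exact: measurable_mx_cst.
  apply: measurable_mx_mul; last exact: measurable_mx_cst.
  by apply: measurable_mx_mul; [exact: measurable_mx_cst|exact: measurable_mx_sample_cov].
have e2 : 0 < eta ^+ 2 by rewrite exprn_gt0.
apply: (@le_trans _ _ (\int[P]_w (e1%:E + ((eta ^+ 2)^-1 *
    nsq (U *m sample_cov (fun i => X i w) *m U^T - 1%:M))%:E))%E).
  apply: ge0_le_integral_nomeas => w.
    by rewrite lee_fin; apply: sup_norm_ge0 (bound1 w).
  rewrite -EFinD lee_fin.
  have [near|far] := leP (nsq (U *m sample_cov (fun i => X i w) *m U^T - 1%:M))
    (eta ^+ 2).
    rewrite -[leLHS]addr0 lerD//; last by rewrite mulr_ge0 ?nsq_ge0// invr_ge0 ltW.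
    apply: sup_norm_le => t.
    have pSt := tilted_cov_posdef n0 pSigma pU (ltW eta0) eta_le
      (sample_cov_sym _) near.
    have [V pV SV] := cholesky pSt.
    have [Z Z0 ZE] := wishart_total pV n0 p0; rewrite -SV in ZE.
    exact: (posterior_cdf n16 pn p0 Lam0 pSigma pU SU Sle Ole eta0 eta_le n_le
      near pV SV Z0 ZE small k36 th1 approx t).
  rewrite -[leLHS]add0r lerD//; apply: (@le_trans _ _ 1).
    exact: sup_norm_le (bound1 w).
  by rewrite mulrC ler_pdivlMr// mul1r ltW.
rewrite ge0_integralD//; last 2 first.
- by move=> w _; rewrite lee_fin mulr_ge0 ?nsq_ge0// invr_ge0 ltW.
- by apply/measurable_EFinP; apply: measurable_funM.
rewrite [X in (X + _)%E](_ : _ = e1%:E); last first.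
  by rewrite integral_cst//= probability_setT mule1.
rewrite integral_scale//; last 2 first.
- by rewrite invr_ge0 ltW.
- by move=> w; exact: nsq_ge0.
apply: (@le_trans _ _ (e1%:E + (eta ^+ 2)^-1%:E *
   (8 * expR 9 * (p ^ 2)%:R / n%:R)%:E)%E).
  apply: leeD2l; apply: lee_wpmul2l; first by rewrite lee_fin invr_ge0 ltW.
  exact: sampling_moment iid pU SU n16.
rewrite -EFinM -EFinD lee_fin /e1 /tail_mass le_eqVlt; apply/orP; left.
by apply/eqP; ring.
Qed.

End deviation.

Theorem corollary3p6 (R : realType)
    (p : nat -> nat) (Lam : nat -> R) (Sigma : forall n, 'M[R]_(p n))
    (d : nat -> measure_display) (T : forall n, measurableType (d n))
    (P : forall n, probability (T n) R)
    (X : forall n, 'I_n -> {RV (P n) >-> (p n).-tuple R})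
    (p_infty : p @ \oo --> \oo)
    (Lam_gt0 : forall n, 0 < Lam n)
    (Lam_O1 : Lam =O_\oo (fun=> 1 : R))
    (Sigma_posdef : forall n, posdefmx (Sigma n))
    (Sigma_bound : forall n,
      Num.max (spectral_norm (Sigma n)) (spectral_norm (invmx (Sigma n)))
        <= Lam n)
    (X_iid : forall n, iid_mvnormal (X n) (Sigma n))
    (p_rate : (p n)%:R ^+ 3 * ln (n%:R : R) ^+ 2 / n%:R @[n --> \oo] --> (0 : R)) :
  ('E_(P n)[(fun w =>
    sup [set `|posterior (Lam n) (fun i => X n i w)
                 [set Omega : 'M[R]_(p n) |
                   Num.sqrt (n%:R / (2 * (p n)%:R)) *
                   (ln (\det (invmx Omega)) -
                    ln (\det (sample_cov (fun i => X n i w)))) <= t]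
               - fine (normal_prob 0 1 `]-oo, t])|
        | t in [set: R]])%R])%E @[n --> \oo] --> 0%E.
Proof.
have [C C0 LamC] : exists2 C : R, 0 < C & \forall n \near \oo, Lam n <= C.
  move/eqO_exP: Lam_O1 => [C C0 h]; exists C => //.
  near=> n; have : `|Lam n| <= C * `|1 : R| by near: n.
  by rewrite normr1 mulr1; apply: le_trans; exact: ler_norm.
have small_dev (e : R) : 0 < e -> \forall n \near \oo,
  let dev := ('E_(P n)[(fun w =>
    sup [set `|posterior (Lam n) (fun i => X n i w)
                 [set Omega : 'M[R]_(p n) |
                   Num.sqrt (n%:R / (2 * (p n)%:R)) *
                   (ln (\det (invmx Omega)) -
                    ln (\det (sample_cov (fun i => X n i w)))) <= t]
               - fine (normal_prob 0 1 `]-oo, t])|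
        | t in [set: R]])%R])%E in (0 <= dev)%E /\ (dev <= e%:E)%E.
  move=> e0.
  have e40 : 0 < e / 4 by rewrite divr_gt0.
  have [K K36 approx] := log_gamma_normal e40.
  (* the error is e/4 for the normal limit, e/4 for the gap, and 9 terms of
     size at most s <= e/32; the bounds r0 on the rate and L0 on ln n are what
     these and the smallness conditions on eta require *)
  pose s := Num.min 4^-1 (e / 32).
  have s0 : 0 < s by rewrite lt_min invr_gt0 ltr0n divr_gt0.
  have s4 : s <= 4^-1 by rewrite ge_min lexx.
  have s32 : s <= e / 32 by rewrite ge_min lexx orbT.
  pose r0 := Num.min (Num.min (16^-1 ^+ 2) (s / (20 * C ^+ 2)))
    (Num.min (2 * K ^+ 2)^-1 ((e / 4) ^+ 2 / ((2 + 4 * C ^+ 2) ^+ 2 / 2))).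
  have K0 : 0 < K by rewrite (lt_le_trans _ K36).
  have C20 : 0 < 20 * C ^+ 2 by rewrite mulr_gt0 ?exprn_gt0.
  have C4 : 0 < (2 + 4 * C ^+ 2) ^+ 2 / 2.
    by rewrite divr_gt0// exprn_gt0// addr_gt0// mulr_gt0 ?exprn_gt0.
  have K20 : 0 < 2 * K ^+ 2 by rewrite mulr_gt0 ?exprn_gt0.
  have r00 : 0 < r0.
    rewrite !lt_min; apply/andP; split; apply/andP; split.
    - by rewrite exprn_gt0 ?invr_gt0.
    - by rewrite divr_gt0.
    - by rewrite invr_gt0.
    - by rewrite divr_gt0 ?exprn_gt0.
  pose L0 := Num.max (Num.max 1 (2 * K)) (Num.max (4 * C ^+ 4) (8 * expR 9 / s)).
  have p_gt0 : \forall n \near \oo, (0 < p n)%N := p_infty _ (nbhs_infty_gt 0).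
  have n_ge := nbhs_infty_ger (expR L0).
  have rate : \forall n \near \oo,
      (p n)%:R ^+ 3 * ln (n%:R : R) ^+ 2 / n%:R <= r0.
    exact: (cvgr_le 0).
  near=> n.
  have p0 : (0 < p n)%N by near: n.
  have LnC : Lam n <= C by near: n.
  have L_ge : L0 <= ln (n%:R : R).
    have h : expR L0 <= n%:R by near: n.
    by rewrite -(expRK L0) ler_ln// posrE ?expR_gt0// (lt_le_trans (expR_gt0 L0)).
  have r_le : (p n)%:R ^+ 3 * ln (n%:R : R) ^+ 2 / n%:R <= r0.
    by near: n.
  have n16 : (16 <= n)%N by near: n; exact: nbhs_infty_ge.
  move: L_ge r_le; rewrite !ge_max !le_min.
  move=> /andP[/andP[L1 LK] /andP[LC Ls]] /andP[/andP[r16 rs] /andP[rK rg]].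
  have LamnC : 0 <= Lam n <= C by rewrite LnC andbT ltW.
  have L_gt0 : 0 < ln (n%:R : R) by rewrite (lt_le_trans ltr01).
  have flat_le : prior_flatness (Lam n) (near_radius n (p n)) <= s.
    apply: (le_trans (prior_flatness_le p0 L1 LamnC)).
    by rewrite mulrC -ler_pdivlMr.
  have tail_le : tail_mass n (p n) (near_radius n (p n)) <= s :> R.
    by rewrite tail_massE// ler_pdivrMr// -ler_pdivrMl// mulrC.
  have gap_le : stat_gap n (p n) (Lam n) (near_radius n (p n)) <= e / 4.
    apply: (stat_gap_le p0 L1 LamnC (ltW e40)).
    by rewrite mulrC -ler_pdivlMr.
  have tiltK : K * trace_tilt n (p n) <= 1.
    by apply: (trace_tilt_le p0 L1 (ltW K0)); rewrite mulrC -ler_pdivlMr ?mul1r.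
  have tilt0 : 0 <= trace_tilt n (p n) :> R.
    by rewrite /trace_tilt divr_ge0 ?sqrtr_ge0.
  have tilt1 : trace_tilt n (p n) <= 1 :> R.
    apply: le_trans tiltK; rewrite ler_peMl//; apply: le_trans K36.
    by rewrite ler1n.
  have shapeK : K <= trace_shape n (p n).
    by apply: le_trans (shape_ge p0 L1); rewrite ler_pdivlMr// mulrC.
  have radius_le : near_radius n (p n) <= 16^-1 :> R.
    rewrite -(@ler_pXn2r _ 2)// ?nnegrE ?invr_ge0 ?sqrtr_ge0//.
    exact: le_trans (near_radius_le p0 L1) r16.
  have r4 : (p n)%:R ^+ 3 * ln (n%:R : R) ^+ 2 / n%:R <= 4^-1.
    apply: (le_trans r16); lra.
  have [h1 h2] := expected_deviation n16 (square_le p0 L1 r4) p0 (Lam_gt0 n)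
    (Sigma_posdef n) (Sigma_bound n) (X_iid n) (near_radius_gt0 p0 L1) radius_le
    (tilt_shift_le p0 L1 LamnC LC) (ltac:(lra)) (le_trans K36 shapeK) tilt1
    (approx _ _ shapeK tilt0 tiltK).
  split => //; apply: (le_trans h2); rewrite lee_fin; lra.
apply/fine_cvgP; split.
  have := small_dev 1 ltr01; apply: filterS => n [h1 h2].
  by rewrite ge0_fin_numE// (le_lt_trans h2)// ltry.
apply/cvgrPdist_le => e e0; have := small_dev e e0; apply: filterS => n [h1 h2].
rewrite sub0r normrN ger0_norm ?fine_ge0//.
rewrite -lee_fin fineK// ge0_fin_numE// (le_lt_trans h2)// ltry.
Unshelve. all: by end_near.
Qed.
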